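(* Let $M$ be a connected oriented smooth $4$-manifold with an $\mathrm{SU}(2)$-structure $\boldsymbol{\omega}=(\omega_1,\omega_2,\omega_3)$ and torsion $1$-forms $a_1,a_2,a_3$. All second-order invariants of the $\mathrm{SU}(2)$-structure can be expressed (to highest order, i.e. modulo lower-order terms quadratic in the torsion) from the following linearly independent terms: 1. the $9$ functions $\delta a_1,\delta a_2,\delta a_3$ and $g(da_i,\omega_j)$, where $1\le i\le j\le 3$; 2. the $12$ anti-self-dual $2$-forms $\pi^2_-(da_i)$, where $i=1,2,3$, and $S^2_{0,j}(\nabla a_i)\diamond\omega_j$, where $i,j=1,2,3$; 3. the anti-self-dual Weyl curvature $W^-\in S^2_0(\Lambda^2_-)$.
   Context: An $\mathrm{SU}(2)$-structure on a connected oriented $4$-manifold $M$ is a triple $\boldsymbol\omega=(\omega_1,\omega_2,\omega_3)$ of $2$-forms such that near each point there is a local coframe $e^1,\dots,e^4$ with $\omega_1=e^{12}+e^{34}$, $\omega_2=e^{13}+e^{42}$, $\omega_3=e^{14}+e^{23}$ ($e^{ij}=e^i\wedge e^j$). It determines the metric $g=\sum_i e^i\otimes e^i$, the volume form $\mathrm{vol}=e^{1234}$, the Hodge star $*$, the Levi-Civita connection $\nabla$, and almost complex structures $J_i$ by $\omega_i(X,Y)=g(J_iX,Y)$. On $1$-forms, $(J_i\alpha)(X)=\alpha(J_iX)$. Inner products of $k$-forms are normalised so that $|e^{i_1\dots i_k}|=1$ (so $g(\omega_i,\omega_j)=2\delta_{ij}$). A $2$-tensor $A$ acts on $2$-tensors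 $\beta$ by $(A\diamond\beta)_{ij}=\tfrac12(A_{ai}g^{ab}\beta_{bj}+A_{aj}g^{ab}\beta_{ib})$. Torsion: there are unique $1$-forms $a_1,a_2,a_3$ with $\nabla_X\omega_1=a_3(X)\omega_2-a_2(X)\omega_3$, $\nabla_X\omega_2=a_1(X)\omega_3-a_3(X)\omega_1$, $\nabla_X\omega_3=a_2(X)\omega_1-a_1(X)\omega_2$; the intrinsic torsion is $T=\sum_i a_i\otimes\omega_i$, with $T(X)\in\Lambda^2_+=\langle\omega_1,\omega_2,\omega_3\rangle$. Notation: $\delta\alpha=-{*}d{*}\alpha$; $\pi^2_-(\alpha)=\tfrac12(\alpha-*\alpha)$ on $2$-forms. $S^2_{0,i}$ is the orthogonal projection of $2$-tensors onto $\Sigma^2_{0,i}=\{\beta \text{ symmetric}: J_i\beta=\beta,\ J_j\beta=J_k\beta=-\beta\}$ for $\{i,j,k\}=\{1,2,3\}$, where $(J\beta)(X,Y)=\beta(JX,JY)$. The map $\beta\mapsto\beta\diamond\omega_j$ identifies $\Sigma^2_{0,j}$ with $\Lambda^2_-$. $(\nabla a_i)(X,Y)=(\nabla_Xa_i)(Y)$. Second-order invariants: they are the components of the pair $(\nabla T,\mathrm{Rm})$, where $\mathrm{Rm}$ is the Riemann curvature of $g$, considered to highest order, i.e. modulo terms quadratic in $T$ (equivalently, evaluated at a point where $T$ vanishes). Pointwise they form the $\mathrm{SU}(2)$-module $V_2(\mathfrak{su}(2))$, defined up to isomorphism by $V_2(\mathfrak{su}(2))\oplus(\Lambda^1\otimes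 S^3(\Lambda^1))\cong (S^2(\Lambda^1)\oplus 3\mathbb{R})\otimes S^2(\Lambda^1)$, with $\Lambda^1=(\mathbb{R}^4)^*$ the standard representation and $3\mathbb{R}\cong\mathfrak{su}(2)^\perp\subset\mathfrak{so}(4)$ trivial. ''Linearly independent'' means that, to highest order, there are no linear relations among the listed components. *)

(* Defs.v *)
From HB Require Import structures.
From mathcomp Require Import all_boot all_order all_algebra.
From mathcomp Require Import all_classical all_reals all_analysis.
Import Order.TTheory GRing.Theory Num.Theory.
Import numFieldNormedType.Exports.

Set Implicit Arguments.
Unset Strict Implicit.
Unset Printing Implicit Defensive.

Local Open Scope classical_set_scope.
Local Open Scope ring_scope.

(* Indices are numbered from 0: e^1, ..., e^4 are indexed by 'I_4 and
   omega_1, omega_2, omega_3 (and a_1, a_2, a_3) by 'I_3. *)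

Definition pd (R : realType) (i : 'I_4) (f : 'rV[R]_4 -> R) : 'rV[R]_4 -> R :=
  fun x => 'D_(delta_mx 0 i) f x.

Fixpoint Ck (R : realType) (k : nat) (U : set 'rV[R]_4) (f : 'rV[R]_4 -> R)
    : Prop :=
  (forall x, U x -> {for x, continuous f}) /\
  match k with
  | 0 => True
  | k'.+1 => forall i : 'I_4,
      (forall x, U x -> derivable f x (delta_mx 0 i)) /\ Ck k' U (pd i f)
  end.

Definition smooth_on (R : realType) (U : set 'rV[R]_4) (f : 'rV[R]_4 -> R) :=
  forall k, Ck k U f.

Record oriented_atlas (R : realType) (M : topologicalType) := OrientedAtlas {
  chart : Type;
  dom : chart -> set M;
  coord : chart -> M -> 'rV[R]_4;
  param : chart -> 'rV[R]_4 -> M;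
  img := fun c : chart => coord c @` dom c;
  overlap := fun b c : chart => coord b @` (dom b `&` dom c);
  transition := fun b c : chart => coord c \o param b;
  dom_open : forall c, open (dom c);
  img_open : forall c, open (img c);
  coordK : forall c p, dom c p -> param c (coord c p) = p;
  coord_continuous : forall c p, dom c p -> {for p, continuous (coord c)};
  param_continuous : forall c x, img c x -> {for x, continuous (param c)};
  atlas_cover : forall p, exists c, dom c p;
  transition_smooth : forall b c (i : 'I_4),
    smooth_on (overlap b c) (fun x => transition b c x 0 i);
  transition_oriented : forall b c x, overlap b c x ->
    0 < \det (jacobian (transition b c) x)
}.

(* A 2-tensor is the matrix of its values on pairs of basis vectors. *)
Definition wedge (R : realType) (i j : 'I_4) : 'M[R]_4 :=
  delta_mx i j - delta_mx j i.

Definition omega0 (R : realType) (i : 'I_3) : 'M[R]_4 :=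
  match val i with
  | 0 => wedge R 0 1 + wedge R 2 3
  | 1 => wedge R 0 2 + wedge R 3 1
  | _ => wedge R 0 3 + wedge R 1 2
  end.

(* The corresponding basis of the anti-self-dual forms, each of norm^2 2. *)
Definition eta0 (R : realType) (i : 'I_3) : 'M[R]_4 :=
  match val i with
  | 0 => wedge R 0 1 - wedge R 2 3
  | 1 => wedge R 0 2 - wedge R 3 1
  | _ => wedge R 0 3 - wedge R 1 2
  end.

(* A coframe is the matrix field whose (i, k) entry is e^i(d/dx^k).  It is taken
   to be positive for the orientation of M, so that e^{1234} is positive. *)
Definition adapted_coframe (R : realType) (V : set 'rV[R]_4)
    (e : 'rV[R]_4 -> 'M[R]_4) (om : 'I_3 -> 'rV[R]_4 -> 'M[R]_4) : Prop :=
  [/\ forall i k, smooth_on V (fun x => e x i k),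
      forall x, V x -> 0 < \det (e x) &
      forall i x, V x -> om i x = (e x)^T *m omega0 R i *m e x].

Record SU2_structure (R : realType) (M : topologicalType)
    (A : oriented_atlas R M) := SU2Structure {
  omega : chart A -> 'I_3 -> 'rV[R]_4 -> 'M[R]_4;
  (* (jacobian f x) k l is the derivative of the l-th component of f along
     d/dx^k. *)
  omega_compat : forall (b c : chart A) (i : 'I_3) x, overlap b c x ->
    omega b i x = jacobian (transition b c) x
                  *m omega c i (transition b c x)
                  *m (jacobian (transition b c) x)^T;
  omega_coframe : forall (c : chart A) x, img c x ->
    exists V e, [/\ open V, V x, V `<=` img c & adapted_coframe V e (omega c)]
}.

Definition metric (R : realType) (e : 'rV[R]_4 -> 'M[R]_4) x : 'M[R]_4 :=
  (e x)^T *m e x.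

Definition cometric (R : realType) (e : 'rV[R]_4 -> 'M[R]_4) x : 'M[R]_4 :=
  invmx (metric e x).

(* e^{1234} evaluated on d/dx^i, d/dx^j, d/dx^k, d/dx^l *)
Definition vol (R : realType) (e : 'rV[R]_4 -> 'M[R]_4) x (i j k l : 'I_4) : R :=
  \det (\matrix_(r < 4, c < 4) e x r (tnth [tuple i; j; k; l] c)).

(* Christoffel symbols of the Levi-Civita connection:
   nabla_{d/dx^i} d/dx^j = \sum_k (christoffel e x k i j) d/dx^k *)
Definition christoffel (R : realType) (e : 'rV[R]_4 -> 'M[R]_4) x
    (k i j : 'I_4) : R :=
  2^-1 * \sum_(l < 4) cometric e x k l *
    (pd i (fun y => metric e y j l) x + pd j (fun y => metric e y i l) x
     - pd l (fun y => metric e y i j) x).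

(* (nabla1 e a x) k l = (nabla_{d/dx^k} a)(d/dx^l) *)
Definition nabla1 (R : realType) (e : 'rV[R]_4 -> 'M[R]_4)
    (a : 'rV[R]_4 -> 'rV[R]_4) x : 'M[R]_4 :=
  \matrix_(k < 4, l < 4)
    (pd k (fun y => a y 0 l) x - \sum_(m < 4) christoffel e x m k l * a x 0 m).

Definition nabla2 (R : realType) (e : 'rV[R]_4 -> 'M[R]_4)
    (b : 'rV[R]_4 -> 'M[R]_4) x (k : 'I_4) : 'M[R]_4 :=
  \matrix_(i < 4, j < 4)
    (pd k (fun y => b y i j) x
     - \sum_(m < 4) christoffel e x m k i * b x m j
     - \sum_(m < 4) christoffel e x m k j * b x i m).

Definition nabla3 (R : realType) (e : 'rV[R]_4 -> 'M[R]_4)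
    (t : 'rV[R]_4 -> 'I_4 -> 'M[R]_4) x (k l i j : 'I_4) : R :=
  pd k (fun y => t y l i j) x
  - \sum_(m < 4) christoffel e x m k l * t x m i j
  - \sum_(m < 4) christoffel e x m k i * t x l m j
  - \sum_(m < 4) christoffel e x m k j * t x l i m.

(* riem31 e x l i j k is the l-th component of R(d/dx^i, d/dx^j) d/dx^k, where
   R(X,Y) = [nabla_X, nabla_Y] - nabla_[X,Y]. *)
Definition riem31 (R : realType) (e : 'rV[R]_4 -> 'M[R]_4) x
    (l i j k : 'I_4) : R :=
  pd i (fun y => christoffel e y l j k) x
  - pd j (fun y => christoffel e y l i k) x
  + \sum_(m < 4) (christoffel e x l i m * christoffel e x m j k
                  - christoffel e x l j m * christoffel e x m i k).

Definition riem (R : realType) (e : 'rV[R]_4 -> 'M[R]_4) x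
    (i j k l : 'I_4) : R :=
  \sum_(m < 4) riem31 e x m i j k * metric e x m l.

Definition ric (R : realType) (e : 'rV[R]_4 -> 'M[R]_4) x : 'M[R]_4 :=
  \matrix_(j < 4, k < 4) \sum_(i < 4) riem31 e x i i j k.

Definition scal (R : realType) (e : 'rV[R]_4 -> 'M[R]_4) x : R :=
  \tr (cometric e x *m ric e x).

Definition schouten (R : realType) (e : 'rV[R]_4 -> 'M[R]_4) x : 'M[R]_4 :=
  2^-1 *: (ric e x - (scal e x / 6) *: metric e x).

Definition weyl (R : realType) (e : 'rV[R]_4 -> 'M[R]_4) x
    (i j k l : 'I_4) : R :=
  let g := metric e x in let P := schouten e x in
  riem e x i j k l - (P j k * g i l + g j k * P i l - P i k * g j l - g i k * P j l).

Definition inner2 (R : realType) (e : 'rV[R]_4 -> 'M[R]_4) x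
    (b c : 'M[R]_4) : R :=
  \tr (cometric e x *m b *m cometric e x *m c^T).

(* The inner product of 2-forms, normalised so that |e^{ij}| = 1. *)
Definition innerL2 (R : realType) (e : 'rV[R]_4 -> 'M[R]_4) x
    (b c : 'M[R]_4) : R := 2^-1 * inner2 e x b c.

Definition ext1 (R : realType) (a : 'rV[R]_4 -> 'rV[R]_4) x : 'M[R]_4 :=
  \matrix_(k < 4, l < 4)
    (pd k (fun y => a y 0 l) x - pd l (fun y => a y 0 k) x).

Definition ext3 (R : realType) (b : 'rV[R]_4 -> 'I_4 -> 'I_4 -> 'I_4 -> R) x
    (i j k l : 'I_4) : R :=
  pd i (fun y => b y j k l) x - pd j (fun y => b y i k l) x
  + pd k (fun y => b y i j l) x - pd l (fun y => b y i j k) x.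

(* Hodge star on 1-, 2- and 4-forms:
   ( *b)(Y) = (1/k!) \sum_I b^I vol(I, Y) for a k-form b. *)
Definition star1 (R : realType) (e : 'rV[R]_4 -> 'M[R]_4)
    (a : 'rV[R]_4 -> 'rV[R]_4) x (j k l : 'I_4) : R :=
  \sum_(m < 4) (a x *m cometric e x) 0 m * vol e x m j k l.

Definition star2 (R : realType) (e : 'rV[R]_4 -> 'M[R]_4) x
    (b : 'M[R]_4) : 'M[R]_4 :=
  \matrix_(k < 4, l < 4) (2^-1 * \sum_(i < 4) \sum_(j < 4)
    (cometric e x *m b *m cometric e x) i j * vol e x i j k l).

Definition star4 (R : realType) (e : 'rV[R]_4 -> 'M[R]_4) x
    (b : 'I_4 -> 'I_4 -> 'I_4 -> 'I_4 -> R) : R :=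
  b 0 1 2 3 / vol e x 0 1 2 3.

Definition codiff (R : realType) (e : 'rV[R]_4 -> 'M[R]_4)
    (a : 'rV[R]_4 -> 'rV[R]_4) x : R :=
  - star4 e x (ext3 (star1 e a) x).

Definition pi2m (R : realType) (e : 'rV[R]_4 -> 'M[R]_4) x
    (b : 'M[R]_4) : 'M[R]_4 := 2^-1 *: (b - star2 e x b).

Definition om (R : realType) (e : 'rV[R]_4 -> 'M[R]_4) (i : 'I_3) x : 'M[R]_4 :=
  (e x)^T *m omega0 R i *m e x.

Definition eta (R : realType) (e : 'rV[R]_4 -> 'M[R]_4) (i : 'I_3) x : 'M[R]_4 :=
  (e x)^T *m eta0 R i *m e x.

(* The matrix of J_i, acting on columns: omega_i(X,Y) = g(J_i X, Y) reads
   om = J^T g. *)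
Definition acs (R : realType) (e : 'rV[R]_4 -> 'M[R]_4) (i : 'I_3) x : 'M[R]_4 :=
  (om e i x *m cometric e x)^T.

Definition acs_act (R : realType) (e : 'rV[R]_4 -> 'M[R]_4) (i : 'I_3) x
    (b : 'M[R]_4) : 'M[R]_4 := (acs e i x)^T *m b *m acs e i x.

Definition Sigma20 (R : realType) (e : 'rV[R]_4 -> 'M[R]_4) (i : 'I_3) x
    : set 'M[R]_4 :=
  [set b | [/\ b^T = b, acs_act e i x b = b &
               forall j, j != i -> acs_act e j x b = - b]].

(* The orthogonal projection onto Sigma20; the default value 0 is irrelevant,
   since Sigma20 is a linear subspace and the metric is positive definite. *)
Definition S20 (R : realType) (e : 'rV[R]_4 -> 'M[R]_4) (i : 'I_3) x
    (b : 'M[R]_4) : 'M[R]_4 :=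
  xget 0 [set c | Sigma20 e i x c /\
                  forall s, Sigma20 e i x s -> inner2 e x (b - c) s = 0].

Definition diamond (R : realType) (e : 'rV[R]_4 -> 'M[R]_4) x
    (A b : 'M[R]_4) : 'M[R]_4 :=
  2^-1 *: (A^T *m cometric e x *m b + b *m cometric e x *m A).

(* The (i, j) entry of W^-, the restriction of the Weyl curvature to the
   anti-self-dual forms, in the basis eta. *)
Definition weyl_minus (R : realType) (e : 'rV[R]_4 -> 'M[R]_4) x : 'M[R]_3 :=
  \matrix_(i < 3, j < 3)
    let up b := cometric e x *m b *m cometric e x in
    (4^-1 * \sum_(k < 4) \sum_(l < 4) \sum_(m < 4) \sum_(n < 4)
      weyl e x k l m n * up (eta e i x) k l * up (eta e j x) m n).

(* Components of a covariant 3- or 4-tensor in the coframe e; the columns of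
   invmx (e x) are the dual frame. *)
Definition comp3 (R : realType) (e : 'rV[R]_4 -> 'M[R]_4) x
    (t : 'I_4 -> 'M[R]_4) (a b c : 'I_4) : R :=
  let f := invmx (e x) in
  \sum_(i < 4) \sum_(j < 4) \sum_(k < 4) f i a * f j b * f k c * t i j k.

Definition comp4 (R : realType) (e : 'rV[R]_4 -> 'M[R]_4) x
    (t : 'I_4 -> 'I_4 -> 'I_4 -> 'I_4 -> R) (a b c d : 'I_4) : R :=
  let f := invmx (e x) in
  \sum_(i < 4) \sum_(j < 4) \sum_(k < 4) \sum_(l < 4)
    f i a * f j b * f k c * f l d * t i j k l.

(* Here i + 1 and i + 2 are taken modulo 3. *)
Definition torsion_forms (R : realType) (e : 'rV[R]_4 -> 'M[R]_4)
    (V : set 'rV[R]_4) (a : 'I_3 -> 'rV[R]_4 -> 'rV[R]_4) : Prop :=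
  forall (i : 'I_3) (k : 'I_4) x, V x ->
    nabla2 e (om e i) x k
    = a (i + 2) x 0 k *: om e (i + 1) x - a (i + 1) x 0 k *: om e (i + 2) x.

Definition torsion (R : realType) (e : 'rV[R]_4 -> 'M[R]_4)
    (a : 'I_3 -> 'rV[R]_4 -> 'rV[R]_4) x (k : 'I_4) : 'M[R]_4 :=
  \sum_(i < 3) a i x 0 k *: om e i x.

(* A connected oriented 4-manifold with an SU(2)-structure, a point of it, and
   the choices that turn tensors at that point into components: a chart, an
   adapted coframe near the point, and the torsion 1-forms in that chart. *)
Record SU2_point (R : realType) := SU2Point {
  mfd : topologicalType;
  atlas : oriented_atlas R mfd;
  mfd_hausdorff : hausdorff_space mfd;
  mfd_second_countable : @second_countable mfd;
  mfd_connected : connected [set: mfd];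
  struct : SU2_structure atlas;
  pt : mfd;
  pt_chart : chart atlas;
  nbd : set 'rV[R]_4;
  cofr : 'rV[R]_4 -> 'M[R]_4;
  tors : 'I_3 -> 'rV[R]_4 -> 'rV[R]_4;
  pt_dom : dom pt_chart pt;
  nbd_open : open nbd;
  nbd_pt : nbd (coord pt_chart pt);
  nbd_img : nbd `<=` img pt_chart;
  cofr_adapted : adapted_coframe nbd cofr (omega struct pt_chart);
  torsP : torsion_forms cofr nbd tors
}.

Definition loc (R : realType) (s : SU2_point R) : 'rV[R]_4 :=
  coord (pt_chart s) (pt s).

Definition T_comp (R : realType) (s : SU2_point R) (I : 'I_4 * 'I_4 * 'I_4) : R :=
  comp3 (cofr s) (loc s) (torsion (cofr s) (tors s) (loc s)) I.1.1 I.1.2 I.2.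

Definition nablaT_comp (R : realType) (k l m n : 'I_4) (s : SU2_point R) : R :=
  comp4 (cofr s) (loc s)
    (nabla3 (cofr s) (torsion (cofr s) (tors s)) (loc s)) k l m n.

Definition Rm_comp (R : realType) (k l m n : 'I_4) (s : SU2_point R) : R :=
  comp4 (cofr s) (loc s) (riem (cofr s) (loc s)) k l m n.

(* Equality to highest order: F and G differ by a fixed quadratic form in the
   components of T. *)
Definition eq_highest (R : realType) (F G : SU2_point R -> R) : Prop :=
  exists q : 'I_4 * 'I_4 * 'I_4 -> 'I_4 * 'I_4 * 'I_4 -> R, forall s,
    F s = G s + \sum_I \sum_J q I J * T_comp s I * T_comp s J.

Definition second_order_component (R : realType) (F : SU2_point R -> R) : Prop :=
  exists k l m n : 'I_4, F = nablaT_comp k l m n \/ F = Rm_comp k l m n.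

Definition term_codiff (R : realType) (i : 'I_3) (s : SU2_point R) : R :=
  codiff (cofr s) (tors s i) (loc s).

Definition term_d (R : realType) (i j : 'I_3) (s : SU2_point R) : R :=
  innerL2 (cofr s) (loc s) (ext1 (tors s i) (loc s)) (om (cofr s) j (loc s)).

Definition asd_comp (R : realType) (s : SU2_point R) (b : 'M[R]_4) (k : 'I_3) : R :=
  innerL2 (cofr s) (loc s) b (eta (cofr s) k (loc s)).

Definition term_dminus (R : realType) (i k : 'I_3) (s : SU2_point R) : R :=
  asd_comp s (pi2m (cofr s) (loc s) (ext1 (tors s i) (loc s))) k.

Definition term_nabla (R : realType) (i j k : 'I_3) (s : SU2_point R) : R :=
  asd_comp s
    (diamond (cofr s) (loc s)
       (S20 (cofr s) j (loc s) (nabla1 (cofr s) (tors s i) (loc s)))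
       (om (cofr s) j (loc s))) k.

Definition term_W (R : realType) (k l : 'I_3) (s : SU2_point R) : R :=
  weyl_minus (cofr s) (loc s) k l.

(* A linear combination, with constant coefficients, of the components of all
   the listed terms. *)
Definition lincomb (R : realType) (c1 : 'I_3 -> R) (c2 c3 : 'I_3 -> 'I_3 -> R)
    (c4 : 'I_3 -> 'I_3 -> 'I_3 -> R) (c5 : 'M[R]_3) (s : SU2_point R) : R :=
  \sum_(i < 3) c1 i * term_codiff i s
  + \sum_(i < 3) \sum_(j < 3 | (i <= j)%N) c2 i j * term_d i j s
  + \sum_(i < 3) \sum_(k < 3) c3 i k * term_dminus i k s
  + \sum_(i < 3) \sum_(j < 3) \sum_(k < 3) c4 i j k * term_nabla i j k s
  + \sum_(k < 3) \sum_(l < 3) c5 k l * term_W k l s.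

(* Since W^- takes values in S^2_0(Lambda^2_-), so do its coefficients: in the
   basis eta, these are the symmetric traceless matrices. *)
Definition S20_minus (R : realType) (c : 'M[R]_3) : Prop :=
  c^T = c /\ \tr c = 0.

(* Main.v *)
(* In an adapted coframe the Levi-Civita connection matrix is so(4)-valued; its
   self-dual part is (a_1, a_2, a_3), so the Lambda^2_+ part of the curvature is
   d a_i up to terms quadratic in the torsion.  The pair symmetry and the Bianchi
   identity then leave W^- as the only part of Rm not determined by the d a_i,
   and make the matrix g(d a_i, omega_j) symmetric to highest order.  The tensor
   nabla a_i itself is the sum of its trace (delta a_i), its skew part (d a_i)
   and its components in Sigma^2_{0,j}, j = 1, 2, 3, which gives generation.

   Independence is tested at the origin of R^4 on coframes 1 + phi K with phi a
   quadratic form, where the torsion vanishes.  For K = omega_q the metric stays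
   flat to second order and nabla a_q is a multiple of the Hessian of phi, an
   arbitrary symmetric matrix: this kills the coefficients of delta a_q and of
   S^2_{0,j}(nabla a_q).  For K = v (x) v and phi = (w . x)^2 / 2 the curvature is
   (w /\ v) (x) (w /\ v), and varying w and v kills the remaining ones. *)
From HB Require Import structures.
Require Import Defs.
From mathcomp Require Import all_boot all_order all_algebra.
From mathcomp Require Import all_classical all_reals all_analysis.
From mathcomp Require Import perm ring lra.
Import Order.TTheory GRing.Theory Num.Theory.
Import numFieldNormedType.Exports.

Set Implicit Arguments.
Unset Strict Implicit.
Unset Printing Implicit Defensive.

Local Open Scope classical_set_scope.
Local Open Scope ring_scope.

(** * Second derivatives and matrix calculus *)

(** The definitions are in coordinates, with the Christoffel symbols of a metric built from the
    coframe, so every invariant is transported to the orthonormal frame dual to [e]. There the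
    metric is the identity, 2-forms are skew 4 by 4 matrices, and the representation theory reduces
    to the signed permutation matrices [omega0] and [eta0]. The bridge between coordinate curvature
    and frame curvature is the equality of mixed second derivatives of the coframe. [eq_highest]
    asks for one quadratic form valid at all points of all manifolds, so the calculations are exact
    identities: quadratic terms come only from the commutator of the connection and from
    differentiating the omega_p inside T. In the second independence test the relation becomes a
    quadratic form in the two parts b+ and b- of a decomposable 2-form b. Decomposability means |b+|
    = |b-|, so such b detect a quadratic form only up to multiples of |b+|^2 - |b-|^2; the trace
    condition on the coefficients of W^- removes exactly this ambiguity. *)

Section SymmetryOfSecondDerivatives.
Variables (R : realType) (V : normedModType R).
Implicit Types (f : V -> R) (x v w : V).

Lemma is_derive_line f x v (s d : R) : is_derive (x + s *: v) v f d ->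
  is_derive s 1 (fun t : R => f (x + t *: v)) d.
Proof.
have E : (fun h : R => h^-1 *: (((fun t : R => f (x + t *: v)) \o shift s)
    (h *: (1 : R)) - f (x + s *: v)))
  = (fun h => h^-1 *: ((f \o shift (x + s *: v)) (h *: v) - f (x + s *: v))).
  apply/funext => h /=; congr (_ *: (f _ - _)).
  by rewrite [h *: 1]mulr1 scalerDl addrCA.
by move=> [df <-]; split; rewrite /derivable /derive E.
Qed.

(** The double difference over a square is an increment along [v] of a difference along [w]: one
    mean value theorem produces [f1], a second one, applied to [f1] along [w], produces [f2]. *)
Lemma mean_value_square f f1 f2 x v w (h : R) : 0 < h ->
  (forall a b : R, 0 <= a <= h -> 0 <= b <= h ->
     is_derive (x + b *: w + a *: v) v f (f1 (x + b *: w + a *: v))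
     /\ is_derive (x + a *: v + b *: w) w f1 (f2 (x + a *: v + b *: w))) ->
  exists a b : R, [/\ 0 <= a <= h, 0 <= b <= h &
    f (x + h *: w + h *: v) - f (x + h *: w) - f (x + h *: v) + f x
    = h * h * f2 (x + a *: v + b *: w)].
Proof.
move=> h0 df.
have h00 : 0 <= (0 : R) <= h by rewrite lexx ltW.
have hh : 0 <= h <= h by rewrite lexx (ltW h0).
(* The summand [0 *: w] lets the hypothesis apply literally with [b = 0]. *)
pose phi (t : R) := f (x + h *: w + t *: v) - f (x + 0 *: w + t *: v).
pose dphi (t : R) := f1 (x + h *: w + t *: v) - f1 (x + 0 *: w + t *: v).
have dphiP t : 0 <= t <= h -> is_derive t 1 phi (dphi t).
  move=> t0h; apply: is_deriveB; apply: is_derive_line.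
    by have [H _] := df t h t0h hh.
  by have [H _] := df t 0 t0h h00.
have oc t : t \in `]0, h[%R -> 0 <= t <= h.
  by rewrite in_itv/= => /andP[? ?]; rewrite !ltW.
have [a /oc a0h Ea] : exists2 a, a \in `]0, h[%R & phi h - phi 0 = dphi a * (h - 0).
  apply: (MVT h0) => [t /oc|]; first exact: dphiP.
  apply: derivable_within_continuous => t; rewrite in_itv/= => t0h.
  by have [H _] := dphiP t t0h; exact: H.
pose psi (t : R) := f1 (x + a *: v + t *: w).
pose dpsi (t : R) := f2 (x + a *: v + t *: w).
have dpsiP t : 0 <= t <= h -> is_derive t 1 psi (dpsi t).
  by move=> t0h; apply: is_derive_line; have [_ H] := df a t a0h t0h.
have [b /oc b0h Eb] : exists2 b, b \in `]0, h[%R & psi h - psi 0 = dpsi b * (h - 0).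
  apply: (MVT h0) => [t /oc|]; first exact: dpsiP.
  apply: derivable_within_continuous => t; rewrite in_itv/= => t0h.
  by have [H _] := dpsiP t t0h; exact: H.
exists a, b; split=> //.
move: Ea Eb; rewrite /phi /dphi /psi /dpsi !scale0r !addr0 !subr0.
rewrite (addrAC x (h *: w) (a *: v)) => Ea Eb.
rewrite -mulrA [h * _]mulrC [h * _]mulrC -Eb -Ea; ring.
Qed.

(** The double difference over a small square is symmetric in [v] and [w], so [f2] and [g2] take a
    common value at two points near [x]; continuity at [x] closes the gap. Only directional
    derivatives occur, as in [Ck]. *)
Lemma mixed_derivatives_eq f f1 g1 f2 g2 x v w :
  (\forall y \near x, is_derive y v f (f1 y) /\ is_derive y w f1 (f2 y)) ->
  (\forall y \near x, is_derive y w f (g1 y) /\ is_derive y v g1 (g2 y)) ->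
  {for x, continuous f2} -> {for x, continuous g2} -> f2 x = g2 x.
Proof.
move=> nf ng /cvgrPdist_lt cf2 /cvgrPdist_lt cg2.
apply/eqP; rewrite -subr_eq0 -normr_le0; apply/ler_addgt0Pr => e e0; rewrite add0r.
have e20 : 0 < e / 2 by rewrite divr_gt0.
have [d /= d0 dP] :=
  (nbhs_normP _ _).1 (filterI (filterI nf ng) (filterI (cf2 _ e20) (cg2 _ e20))).
(* This side length keeps the whole square inside the ball of radius [d]; the [+ 1] covers the case
   [v = w = 0]. *)
pose h := d / 2 / (`|v| + `|w| + 1).
have n0 : 0 < `|v| + `|w| + 1 by rewrite ltr_wpDl// addr_ge0.
have h0 : 0 < h by rewrite !divr_gt0.
have inball (a b : R) : 0 <= a <= h -> 0 <= b <= h ->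
    `|x - (x + a *: v + b *: w)| < d.
  move=> /andP[a0 ah] /andP[b0 bh].
  rewrite -addrA opprD addNKr normrN.
  apply: (@le_lt_trans _ _ (h * (`|v| + `|w| + 1))).
    rewrite (le_trans (ler_normD _ _))// !normrZ !ger0_norm//.
    rewrite !mulrDr mulr1 -[leLHS]addr0 lerD// ?(ltW h0)//.
    by rewrite lerD// ler_wpM2r.
  by rewrite divfK ?gt_eqF// ltr_pdivrMr// ltr_pMr// ltr1n.
have dP' (a b : R) (H : 0 <= a <= h) (H' : 0 <= b <= h) := dP _ (inball a b H H').
have [|a [b [a0 b0 E1]]] := @mean_value_square f f1 f2 x v w h h0.
  move=> a b a0 b0; have [[[H1 H2] _] _] := dP' a b a0 b0.
  by rewrite [x + b *: w + _]addrAC.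
have [|b' [a' [b'0 a'0 E2]]] := @mean_value_square f g1 g2 x w v h h0.
  move=> b' a' b0' a0'; have [[_ [H1 H2]] _] := dP' a' b' a0' b0'.
  by rewrite [x + b' *: w + _]addrAC.
have E : f2 (x + a *: v + b *: w) = g2 (x + b' *: w + a' *: v).
  have hh : h * h != 0 by rewrite mulf_neq0// gt_eqF.
  apply: (mulfI hh); rewrite -E1 -E2.
  by rewrite [x + h *: w + _]addrAC; ring.
have [_ [B1 _]] := dP' a b a0 b0; have [_ [_ B2]] := dP' a' b' a'0 b'0.
rewrite /= [x + a' *: v + _]addrAC -E distrC in B2; rewrite /= in B1.
rewrite (splitr e); apply: le_trans (lerD (ltW B1) (ltW B2)).
apply: le_trans (ler_normD _ _); set c := f2 (_ + _).
by rewrite addrA subrK.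
Qed.

Lemma derive_commutes f x v w :
  (\forall y \near x, derivable f y v /\ derivable ('D_v f) y w) ->
  (\forall y \near x, derivable f y w /\ derivable ('D_w f) y v) ->
  {for x, continuous ('D_w ('D_v f))} -> {for x, continuous ('D_v ('D_w f))} ->
  'D_w ('D_v f) x = 'D_v ('D_w f) x.
Proof.
move=> dvw dwv; apply: (@mixed_derivatives_eq f ('D_v f) ('D_w f) _ _ x v w).
  by apply: filterS dvw => y [H1 H2]; exact: conj (derivableP H1) (derivableP H2).
by apply: filterS dwv => y [H1 H2]; exact: conj (derivableP H1) (derivableP H2).
Qed.

End SymmetryOfSecondDerivatives.

(** * Derivatives of matrix products and determinants *)

Section MatrixCalculus.
Variables (R : realType) (V : normedModType R).
Implicit Types (x v : V).

Lemma is_derive_mxP m n (F : V -> 'M[R]_(m, n)) x v (D : 'M[R]_(m, n)) :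
  (forall i j, is_derive x v (fun y => F y i j) (D i j)) <-> is_derive x v F D.
Proof.
split=> [dF|[dF <-] i j].
  have dF' : derivable F x v.
    by apply/derivable_mxP => i j; have [H _] := dF i j; exact: H.
  apply: DeriveDef => //; rewrite derive_mx//; apply/matrixP => i j; rewrite mxE.
  by have [_] := dF i j.
have H := (derivable_mxP _ _ _).1 dF i j.
by rewrite derive_mx// mxE; apply: DeriveDef.
Qed.

Lemma is_derive_mulmx m n p (F : V -> 'M[R]_(m, n)) (G : V -> 'M[R]_(n, p)) x v
    dF dG : is_derive x v F dF -> is_derive x v G dG ->
  is_derive x v (fun y => F y *m G y) (dF *m G x + F x *m dG).
Proof.
move=> /is_derive_mxP HF /is_derive_mxP HG; apply/is_derive_mxP => i j.
rewrite (_ : (fun y => _) = \sum_k (fun y => F y i k) * (fun y => G y k j)); last first.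
  by apply/funext => y; rewrite mxE fct_sumE.
have D k := is_deriveM (HF i k) (HG k j).
apply: is_derive_eq (is_derive_sum D) _.
rewrite !mxE -big_split/=; apply: eq_bigr => k _.
by rewrite addrC; congr (_ + _); exact: mulrC.
Qed.

Lemma is_derive_trmx m n (F : V -> 'M[R]_(m, n)) x v dF :
  is_derive x v F dF -> is_derive x v (fun y => (F y)^T) dF^T.
Proof.
move=> /is_derive_mxP HF; apply/is_derive_mxP => i j; rewrite !mxE.
by rewrite (_ : (fun y => _) = (fun y => F y j i))//; apply/funext => y; rewrite mxE.
Qed.

Lemma is_derive_prod n (h : 'I_n -> V -> R) (dh : 'I_n -> R) x v :
  (forall i, is_derive x v (h i) (dh i)) ->
  is_derive x v (fun y => \prod_i h i y)
    (\sum_i dh i * \prod_(j | j != i) h j x).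
Proof.
elim: n h dh => [|n IH] h dh H.
  rewrite big_ord0 (_ : (fun y => _) = cst 1).
    exact: is_derive_cst.
  by apply/funext => y; rewrite big_ord0.
rewrite (_ : (fun y => _) = h ord0 * (fun y => \prod_i h (lift ord0 i) y)); last first.
  by apply/funext => y; rewrite big_ord_recl.
have D := is_deriveM (H ord0) (IH _ _ (fun i => H (lift ord0 i))).
apply: is_derive_eq D _; rewrite big_ord_recl /= addrC.
congr (_ + _).
  rewrite [LHS]mulrC; congr (_ * _).
  by rewrite [RHS]big_mkcond big_ord_recl eqxx /= mul1r.
rewrite /GRing.scale/= mulr_sumr; apply: eq_bigr => i _.
rewrite mulrCA; congr (_ * _).
by rewrite [in LHS]big_mkcond [in RHS]big_mkcond big_ord_recl /=.
Qed.

(** Jacobi's formula: the Leibniz expansion is differentiated one row at a time, and each resulting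
    determinant is expanded along the differentiated row. *)
Lemma is_derive_det n (F : V -> 'M[R]_n) x v dF : is_derive x v F dF ->
  is_derive x v (fun y => \det (F y)) (\tr (\adj (F x) *m dF)).
Proof.
move=> /is_derive_mxP HF.
have D : is_derive x v (fun y => \det (F y)) (\sum_(s : 'S_n) (-1) ^+ s *
    \sum_i dF i (s i) * \prod_(j | j != i) F x j (s j)).
  rewrite (_ : (fun y => _) =
      \sum_(s : 'S_n) (fun y => (-1) ^+ s * \prod_i F y i (s i))); last first.
    by apply/funext => y; rewrite fct_sumE.
  elim/big_ind2 : _ => [|g1 d1 g2 d2|s _]; first exact: is_derive_cst.
    by move=> H1 H2; exact: is_deriveD.
  by apply: is_deriveZ; apply: is_derive_prod.
apply: is_derive_eq D _.
transitivity (\sum_i \det (\matrix_(k, l) (if k == i then dF i l else F x k l))).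
  rewrite /determinant exchange_big /=.
  apply: eq_bigr => s _; rewrite mulr_sumr; apply: eq_bigr => i _; congr (_ * _).
  rewrite [RHS](bigD1 i)//= mxE eqxx; congr (_ * _).
  by apply: eq_bigr => j ji; rewrite mxE (negPf ji).
rewrite mxtrace_mulC; apply: eq_bigr => i _.
rewrite (expand_det_row _ i) mxE; apply: eq_bigr => j _.
rewrite !mxE eqxx; congr (_ * _); rewrite /cofactor; congr (_ * \det _).
apply/matrixP => k l; rewrite !mxE.
by rewrite eq_sym (negPf (neq_lift _ _)).
Qed.

End MatrixCalculus.

(** * Self-dual and anti-self-dual parts in R^4 *)

Local Notation ord4 k := (@Ordinal 4 k isT).
Local Notation ord3 k := (@Ordinal 3 k isT).

Section FrameAlgebra.
Variable R : realType.

Lemma sum4 (F : 'I_4 -> R) :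
  \sum_i F i = F (ord4 0) + F (ord4 1) + F (ord4 2) + F (ord4 3).
Proof.
rewrite !big_ord_recl big_ord0 addr0 !addrA.
by do !congr (_ + _); congr (F _); apply: val_inj.
Qed.

Lemma ord4_ind (P : 'I_4 -> Prop) :
  P (ord4 0) -> P (ord4 1) -> P (ord4 2) -> P (ord4 3) ->
  forall i, P i.
Proof.
move=> P0 P1 P2 P3 [[|[|[|[|//]]]] i].
- by rewrite (_ : Ordinal i = ord4 0)//; apply: val_inj.
- by rewrite (_ : Ordinal i = ord4 1)//; apply: val_inj.
- by rewrite (_ : Ordinal i = ord4 2)//; apply: val_inj.
- by rewrite (_ : Ordinal i = ord4 3)//; apply: val_inj.
Qed.

Lemma sum3 (F : 'I_3 -> R) :
  \sum_i F i = F (ord3 0) + F (ord3 1) + F (ord3 2).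
Proof.
rewrite !big_ord_recl big_ord0 addr0 !addrA.
by do !congr (_ + _); congr (F _); apply: val_inj.
Qed.

Lemma ord3_ind (P : 'I_3 -> Prop) :
  P (ord3 0) -> P (ord3 1) -> P (ord3 2) -> forall i, P i.
Proof.
move=> P0 P1 P2 [[|[|[|//]]] i].
- by rewrite (_ : Ordinal i = ord3 0)//; apply: val_inj.
- by rewrite (_ : Ordinal i = ord3 1)//; apply: val_inj.
- by rewrite (_ : Ordinal i = ord3 2)//; apply: val_inj.
Qed.

Lemma ord3D : ((ord3 0 + 1 = ord3 1)%R * (ord3 1 + 1 = ord3 2)%R *
  (ord3 2 + 1 = ord3 0)%R * (ord3 0 + 2 = ord3 2)%R *
  (ord3 1 + 2 = ord3 0)%R * (ord3 2 + 2 = ord3 1)%R)%type.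
Proof. by do !split; apply: val_inj. Qed.

(* omega0 p and eta0 p are signed permutation matrices with the same
   underlying permutation [flip p]. *)
Definition flip (p : 'I_3) (i : 'I_4) : 'I_4 :=
  match val p, val i with
  | 0, 0 => ord4 1 | 0, 1 => ord4 0 | 0, 2 => ord4 3 | 0, _ => ord4 2
  | 1, 0 => ord4 2 | 1, 1 => ord4 3 | 1, 2 => ord4 0 | 1, _ => ord4 1
  | _, 0 => ord4 3 | _, 1 => ord4 2 | _, 2 => ord4 1 | _, _ => ord4 0
  end.

Definition somega (p : 'I_3) (i : 'I_4) : R :=
  match val p, val i with
  | 0, 0 => 1 | 0, 1 => -1 | 0, 2 => 1  | 0, _ => -1
  | 1, 0 => 1 | 1, 1 => -1 | 1, 2 => -1 | 1, _ => 1
  | _, 0 => 1 | _, 1 => 1  | _, 2 => -1 | _, _ => -1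
  end.

Definition seta (p : 'I_3) (i : 'I_4) : R :=
  match val p, val i with
  | 0, 0 => 1 | 0, 1 => -1 | 0, 2 => -1 | 0, _ => 1
  | 1, 0 => 1 | 1, 1 => 1  | 1, 2 => -1 | 1, _ => -1
  | _, 0 => 1 | _, 1 => -1 | _, 2 => 1  | _, _ => -1
  end.

Lemma omega0E p i j : omega0 R p i j = somega p i *+ (j == flip p i).
Proof.
move: p i j; elim/ord3_ind; elim/ord4_ind; elim/ord4_ind;
  by rewrite /omega0 /= !mxE /= ?(subr0, sub0r, addr0, add0r, subrr).
Qed.

Lemma eta0E p i j : eta0 R p i j = seta p i *+ (j == flip p i).
Proof.
move: p i j; elim/ord3_ind; elim/ord4_ind; elim/ord4_ind;
  by rewrite /eta0 /= !mxE /= ?(subr0, sub0r, addr0, add0r, subrr, oppr0, opprK, opprB).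
Qed.

Lemma flipK p : involutive (flip p).
Proof.
by move: p; elim/ord3_ind; elim/ord4_ind; apply: val_inj.
Qed.

Lemma somega_flip p i : somega p (flip p i) = - somega p i.
Proof. by move: p i; elim/ord3_ind; elim/ord4_ind; rewrite /somega/= ?opprK. Qed.

Lemma seta_flip p i : seta p (flip p i) = - seta p i.
Proof. by move: p i; elim/ord3_ind; elim/ord4_ind; rewrite /seta/= ?opprK. Qed.

(** The factor is that of the inner product of 2-forms. Since [omega0 p] has squared length 2,
    expansions in this basis carry a further factor one half. *)
Definition sd (A : 'M[R]_4) (p : 'I_3) : R :=
  2^-1 * \sum_a \sum_b A a b * omega0 R p a b.

Definition asd (A : 'M[R]_4) (k : 'I_3) : R :=
  2^-1 * \sum_a \sum_b A a b * eta0 R k a b.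

Lemma mul_omega0 p (A : 'M[R]_4) i j :
  (omega0 R p *m A) i j = somega p i * A (flip p i) j.
Proof.
rewrite mxE (bigD1 (flip p i))//= omega0E eqxx big1 ?addr0// => l ne.
by rewrite omega0E (negPf ne) mulr0n mul0r.
Qed.

Lemma mulr_omega0 p (A : 'M[R]_4) i j :
  (A *m omega0 R p) i j = - (somega p j * A i (flip p j)).
Proof.
rewrite mxE (bigD1 (flip p j))//= omega0E flipK eqxx big1.
  by rewrite addr0 somega_flip mulr1n mulrN mulrC.
move=> l ne; rewrite omega0E; case: eqP => [E|]; last by rewrite mulr0.
by rewrite E flipK eqxx in ne.
Qed.

Lemma mulr_eta0 p (A : 'M[R]_4) i j :
  (A *m eta0 R p) i j = - (seta p j * A i (flip p j)).
Proof.
rewrite mxE (bigD1 (flip p j))//= eta0E flipK eqxx big1.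
  by rewrite addr0 seta_flip mulr1n mulrN mulrC.
move=> l ne; rewrite eta0E; case: eqP => [E|]; last by rewrite mulr0.
by rewrite E flipK eqxx in ne.
Qed.

Lemma sdE A p : sd A p = 2^-1 * \sum_a somega p a * A a (flip p a).
Proof.
congr (_ * _); apply: eq_bigr => a _; rewrite (bigD1 (flip p a))//=.
rewrite omega0E eqxx mulrC big1 ?addr0// => l ne.
by rewrite omega0E (negPf ne) mulr0.
Qed.

Lemma asdE A p : asd A p = 2^-1 * \sum_a seta p a * A a (flip p a).
Proof.
congr (_ * _); apply: eq_bigr => a _; rewrite (bigD1 (flip p a))//=.
rewrite eta0E eqxx mulrC big1 ?addr0// => l ne.
by rewrite eta0E (negPf ne) mulr0.
Qed.

Lemma skewE (A : 'M[R]_4) : A^T = - A -> forall a b, A a b = - A b a.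
Proof. by move=> /matrixP skewA a b; have := skewA b a; rewrite !mxE. Qed.

Lemma skew_upper (A : 'M[R]_4) : A^T = - A ->
  ((forall a, A a a = 0)%R *
   (A (ord4 1) (ord4 0) = - A (ord4 0) (ord4 1))%R *
   (A (ord4 2) (ord4 0) = - A (ord4 0) (ord4 2))%R *
   (A (ord4 3) (ord4 0) = - A (ord4 0) (ord4 3))%R *
   (A (ord4 2) (ord4 1) = - A (ord4 1) (ord4 2))%R *
   (A (ord4 3) (ord4 1) = - A (ord4 1) (ord4 3))%R *
   (A (ord4 3) (ord4 2) = - A (ord4 2) (ord4 3))%R)%type.
Proof.
move=> /skewE E; do !split; rewrite -?E//.
by move=> a; have := E a a; lra.
Qed.

Lemma mxDE m n (A B : 'M[R]_(m, n)) i j : (A + B) i j = A i j + B i j.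
Proof. by rewrite mxE. Qed.

Lemma mxNE m n (A : 'M[R]_(m, n)) i j : (- A) i j = - A i j.
Proof. by rewrite mxE. Qed.

Lemma mxZE m n c (A : 'M[R]_(m, n)) i j : (c *: A) i j = c * A i j.
Proof. by rewrite mxE. Qed.

Lemma mxTE m n (A : 'M[R]_(m, n)) i j : A^T i j = A j i.
Proof. by rewrite mxE. Qed.

Definition mxlinE := (mxDE, mxNE, mxZE).

Local Ltac frame_eval := rewrite /somega /seta /flip /= ?mulr0n ?mulr1n.

(** The anti-self-dual part of [A] commutes with [omega0], and the self-dual part brackets with it
    as in so(3), cyclically in the index. *)
Lemma commutator_omega0 (A : 'M[R]_4) p : A^T = - A ->
  omega0 R p *m A - A *m omega0 R p
  = sd A (p + 2) *: omega0 R (p + 1) - sd A (p + 1) *: omega0 R (p + 2).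
Proof.
move=> skewA; apply/matrixP => i j.
rewrite !mxlinE mul_omega0 mulr_omega0 !sdE !sum4 !omega0E.
move: p i j; elim/ord3_ind; rewrite !ord3D; elim/ord4_ind; elim/ord4_ind;
  frame_eval; rewrite !(skew_upper skewA); by field.
Qed.

(** Self-dual matrices form an ideal of so(4) isomorphic to so(3), so the self-dual part of a
    commutator is, up to sign, the cross product of the self-dual parts. *)
Lemma sd_commutator (A B : 'M[R]_4) p : A^T = - A -> B^T = - B ->
  sd (A *m B - B *m A) p
  = sd A (p + 2) * sd B (p + 1) - sd A (p + 1) * sd B (p + 2).
Proof.
move=> skewA skewB; rewrite !sdE !sum4 !mxlinE ![(_ *m _) _ _]mxE !sum4.
move: p; elim/ord3_ind; rewrite !ord3D;
  frame_eval; rewrite !(skew_upper skewA) !(skew_upper skewB); by field.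
Qed.

Lemma skew_decomposition (A : 'M[R]_4) i j : A^T = - A ->
  A i j = 2^-1 * (\sum_p sd A p * omega0 R p i j + \sum_k asd A k * eta0 R k i j).
Proof.
move=> skewA; rewrite !sum3 !sdE !asdE !sum4 !omega0E !eta0E.
move: i j; elim/ord4_ind; elim/ord4_ind;
  frame_eval; rewrite ?(skew_upper skewA); by field.
Qed.

(* The symmetric traceless basis tensors omega0 j *m eta0 k, k < 3, span the
   frame version of Sigma20 j. *)
Definition sig (j k : 'I_3) : 'M[R]_4 := omega0 R j *m eta0 R k.

Definition dot (A B : 'M[R]_4) : R := \sum_a \sum_b A a b * B a b.

Lemma sigE j k a b : sig j k a b =
  somega j a * seta k (flip j a) *+ (b == flip k (flip j a)).
Proof. by rewrite /sig mul_omega0 eta0E mulrnAr. Qed.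

Lemma dot_sig A j k : dot A (sig j k)
  = \sum_a somega j a * seta k (flip j a) * A a (flip k (flip j a)).
Proof.
apply: eq_bigr => a _; rewrite (bigD1 (flip k (flip j a)))//= sigE eqxx mulrC.
rewrite big1 ?addr0// => l ne.
by rewrite sigE (negPf ne) mulr0n mulr0.
Qed.

Lemma tr_sig j k : (sig j k)^T = sig j k.
Proof.
apply/matrixP => a b; rewrite mxE !sigE.
move: j k a b; elim/ord3_ind; elim/ord3_ind; elim/ord4_ind; elim/ord4_ind;
  frame_eval; ring.
Qed.

(** The [omega0] commute with the [eta0], anticommute among themselves and square to -1, so the sign
    only depends on how [omega0 i] passes the factor [omega0 j] of [sig j k]. *)
Lemma omega0_sig_omega0 i j k :
  omega0 R i *m sig j k *m omega0 R i = (-1) ^+ (i == j) *: sig j k.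
Proof.
apply/matrixP => a b; rewrite mxlinE mulr_omega0 mul_omega0 !sigE.
move: i j k a b; elim/ord3_ind; elim/ord3_ind; elim/ord3_ind;
  elim/ord4_ind; elim/ord4_ind; frame_eval; ring.
Qed.

Lemma sym_upper (A : 'M[R]_4) : A^T = A ->
  ((A (ord4 1) (ord4 0) = A (ord4 0) (ord4 1))%R *
   (A (ord4 2) (ord4 0) = A (ord4 0) (ord4 2))%R *
   (A (ord4 3) (ord4 0) = A (ord4 0) (ord4 3))%R *
   (A (ord4 2) (ord4 1) = A (ord4 1) (ord4 2))%R *
   (A (ord4 3) (ord4 1) = A (ord4 1) (ord4 3))%R *
   (A (ord4 3) (ord4 2) = A (ord4 2) (ord4 3))%R)%type.
Proof.
by move=> /matrixP E; do !split; rewrite -[RHS]E mxE.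
Qed.

(** The identity and the nine [sig] form an orthogonal basis of the symmetric matrices, each of
    squared length 4; doubling the symmetric part turns 1/4 into 1/2. *)
Lemma sym_decomposition (A : 'M[R]_4) i j :
  A i j + A j i = 2^-1 * (\tr A *+ (i == j) + \sum_p \sum_k dot A (sig p k) * sig p k i j).
Proof.
rewrite !sum3 /mxtrace !dot_sig !sum4 !sigE.
move: i j; elim/ord4_ind; elim/ord4_ind; frame_eval; by field.
Qed.

End FrameAlgebra.

(** * Derivative of the inverse matrix *)

Section InverseDerivative.
Variables (R : realType) (V : normedModType R).

Lemma derivable_adj n (F : V -> 'M[R]_n) x v :
  derivable F x v -> derivable (fun y => \adj (F y)) x v.
Proof.
move=> /derivableP/is_derive_mxP HF; apply/derivable_mxP => i j.
pose G y := row' j (col' i (F y)).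
have HG : is_derive x v G (row' j (col' i ('D_v F x))).
  apply/is_derive_mxP => k l; rewrite !mxE.
  by rewrite (_ : (fun y => _) = (fun y => F y (lift j k) (lift i l)))//;
     apply/funext => y; rewrite !mxE.
rewrite (_ : (fun y => _) = (fun y => (-1) ^+ (j + i) * \det (G y))); last first.
  by apply/funext => y; rewrite mxE.
have [H _] := is_deriveZ ((-1) ^+ (j + i)) (is_derive_det HG).
exact: H.
Qed.

(** Derivability comes from Cramer's formula, which [invmx] follows only at invertible matrices,
    hence the condition near [x]. The value then comes from differentiating the product of the
    inverse with [F]. *)
Lemma is_derive_invmx n (F : V -> 'M[R]_n) x v dF :
  (\forall y \near x, F y \in unitmx) -> is_derive x v F dF ->
  is_derive x v (fun y => invmx (F y)) (- (invmx (F x) *m dF *m invmx (F x))).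
Proof.
move=> Fu HF; have Fxu := nbhs_singleton Fu.
have Hd : derivable (fun y => invmx (F y)) x v.
  apply: (@near_eq_derivable _ _ _ (fun y => (\det (F y))^-1 *: \adj (F y))).
    by apply: filterS Fu => y Fyu; rewrite /invmx Fyu.
  apply/derivable_mxP => i j.
  rewrite (_ : (fun y => _) = (fun y => (\det (F y))^-1) * (fun y => \adj (F y) i j)).
    apply: derivableM; last first.
      by have [H _] := HF; exact: (derivable_mxP _ _ _).1 (derivable_adj H) i j.
    apply: derivableV; first by rewrite -unitfE -unitmxE.
    by have [H _] := is_derive_det HF; exact: H.
  by apply/funext => y; rewrite mxE.
have [_ E] := is_derive_mulmx (derivableP Hd) HF.
have E1 : 'D_v (fun y => invmx (F y) *m F y) x = 0.
  rewrite (@near_eq_derive _ _ _ _ (cst 1%:M)) ?derive_cst//.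
  by apply: filterS Fu => y Fyu; rewrite mulVmx.
apply: is_derive_eq (derivableP Hd) _.
move: E; rewrite E1 => /esym/eqP; rewrite addr_eq0 => /eqP E.
by rewrite -[LHS](mulmxK Fxu) E mulNmx.
Qed.

End InverseDerivative.

(** * Connection, curvature and torsion of a coframe *)

Definition regular_coframe (R : realType) (V : set 'rV[R]_4)
    (e : 'rV[R]_4 -> 'M[R]_4) : Prop :=
  [/\ open V, forall x, V x -> e x \in unitmx &
      forall i k, smooth_on V (fun x => e x i k)].

(* These are locked because unification would otherwise unfold them on every
   failing match. *)
HB.lock Definition frame (R : realType) (e : 'rV[R]_4 -> 'M[R]_4)
    (x : 'rV[R]_4) : 'M[R]_4 :=
  invmx (e x).

HB.lock Definition de (R : realType) (e : 'rV[R]_4 -> 'M[R]_4)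
    (k : 'I_4) (x : 'rV[R]_4) : 'M[R]_4 :=
  \matrix_(i, j) pd k (fun y => e y i j) x.

HB.lock Definition dde (R : realType) (e : 'rV[R]_4 -> 'M[R]_4)
    (l k : 'I_4) (x : 'rV[R]_4) : 'M[R]_4 :=
  \matrix_(i, j) pd l (pd k (fun y => e y i j)) x.

HB.lock Definition dg (R : realType) (e : 'rV[R]_4 -> 'M[R]_4)
    (k : 'I_4) (x : 'rV[R]_4) : 'M[R]_4 :=
  (de e k x)^T *m e x + (e x)^T *m de e k x.

(** Christoffel symbols of the first kind: the entry at [l], [i] is the inner product of nabla_k
    (d/dx^i) with d/dx^l. *)
HB.lock Definition lowered (R : realType) (e : 'rV[R]_4 -> 'M[R]_4)
    (k : 'I_4) (x : 'rV[R]_4) : 'M[R]_4 :=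
  2^-1 *: \matrix_(l, i) (dg e k x i l + dg e i x k l - dg e l x k i).

(* Matrix of the endomorphism Y |-> nabla_Y (d/dx^k) *)
HB.lock Definition gam (R : realType) (e : 'rV[R]_4 -> 'M[R]_4)
    (k : 'I_4) (x : 'rV[R]_4) : 'M[R]_4 :=
  frame e x *m (frame e x)^T *m lowered e k x.

(* Levi-Civita connection matrix of the frame dual to e *)
HB.lock Definition conn (R : realType) (e : 'rV[R]_4 -> 'M[R]_4)
    (k : 'I_4) (x : 'rV[R]_4) : 'M[R]_4 :=
  (de e k x - e x *m gam e k x) *m frame e x.

HB.lock Definition dgam (R : realType) (e : 'rV[R]_4 -> 'M[R]_4)
    (l k : 'I_4) (x : 'rV[R]_4) : 'M[R]_4 :=
  'D_(delta_mx 0 l) (gam e k) x.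

HB.lock Definition dconn (R : realType) (e : 'rV[R]_4 -> 'M[R]_4)
    (l k : 'I_4) (x : 'rV[R]_4) : 'M[R]_4 :=
  'D_(delta_mx 0 l) (conn e k) x.

HB.lock Definition curv31 (R : realType) (e : 'rV[R]_4 -> 'M[R]_4)
    (i j : 'I_4) (x : 'rV[R]_4) : 'M[R]_4 :=
  dgam e i j x - dgam e j i x + (gam e i x *m gam e j x - gam e j x *m gam e i x).

(** The entry of [conn] at [C], [D] is the inner product of nabla f_C with f_D, row index first.
    Composition is therefore reversed, which gives the commutator its minus sign, and the entries of
    the curvature follow the index order of [riem]. *)
HB.lock Definition curv (R : realType) (e : 'rV[R]_4 -> 'M[R]_4)
    (i j : 'I_4) (x : 'rV[R]_4) : 'M[R]_4 :=
  dconn e i j x - dconn e j i x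
  - (conn e i x *m conn e j x - conn e j x *m conn e i x).

Arguments frame {R} e.
Arguments de {R} e.
Arguments dde {R} e.
Arguments dg {R} e.
Arguments lowered {R} e.
Arguments gam {R} e.
Arguments conn {R} e.
Arguments dgam {R} e.
Arguments dconn {R} e.
Arguments curv31 {R} e.
Arguments curv {R} e.

Section CoframeGeometry.
Variables (R : realType) (e : 'rV[R]_4 -> 'M[R]_4) (V : set 'rV[R]_4).
Hypothesis e_regular : regular_coframe V e.

Let oV : open V. Proof. by have [] := e_regular. Qed.
Let e_unit x : V x -> e x \in unitmx.
Proof. by have [_ H _] := e_regular; exact: H. Qed.
Let e_smooth i k : smooth_on V (fun x => e x i k).
Proof. by have [_ _ H] := e_regular; exact: H. Qed.

Local Notation dir k := (delta_mx 0 k : 'rV[R]_4).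
Local Notation frame := (frame e).
Local Notation de := (de e).
Local Notation dde := (dde e).
Local Notation dg := (dg e).
Local Notation lowered := (lowered e).
Local Notation gam := (gam e).
Local Notation conn := (conn e).
Local Notation dgam := (dgam e).
Local Notation dconn := (dconn e).
Local Notation curv31 := (curv31 e).
Local Notation curv := (curv e).

Lemma nearV x : V x -> \forall y \near x, V y.
Proof. by move=> Vx; exact: open_nbhs_nbhs (conj oV Vx). Qed.

Lemma frameE x : frame x = invmx (e x).
Proof. by rewrite frame.unlock. Qed.

Lemma deE k x i j : de k x i j = pd k (fun y => e y i j) x.
Proof. by rewrite de.unlock mxE. Qed.

Lemma ddeE l k x i j : dde l k x i j = pd l (pd k (fun y => e y i j)) x.
Proof. by rewrite dde.unlock mxE. Qed.

Lemma is_derive_coframe k x : V x -> is_derive x (dir k) e (de k x).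
Proof.
move=> Vx; apply/is_derive_mxP => i j; rewrite deE.
apply: DeriveDef; last by [].
by have [_ /(_ k)[H _]] := e_smooth i j 1%N; exact: H.
Qed.

Lemma is_derive_de l k x : V x -> is_derive x (dir l) (de k) (dde l k x).
Proof.
move=> Vx; apply/is_derive_mxP => i j; rewrite ddeE.
have -> : (fun y => de k y i j) = pd k (fun z => e z i j).
  by apply/funext => y; rewrite deE.
apply: DeriveDef; last by [].
by have [_ /(_ k)[_ [_ /(_ l)[H _]]]] := e_smooth i j 2%N; exact: H.
Qed.

Lemma ddeC l k x : V x -> dde l k x = dde k l x.
Proof.
move=> Vx; apply/matrixP => i j; rewrite !ddeE.
have S := e_smooth i j 2%N.
apply: derive_commutes.
- apply: filterS (nearV Vx) => y Vy; have [_ /(_ k)[H [_ /(_ l)[H' _]]]] := S.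
  exact: conj (H y Vy) (H' y Vy).
- apply: filterS (nearV Vx) => y Vy; have [_ /(_ l)[H [_ /(_ k)[H' _]]]] := S.
  exact: conj (H y Vy) (H' y Vy).
- by have [_ /(_ k)[_ [_ /(_ l)[_ [H _]]]]] := S; exact: H.
- by have [_ /(_ l)[_ [_ /(_ k)[_ [H _]]]]] := S; exact: H.
Qed.

Lemma is_derive_frame k x : V x ->
  is_derive x (dir k) frame (- (frame x *m de k x *m frame x)).
Proof.
move=> Vx; rewrite frameE.
have -> : frame = (fun y => invmx (e y)) by apply/funext => y; rewrite frameE.
apply: is_derive_invmx (is_derive_coframe k Vx).
by apply: filterS (nearV Vx) => y; exact: e_unit.
Qed.

Lemma frameK x : V x -> e x *m frame x = 1%:M.
Proof. by move=> Vx; rewrite frameE mulmxV// e_unit. Qed.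

Lemma coframeK x : V x -> frame x *m e x = 1%:M.
Proof. by move=> Vx; rewrite frameE mulVmx// e_unit. Qed.

Lemma frame_trK x : V x -> (frame x)^T *m (e x)^T = 1%:M.
Proof. by move=> Vx; rewrite -trmx_mul frameK// trmx1. Qed.

Lemma coframe_trK x : V x -> (e x)^T *m (frame x)^T = 1%:M.
Proof. by move=> Vx; rewrite -trmx_mul coframeK// trmx1. Qed.

Lemma cometricE x : V x -> cometric e x = frame x *m (frame x)^T.
Proof.
move=> Vx; have gK : frame x *m (frame x)^T *m metric e x = 1%:M.
  by rewrite /metric -mulmxA (mulmxA _^T) frame_trK// mul1mx coframeK.
have gu : metric e x \in unitmx by have [] := mulmx1_unit gK.
by rewrite -[LHS]mul1mx -gK mulmxK.
Qed.

Lemma tr_metric x : (metric e x)^T = metric e x.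
Proof. by rewrite trmx_mul trmxK. Qed.

Lemma dgE k x : dg k x = (de k x)^T *m e x + (e x)^T *m de k x.
Proof. by rewrite dg.unlock. Qed.

Lemma is_derive_metric k x : V x -> is_derive x (dir k) (metric e) (dg k x).
Proof.
move=> Vx; have H := is_derive_coframe k Vx; rewrite dgE.
exact: is_derive_mulmx (is_derive_trmx H) H.
Qed.

Lemma dg_sym k x : (dg k x)^T = dg k x.
Proof. by rewrite dg.unlock linearD /= !trmx_mul !trmxK addrC. Qed.

Lemma dgC k x i j : dg k x i j = dg k x j i.
Proof. by rewrite -[in LHS]dg_sym [LHS]mxE. Qed.

Lemma pd_metric k i j x : V x -> pd k (fun y => metric e y i j) x = dg k x i j.
Proof. by move=> Vx; have /is_derive_mxP/(_ i j)[_ <-] := is_derive_metric k Vx. Qed.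

Lemma loweredE k x l i :
  lowered k x l i = 2^-1 * (dg k x i l + dg i x k l - dg l x k i).
Proof. by rewrite lowered.unlock [LHS]mxZE [in LHS]mxE. Qed.

Lemma christoffelE k x m i : V x -> christoffel e x m k i = gam k x m i.
Proof.
move=> Vx; rewrite /christoffel mulr_sumr gam.unlock mxE; apply: eq_bigr => l _.
rewrite cometricE// (pd_metric k) // (pd_metric i)// (pd_metric l)//.
by rewrite loweredE mulrCA.
Qed.

Lemma gamC k x m i : gam k x m i = gam i x m k.
Proof.
rewrite gam.unlock [LHS]mxE [RHS]mxE; apply: eq_bigr => l _; congr (_ * _).
rewrite (loweredE k) (loweredE i); have := dgC l x k i.
by move: (dg k x) (dg i x) (dg l x) => A B C ->; field.
Qed.

(** Adding the symbols of the first kind to their transpose cancels all derivatives of the metric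
    except the one along [k]. *)
Lemma metric_compatible k x : V x ->
  dg k x = (gam k x)^T *m metric e x + metric e x *m gam k x.
Proof.
move=> Vx.
have E : metric e x *m gam k x = lowered k x.
  rewrite gam.unlock /metric -mulmxA (mulmxA (e x)) (mulmxA (e x)) frameK// mul1mx.
  by rewrite mulmxA coframe_trK// mul1mx.
have E' : (gam k x)^T *m metric e x = (lowered k x)^T.
  by rewrite -E (trmx_mul (metric e x)) tr_metric.
rewrite E E'; apply/matrixP => i j; rewrite [RHS]mxDE mxTE !loweredE.
have := dgC k x j i; move: (dg k x) (dg i x) (dg j x) => A B C ->.
by field.
Qed.

Lemma de_conn k x : V x -> de k x = e x *m gam k x + conn k x *m e x.
Proof. by move=> Vx; rewrite conn.unlock -mulmxA coframeK// mulmx1 addrC subrK. Qed.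

(** Metric compatibility read in the orthonormal frame: substituting [de_conn] cancels the
    Christoffel terms, and what remains is that the symmetric part of [conn], pulled back by [e],
    vanishes. *)
Lemma conn_skew k x : V x -> (conn k x)^T = - conn k x.
Proof.
move=> Vx; apply/eqP; rewrite -addr_eq0; apply/eqP.
have := metric_compatible k Vx; rewrite dgE de_conn// /metric.
move: (e x) (frame x) (gam k x) (conn k x) (frameK Vx) (frame_trK Vx) => E F G T.
move=> EF FE; rewrite linearD /= mulmxDl mulmxDr !trmx_mul -!mulmxA => H.
have : E^T *m (T^T *m E) + E^T *m (T *m E) = 0.
  move: H; set a := G^T *m _; set b := E^T *m (T^T *m E).
  set c := E^T *m (E *m G); set d := E^T *m (T *m E); clearbody a b c d => H.
  by apply/matrixP => i j; move/matrixP/(_ i j): H; rewrite !mxE; lra.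
move=> /(congr1 (fun M => F^T *m M *m F)).
rewrite mulmx0 mul0mx mulmxDr mulmxDl !mulmxA FE !mul1mx -!mulmxA EF !mulmx1.
by [].
Qed.

Lemma is_derive_gam l k x : V x -> is_derive x (dir l) (gam k) (dgam l k x).
Proof.
move=> Vx; rewrite dgam.unlock; apply: derivableP.
have Hf := is_derive_frame l Vx.
have Hdg p : is_derive x (dir l) (dg p) ('D_(dir l) (dg p) x).
  have H1 := is_derive_coframe l Vx; have H2 := is_derive_de l p Vx.
  have H3 := is_deriveD (is_derive_mulmx (is_derive_trmx H2) H1)
     (is_derive_mulmx (is_derive_trmx H1) H2).
  have [H _] := H3; apply: derivableP.
  have -> : dg p = (fun y => (de p y)^T *m e y + (e y)^T *m de p y).
    by apply/funext => y; rewrite dgE.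
  exact: H.
have Hlow : is_derive x (dir l) (lowered k) ('D_(dir l) (lowered k) x).
  apply: derivableP; apply/derivable_mxP => i j.
  have -> : (fun y => lowered k y i j) = 2^-1 \*: ((fun y => dg k y j i) +
      (fun y => dg j y k i) - (fun y => dg i y k j)).
    by apply/funext => y; rewrite loweredE.
  apply: derivableZ.
  have D p a b : derivable (fun y => dg p y a b) x (dir l).
    by have /is_derive_mxP/(_ a b)[H _] := Hdg p; exact: H.
  by apply: derivableB; [apply: derivableD|]; exact: D.
have [H _] := is_derive_mulmx (is_derive_mulmx Hf (is_derive_trmx Hf)) Hlow.
have -> : gam k = (fun y => frame y *m (frame y)^T *m lowered k y).
  by apply/funext => y; rewrite gam.unlock.
exact: H.
Qed.

Lemma dgamE l k x i j : V x -> dgam l k x i j = 'D_(dir l) (fun y => gam k y i j) x.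
Proof.
by move=> Vx; have [H _] := is_derive_gam l k Vx; rewrite dgam.unlock (derive_mx H) [LHS]mxE.
Qed.

Lemma is_derive_conn l k x : V x -> is_derive x (dir l) (conn k) (dconn l k x).
Proof.
move=> Vx; rewrite dconn.unlock; apply: derivableP.
have -> : conn k = (fun y => (de k y - e y *m gam k y) *m frame y).
  by apply/funext => y; rewrite conn.unlock.
have [H _] := is_derive_mulmx (is_deriveB (is_derive_de l k Vx)
  (is_derive_mulmx (is_derive_coframe l Vx) (is_derive_gam l k Vx)))
  (is_derive_frame l Vx).
exact: H.
Qed.

Lemma pd_christoffel i j k l x : V x ->
  pd i (fun y => christoffel e y l j k) x = dgam i j x l k.
Proof.
move=> Vx; rewrite /pd (@near_eq_derive _ _ _ _ (fun y => gam j y l k)); last first.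
  by apply: filterS (nearV Vx) => y Vy; exact: christoffelE.
by rewrite dgamE.
Qed.

Lemma riem31E l i j k x : V x -> riem31 e x l i j k = curv31 i j x l k.
Proof.
move=> Vx; rewrite /riem31 (pd_christoffel i)// (pd_christoffel j)//.
have -> : curv31 i j x l k = dgam i j x l k - dgam j i x l k +
    ((gam i x *m gam j x) l k - (gam j x *m gam i x) l k).
  by rewrite curv31.unlock 2!mxDE mxNE (mxDE (gam i x *m _)) (mxNE (gam j x *m _)).
congr (_ + _).
rewrite [X in _ = X - _]mxE [X in _ = _ - X]mxE -sumrB; apply: eq_bigr => m _.
rewrite (christoffelE i l m)// (christoffelE j m k)//.
by rewrite (christoffelE j l m)// (christoffelE i m k).
Qed.

Lemma dde_conn l k x : V x ->
  dde l k x = de l x *m gam k x + e x *m dgam l k x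
              + (dconn l k x *m e x + conn k x *m de l x).
Proof.
move=> Vx; have [_ <-] := is_derive_de l k Vx.
have [_ <-] := is_deriveD
  (is_derive_mulmx (is_derive_coframe l Vx) (is_derive_gam l k Vx))
  (is_derive_mulmx (is_derive_conn l k Vx) (is_derive_coframe l Vx)).
by apply: near_eq_derive; apply: filterS (nearV Vx) => y Vy; exact: de_conn.
Qed.

(* Compares the mixed second derivatives of the coframe, computed from [de_conn]. *)
Lemma curv31E i j x : V x -> e x *m curv31 i j x = - (curv i j x *m e x).
Proof.
move=> Vx; have := ddeC i j Vx.
rewrite (dde_conn i j Vx) (dde_conn j i Vx) (de_conn i Vx) (de_conn j Vx).
rewrite curv31.unlock curv.unlock.
move: (e x) (gam i x) (gam j x) (conn i x) (conn j x) (dgam i j x) (dgam j i x).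
move: (dconn i j x) (dconn j i x) => A B C D E F G H K.
rewrite !(mulmxDl, mulmxDr, mulmxBl, mulmxBr, mulmxN, mulNmx) -!mulmxA.
move: (C *m (D *m E)) (C *m (E *m D)) (F *m (C *m E)) (F *m (C *m D)).
move: (G *m (C *m E)) (G *m (C *m D)) (C *m H) (C *m K) (A *m C) (B *m C).
move: (F *m (G *m C)) (G *m (F *m C)).
move=> *; apply/matrixP => p q.
match goal with H : _ = _ |- _ => move/matrixP/(_ p q): H end.
by rewrite !mxE; lra.
Qed.

Lemma curv_skew i j x : V x -> (curv i j x)^T = - curv i j x.
Proof.
move=> Vx.
have Hd a b : (dconn a b x)^T = - dconn a b x.
  have D := is_derive_conn a b Vx.
  have [_ <-] := is_derive_trmx D; have [_ <-] := is_deriveN D.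
  by apply: near_eq_derive; apply: filterS (nearV Vx) => y Vy; exact: conn_skew.
move: (conn_skew i Vx) (conn_skew j Vx) (Hd i j) (Hd j i); rewrite curv.unlock.
move: (conn i x) (conn j x) (dconn i j x) (dconn j i x) => A B C D AE BE CE DE.
rewrite !raddfB /= !trmx_mul AE BE CE DE !mulmxN !mulNmx !opprK.
by apply/matrixP => p q; rewrite !mxlinE; ring.
Qed.

Lemma curv_anti i j x : curv j i x = - curv i j x.
Proof.
rewrite curv.unlock; move: (dconn i j x) (dconn j i x) (_ *m _) (_ *m _) => A B C D.
by apply/matrixP => p q; rewrite !mxE; ring.
Qed.

(** First Bianchi identity: the symmetry [gamC], that is vanishing torsion of the Levi-Civita
    connection, makes both the derivatives and the products cancel in the cyclic sum. *)
Lemma bianchi31 i j k l x : V x ->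
  curv31 i j x l k + curv31 j k x l i + curv31 k i x l j = 0.
Proof.
move=> Vx.
have Hd a b c : dgam a b x l c = dgam a c x l b.
  rewrite (dgamE a b l c Vx) (dgamE a c l b Vx).
  have -> : (fun y => gam b y l c) = (fun y => gam c y l b).
    by apply/funext => y; exact: gamC.
  by [].
have HG a b c : (gam a x *m gam b x) l c = (gam a x *m gam c x) l b.
  by rewrite [LHS]mxE [RHS]mxE; apply: eq_bigr => m _; rewrite (gamC b x m c).
have E a b c : curv31 a b x l c = dgam a b x l c - dgam b a x l c +
    ((gam a x *m gam b x) l c - (gam b x *m gam a x) l c).
  by rewrite curv31.unlock 2!mxDE mxNE (mxDE (gam a x *m _)) (mxNE (gam b x *m _)).
rewrite (E i j k) (E j k i) (E k i j).
pose D a b c := dgam a b x l c; pose P a b c := (gam a x *m gam b x) l c.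
have : D i j k - D j i k + (P i j k - P j i k) + (D j k i - D k j i +
    (P j k i - P k j i)) + (D k i j - D i k j + (P k i j - P i k j)) = 0.
  have HD : forall a b c, D a b c = D a c b by exact: Hd.
  have HP : forall a b c, P a b c = P a c b by exact: HG.
  move: D P HD HP => D P HD HP.
  rewrite (HD i j k) (HD j k i) (HD k i j).
  by rewrite (HP i j k) (HP j k i) (HP k i j); ring.
by [].
Qed.

Lemma curvE i j x : curv i j x =
  dconn i j x - dconn j i x - (conn i x *m conn j x - conn j x *m conn i x).
Proof. by rewrite curv.unlock. Qed.

End CoframeGeometry.

(** * Self-dual coefficients and the torsion forms *)

Section LinearFunctionals.
Variable R : realType.
Implicit Types A B : 'M[R]_4.

Lemma sdD A B p : sd (A + B) p = sd A p + sd B p.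
Proof.
rewrite !sdE -mulrDr -big_split /=; congr (_ * _).
by apply: eq_bigr => a _; rewrite mxDE mulrDr.
Qed.

Lemma sdZ c A p : sd (c *: A) p = c * sd A p.
Proof.
rewrite !sdE [RHS]mulrCA [in RHS]mulr_sumr; congr (_ * _).
by apply: eq_bigr => a _; rewrite mxZE mulrCA.
Qed.

Lemma sdN A p : sd (- A) p = - sd A p.
Proof. by rewrite -scaleN1r sdZ mulN1r. Qed.

Lemma asdD A B p : asd (A + B) p = asd A p + asd B p.
Proof.
rewrite !asdE -mulrDr -big_split /=; congr (_ * _).
by apply: eq_bigr => a _; rewrite mxDE mulrDr.
Qed.

Lemma asdZ c A p : asd (c *: A) p = c * asd A p.
Proof.
rewrite !asdE [RHS]mulrCA [in RHS]mulr_sumr; congr (_ * _).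
by apply: eq_bigr => a _; rewrite mxZE mulrCA.
Qed.

Lemma asdN A p : asd (- A) p = - asd A p.
Proof. by rewrite -scaleN1r asdZ mulN1r. Qed.

Lemma sd_omega0 p q : sd (omega0 R p) q = 2 *+ (p == q).
Proof.
rewrite sdE sum4 !omega0E; move: p q; elim/ord3_ind; elim/ord3_ind;
  by rewrite /somega /flip /= ?mulr0n ?mulr1n; field.
Qed.

Lemma ord3_neq (p : 'I_3) : ((p + 1 == p + 2) = false) * ((p + 2 == p + 1) = false).
Proof. by move: p; elim/ord3_ind; rewrite !ord3D. Qed.

Lemma addr_add12 (p : 'I_3) : p + (1 + 2) = p.
Proof. by move: p; elim/ord3_ind; apply: val_inj. Qed.

Lemma omega0_free (a b : R) (p : 'I_3) :
  a *: omega0 R (p + 1) - b *: omega0 R (p + 2) = 0 -> a = 0 /\ b = 0.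
Proof.
move=> E.
have E1 : sd (a *: omega0 R (p + 1) - b *: omega0 R (p + 2)) (p + 1) = a * 2.
  by rewrite sdD sdN !sdZ !sd_omega0 eqxx !ord3_neq mulr0n mulr1n; ring.
have E2 : sd (a *: omega0 R (p + 1) - b *: omega0 R (p + 2)) (p + 2) = - (b * 2).
  by rewrite sdD sdN !sdZ !sd_omega0 eqxx !ord3_neq mulr0n mulr1n; ring.
have sd0 q : sd (0 : 'M[R]_4) q = 0 by rewrite -(scale0r 0) sdZ mul0r.
by rewrite E sd0 in E1; rewrite E sd0 in E2; split; lra.
Qed.

Lemma is_derive_sd (V : normedModType R) (F : V -> 'M[R]_4) D x v p :
  is_derive x v F D -> is_derive x v (fun y => sd (F y) p) (sd D p).
Proof.
move=> /is_derive_mxP HF.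
have -> : (fun y => sd (F y) p)
    = 2^-1 \*: \sum_a (fun y => somega R p a * F y a (flip p a)).
  by apply/funext => y; rewrite sdE /= fct_sumE.
by rewrite sdE; apply: is_deriveZ; apply: is_derive_sum => a; apply: is_deriveZ.
Qed.

End LinearFunctionals.

(* The torsion forms are the self-dual part of the connection matrix, because
   nabla om is its commutator with omega0; see [nabla2_om]. *)
HB.lock Definition tform (R : realType) (e : 'rV[R]_4 -> 'M[R]_4)
    (p : 'I_3) (x : 'rV[R]_4) : 'rV[R]_4 :=
  \row_k sd (conn e k x) p.

HB.lock Definition dtform (R : realType) (e : 'rV[R]_4 -> 'M[R]_4)
    (k : 'I_4) (p : 'I_3) (x : 'rV[R]_4) : 'rV[R]_4 :=
  \row_l sd (dconn e k l x) p.

Arguments tform {R} e.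
Arguments dtform {R} e.

Section Torsion.
Variables (R : realType) (e : 'rV[R]_4 -> 'M[R]_4) (V : set 'rV[R]_4).
Hypothesis H : regular_coframe V e.

Local Notation tform := (tform e).
Local Notation dtform := (dtform e).

Local Notation dir k := (delta_mx 0 k : 'rV[R]_4).

Lemma dtformE k p x l : dtform k p x 0 l = sd (dconn e k l x) p.
Proof. by rewrite dtform.unlock mxE. Qed.

Lemma tformE p x k : tform p x 0 k = sd (conn e k x) p.
Proof. by rewrite tform.unlock mxE. Qed.

Lemma pd_entry (b : 'rV[R]_4 -> 'M[R]_4) db k i j x :
  is_derive x (dir k) b db -> pd k (fun y => b y i j) x = db i j.
Proof. by move=> /is_derive_mxP/(_ i j)[_ <-]. Qed.

Lemma pd_entry_row (b : 'rV[R]_4 -> 'rV[R]_4) db k i x :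
  is_derive x (dir k) b db -> pd k (fun y => b y 0 i) x = db 0 i.
Proof. by move=> /is_derive_mxP/(_ 0 i)[_ <-]. Qed.

Lemma nabla2E (b : 'rV[R]_4 -> 'M[R]_4) db k x : V x ->
  is_derive x (dir k) b db ->
  nabla2 e b x k = db - (gam e k x)^T *m b x - b x *m gam e k x.
Proof.
move=> Vx Hb; apply/matrixP => i j; rewrite [LHS]mxE (pd_entry _ _ Hb).
rewrite [RHS]mxDE (mxDE db) [X in _ = _ + X + _]mxNE [X in _ = _ + X]mxNE.
rewrite [((gam e k x)^T *m _) i j]mxE [(b x *m _) i j]mxE.
congr (_ - _ - _); apply: eq_bigr => m _; rewrite (christoffelE H)//.
  by rewrite mxTE.
exact: mulrC.
Qed.

Lemma is_derive_om p k x : V x -> is_derive x (dir k) (om e p)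
  ((de e k x)^T *m omega0 R p *m e x + (e x)^T *m omega0 R p *m de e k x).
Proof.
move=> Vx; have D := is_derive_coframe H k Vx.
have D0 : is_derive x (dir k) (fun=> omega0 R p) 0 by exact: is_derive_cst.
apply: is_derive_eq (is_derive_mulmx (is_derive_mulmx (is_derive_trmx D) D0) D) _.
by rewrite mulmx0 addr0.
Qed.

(** The components of [om] in the frame are constant, so only the connection acts on them, and
    skewness of [conn] turns that action into a commutator. *)
Lemma nabla2_om p k x : V x -> nabla2 e (om e p) x k
  = sd (conn e k x) (p + 2) *: om e (p + 1) x - sd (conn e k x) (p + 1) *: om e (p + 2) x.
Proof.
move=> Vx; rewrite (nabla2E Vx (is_derive_om p k Vx)) /om.
have pullZB (c d : R) (E X Y : 'M[R]_4) :
    c *: (E^T *m X *m E) - d *: (E^T *m Y *m E) = E^T *m (c *: X - d *: Y) *m E.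
  by rewrite mulmxBr mulmxBl -!scalemxAr -!scalemxAl.
rewrite pullZB.
rewrite -(commutator_omega0 p (conn_skew H k Vx)) (de_conn H k Vx).
move: (conn_skew H k Vx).
move: (e x) (gam e k x) (conn e k x) (omega0 R p) => E G T W TE.
rewrite linearD /= !trmx_mul TE.
rewrite !(mulmxDl, mulmxDr, mulmxBl, mulmxBr, mulmxN, mulNmx) -!mulmxA.
move: (G^T *m (E^T *m (W *m E))) (E^T *m (W *m (E *m G))).
move: (E^T *m (T *m (W *m E))) (E^T *m (W *m (T *m E))) => a b c d.
by apply/matrixP => i j; rewrite !mxlinE; ring.
Qed.

Lemma frame_om p x : V x -> (frame e x)^T *m om e p x *m frame e x = omega0 R p.
Proof.
move=> Vx; rewrite /om !mulmxA (frame_trK H)// mul1mx -mulmxA (frameK H)//.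
by rewrite mulmx1.
Qed.

(** Existence and uniqueness of the torsion forms: the defining equations have linearly independent
    right-hand sides, so any solution agrees on [V] with the self-dual part of the connection. *)
Lemma torsion_formsP a :
  torsion_forms e V a <-> forall p y, V y -> a p y = tform p y.
Proof.
split=> [Ha p y Vy|Ha p k x Vx]; last first.
  by rewrite nabla2_om// (Ha (p + 1))// (Ha (p + 2))// !tformE.
apply/rowP => k; rewrite tformE.
(* The equation for [p + 1] is the one in which [a p] appears, because [p + 1 + 2 = p] modulo 3. *)
have := Ha (p + 1) k y Vy; rewrite nabla2_om// => /esym/eqP.
rewrite -subr_eq0 => /eqP /(congr1 (fun M => (frame e y)^T *m M *m frame e y)).
rewrite mulmx0 mul0mx.
rewrite !(mulmxBr, mulmxBl) -!scalemxAr -!scalemxAl !frame_om//.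
have -> : p + 1 + 2 = p by rewrite -addrA addr_add12.
set q1 := p + 1 + 1 => E.
have : (a p y 0 k - sd (conn e k y) p) *: omega0 R (p + 1 + 1)
     - (a q1 y 0 k - sd (conn e k y) q1) *: omega0 R (p + 1 + 2) = 0.
  by rewrite -(addrA p 1 2) addr_add12 -[RHS]E !scalerBl; apply/matrixP => i j;
     rewrite !mxlinE; ring.
by move=> /omega0_free[/eqP + _]; rewrite subr_eq0 => /eqP.
Qed.

Variable a : 'I_3 -> 'rV[R]_4 -> 'rV[R]_4.
Hypothesis aP : torsion_forms e V a.

Let aE p y : V y -> a p y = tform p y.
Proof. by move: p y; apply/torsion_formsP. Qed.

Lemma is_derive_tors k p x : V x -> is_derive x (dir k) (a p) (dtform k p x).
Proof.
move=> Vx; apply: (@near_eq_is_derive _ _ _ (tform p)).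
  by apply: filterS (nearV H Vx) => y Vy; rewrite aE.
apply/is_derive_mxP => i j; rewrite (ord1 i) dtformE.
have -> : (fun y => tform p y 0 j) = (fun y => sd (conn e j y) p).
  by apply/funext => y; rewrite tformE.
exact: is_derive_sd (is_derive_conn H k j Vx).
Qed.

Lemma nabla1E p k l x : V x ->
  nabla1 e (a p) x k l = sd (dconn e k l x) p - (a p x *m gam e k x) 0 l.
Proof.
move=> Vx; rewrite [LHS]mxE (pd_entry_row _ (is_derive_tors k p Vx)).
rewrite dtformE; congr (_ - _); rewrite [RHS]mxE; apply: eq_bigr => m _.
by rewrite (christoffelE H)// mulrC.
Qed.

(** The Christoffel terms are symmetric in [k] and [l], so they drop out of the skew part. *)
Lemma ext1E p k l x : V x ->
  ext1 (a p) x k l = nabla1 e (a p) x k l - nabla1 e (a p) x l k.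
Proof.
move=> Vx; rewrite !nabla1E// [LHS]mxE !(pd_entry_row _ (is_derive_tors _ p Vx)).
rewrite (dtformE k) (dtformE l).
have -> : (a p x *m gam e k x) 0 l = (a p x *m gam e l x) 0 k.
  by rewrite [LHS]mxE [RHS]mxE; apply: eq_bigr => m _; rewrite (gamC e k x m l).
by rewrite opprB addrA subrK.
Qed.

(** Self-dual part of the structure equation: the derivatives of the connection assemble into d a_p,
    and [sd_commutator] turns the commutator into the wedge of the two other torsion forms. *)
Lemma sd_curv p i j x : V x -> sd (curv e i j x) p = ext1 (a p) x i j
  + (a (p + 1) x 0 i * a (p + 2) x 0 j - a (p + 2) x 0 i * a (p + 1) x 0 j).
Proof.
move=> Vx; rewrite [ext1 _ _ _ _]mxE !(pd_entry_row _ (is_derive_tors _ p Vx)).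
rewrite (dtformE i) (dtformE j) (aE (p + 1) Vx) (aE (p + 2) Vx) !tformE.
rewrite curvE sdD sdN sdD sdN.
rewrite (sd_commutator p (conn_skew H i Vx) (conn_skew H j Vx)).
by rewrite opprB.
Qed.

End Torsion.

(** * Volume form, Hodge star and codifferential *)

Section VolumeForm.
Variable R : realType.

(** Laplace expansion written out as a polynomial in the columns, so that multilinearity and
    particular values are left to [ring]. *)
Definition det4 (u v w z : 'I_4 -> R) : R :=
  let a i := [:: u (ord4 0); u (ord4 1); u (ord4 2); u (ord4 3)]`_i in
  let b i := [:: v (ord4 0); v (ord4 1); v (ord4 2); v (ord4 3)]`_i in
  let c i := [:: w (ord4 0); w (ord4 1); w (ord4 2); w (ord4 3)]`_i in
  let d i := [:: z (ord4 0); z (ord4 1); z (ord4 2); z (ord4 3)]`_i in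
  let det2 i j := c i * d j - c j * d i in
  let det3 i j k := b i * det2 j k - b j * det2 i k + b k * det2 i j in
  a 0 * det3 1 2 3 - a 1 * det3 0 2 3 + a 2 * det3 0 1 3 - a 3 * det3 0 1 2.

Lemma det4E (M : 'M[R]_4) : \det M = det4 (M ^~ (ord4 0)) (M ^~ (ord4 1))
  (M ^~ (ord4 2)) (M ^~ (ord4 3)).
Proof.
(* Entries indexed by natural numbers: the nested lifts of the cofactor expansion then reduce to
   numerals and become comparable. *)
pose f a b := M (inord a) (inord b).
have E i j : M i j = f (val i) (val j) by rewrite /f !inord_val.
do 3 rewrite !(expand_det_col _ ord0) !big_ord_recl !big_ord0 /cofactor.
rewrite !det_mx11 !mxE !E /det4 !E /= /bump /=.
ring.
Qed.

End VolumeForm.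

Section FrameVolume.
Variable R : realType.

Definition delta (a i : 'I_4) : R := (i == a)%:R.

Definition eps (a b c d : 'I_4) : R := det4 (delta a) (delta b) (delta c) (delta d).

Lemma sum_det4_1 (f : 'I_4 -> R) (M : 'M[R]_4) v w z :
  \sum_i f i * det4 (M ^~ i) v w z = det4 (fun r => \sum_i f i * M r i) v w z.
Proof. by rewrite /det4 /= !sum4; ring. Qed.

Lemma sum_det4_2 (f : 'I_4 -> R) (M : 'M[R]_4) u w z :
  \sum_i f i * det4 u (M ^~ i) w z = det4 u (fun r => \sum_i f i * M r i) w z.
Proof. by rewrite /det4 /= !sum4; ring. Qed.

Lemma sum_det4_3 (f : 'I_4 -> R) (M : 'M[R]_4) u v z :
  \sum_i f i * det4 u v (M ^~ i) z = det4 u v (fun r => \sum_i f i * M r i) z.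
Proof. by rewrite /det4 /= !sum4; ring. Qed.

Lemma sum_det4_4 (f : 'I_4 -> R) (M : 'M[R]_4) u v w :
  \sum_i f i * det4 u v w (M ^~ i) = det4 u v w (fun r => \sum_i f i * M r i).
Proof. by rewrite /det4 /= !sum4; ring. Qed.

Lemma volE (e : 'rV[R]_4 -> 'M[R]_4) x i j k l :
  vol e x i j k l = det4 (e x ^~ i) (e x ^~ j) (e x ^~ k) (e x ^~ l).
Proof.
rewrite /vol det4E; congr det4; apply/funext => r; rewrite mxE;
  by congr (e x r _).
Qed.

Lemma vol_eps (e : 'rV[R]_4 -> 'M[R]_4) x i j k l :
  vol e x i j k l = \det (e x) * eps i j k l.
Proof.
pose P : 'M[R]_4 := \matrix_(r, c) delta (tnth [tuple i; j; k; l] c) r.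
have -> : eps i j k l = \det P.
  rewrite det4E /eps; congr det4; apply/funext => r; rewrite mxE;
  by congr (delta _ r).
rewrite -det_mulmx /vol {}/P; move: (tnth _) => t.
congr (\det _); apply/matrixP => r c; rewrite !mxE.
rewrite (bigD1 (t c))//= mxE /delta eqxx mulr1 big1 ?addr0//.
by move=> m ne; rewrite mxE /delta (negPf ne) mulr0.
Qed.

(** By multilinearity, each contraction with a column of [F] replaces one column of the coframe by a
    standard basis vector. *)
Lemma sum_vol (e : 'rV[R]_4 -> 'M[R]_4) x (F : 'M[R]_4) a b c d :
  e x *m F = 1%:M ->
  \sum_i F i a * \sum_j F j b * \sum_k F k c * \sum_l F l d * vol e x i j k l
  = eps a b c d.
Proof.
move=> EF.
have dE q : (fun r => \sum_i F i q * e x r i) = delta q.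
  apply/funext => r; have /matrixP/(_ r q) := EF; rewrite !mxE /delta => <-.
  by apply: eq_bigr => i _; rewrite mulrC.
transitivity (\sum_i F i a * \sum_j F j b * \sum_k F k c *
    det4 (e x ^~ i) (e x ^~ j) (e x ^~ k) (delta d)).
  apply: eq_bigr => i _; congr (_ * _); apply: eq_bigr => j _; congr (_ * _).
  apply: eq_bigr => k _; congr (_ * _).
  by rewrite -dE -sum_det4_4; apply: eq_bigr => l _; rewrite volE.
transitivity (\sum_i F i a * \sum_j F j b *
    det4 (e x ^~ i) (e x ^~ j) (delta c) (delta d)).
  apply: eq_bigr => i _; congr (_ * _); apply: eq_bigr => j _; congr (_ * _).
  by rewrite -(dE c) -sum_det4_3.
transitivity (\sum_i F i a * det4 (e x ^~ i) (delta b) (delta c) (delta d)).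
  by apply: eq_bigr => i _; congr (_ * _); rewrite -(dE b) -sum_det4_2.
by rewrite /eps -(dE a) -sum_det4_1.
Qed.

Lemma star_eta0 a b k : 2^-1 * \sum_c \sum_d eps a b c d * eta0 R k c d = - eta0 R k a b.
Proof.
transitivity (2^-1 * \sum_c seta R k c * eps a b c (flip k c)).
  congr (_ * _); apply: eq_bigr => c _; rewrite (bigD1 (flip k c))//=.
  rewrite eta0E eqxx mulrC big1 ?addr0// => l ne.
  by rewrite eta0E (negPf ne) mulr0.
rewrite sum4 eta0E; move: k a b; elim/ord3_ind; elim/ord4_ind; elim/ord4_ind;
  rewrite /seta /flip /eps /det4 /delta /= ?mulr0n ?mulr1n; by field.
Qed.

Lemma ord4E : ((0 : 'I_4) = ord4 0) * ((1 : 'I_4) = ord4 1) *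
  ((2 : 'I_4) = ord4 2) * ((3 : 'I_4) = ord4 3).
Proof. by do !split; apply: val_inj. Qed.

Lemma eps_123 m : eps m 1 2 3 = (m == 0)%:R.
Proof.
rewrite !ord4E.
by move: m; elim/ord4_ind; rewrite /eps /det4 /delta /= ?mulr0n ?mulr1n; ring.
Qed.

Lemma eps_023 m : eps m 0 2 3 = - (m == 1)%:R.
Proof.
rewrite !ord4E.
by move: m; elim/ord4_ind; rewrite /eps /det4 /delta /= ?mulr0n ?mulr1n; ring.
Qed.

Lemma eps_013 m : eps m 0 1 3 = (m == 2)%:R.
Proof.
rewrite !ord4E.
by move: m; elim/ord4_ind; rewrite /eps /det4 /delta /= ?mulr0n ?mulr1n; ring.
Qed.

Lemma eps_012 m : eps m 0 1 2 = - (m == 3)%:R.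
Proof.
rewrite !ord4E.
by move: m; elim/ord4_ind; rewrite /eps /det4 /delta /= ?mulr0n ?mulr1n; ring.
Qed.

End FrameVolume.

Lemma sum_lin (R : realType) (I J : finType) (f : I -> R) (m : J -> R)
    (h : I -> J -> R) :
  \sum_i f i * \sum_j m j * h i j = \sum_j m j * \sum_i f i * h i j.
Proof.
under eq_bigr do rewrite mulr_sumr; rewrite exchange_big/=.
by apply: eq_bigr => j _; rewrite mulr_sumr; apply: eq_bigr => i _; exact: mulrCA.
Qed.

Section PointwiseStar.
Variables (R : realType) (e : 'rV[R]_4 -> 'M[R]_4) (V : set 'rV[R]_4).
Hypothesis H : regular_coframe V e.

(** In the frame the volume form becomes [eps]; it moves to the other side of the pairing, where it
    acts on [eta0] by -1. *)
Lemma asd_star2 x (b : 'M[R]_4) k : V x ->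
  asd ((frame e x)^T *m star2 e x b *m frame e x) k
  = - asd ((frame e x)^T *m b *m frame e x) k.
Proof.
move=> Vx; set F := frame e x; set B := F^T *m b *m F.
have up : cometric e x *m b *m cometric e x = F *m B *m F^T.
  by rewrite (cometricE H Vx) /B -/F !mulmxA.
have congE (A : 'M[R]_4) c d : (F^T *m A *m F) c d = \sum_k F k c * \sum_l F l d * A k l.
  rewrite -mulmxA mxE; apply: eq_bigr => i _; rewrite mxE; congr (_ * _).
  by rewrite mxE; apply: eq_bigr => j _; rewrite mulrC.
have starE c d : (F^T *m star2 e x b *m F) c d
    = 2^-1 * \sum_a \sum_b B a b * eps R a b c d.
  rewrite congE.
  transitivity (2^-1 * \sum_(p : 'I_4 * 'I_4) (F *m B *m F^T) p.1 p.2 *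
      (\sum_k F k c * \sum_l F l d * vol e x p.1 p.2 k l)).
    rewrite mulr_sumr.
    under [RHS]eq_bigr do rewrite mulrA.
    rewrite -[RHS]sum_lin; apply: eq_bigr => k0 _; congr (_ * _).
    rewrite -[RHS]sum_lin; apply: eq_bigr => l0 _; congr (_ * _).
    rewrite mxE up pair_big/= mulr_sumr; apply: eq_bigr => p _; exact: mulrA.
  congr (_ * _); rewrite pair_big/=.
  transitivity (\sum_(q : 'I_4 * 'I_4) B q.1 q.2 * \sum_(p : 'I_4 * 'I_4)
      (F p.1 q.1 * F p.2 q.2) * (\sum_k F k c * \sum_l F l d * vol e x p.1 p.2 k l)).
    under [RHS]eq_bigr do under eq_bigr do rewrite mulrC.
    rewrite [RHS]sum_lin; apply: eq_bigr => p _; rewrite [LHS]mulrC; congr (_ * _).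
    rewrite !mxE; under eq_bigr do rewrite !mxE mulr_suml.
    rewrite exchange_big pair_big/=; apply: eq_bigr => q _.
    by rewrite [F _ _ * B _ _]mulrC -mulrA.
  apply: eq_bigr => q _; congr (_ * _); rewrite -(sum_vol _ _ _ _ (frameK H Vx)).
  rewrite -(pair_big xpredT xpredT (fun i j => F i q.1 * F j q.2 *
    (\sum_k F k c * \sum_l F l d * vol e x i j k l)))/=.
  by apply: eq_bigr => i _; rewrite mulr_sumr; apply: eq_bigr => j _; rewrite mulrA.
rewrite /asd -mulrN; congr (_ * _).
transitivity (\sum_(p : 'I_4 * 'I_4) eta0 R k p.1 p.2 *
    \sum_(q : 'I_4 * 'I_4) B q.1 q.2 * (2^-1 * eps R q.1 q.2 p.1 p.2)).
  rewrite pair_big/=; apply: eq_bigr => p _; rewrite starE mulrC; congr (_ * _).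
  rewrite pair_big/= mulr_sumr; apply: eq_bigr => q _; exact: mulrCA.
rewrite sum_lin -(pair_big xpredT xpredT (fun a b0 => B a b0 *
  \sum_(p : 'I_4 * 'I_4) eta0 R k p.1 p.2 * (2^-1 * eps R a b0 p.1 p.2)))/=.
rewrite -sumrN; apply: eq_bigr => a _; rewrite -sumrN; apply: eq_bigr => b0 _.
rewrite -mulrN -star_eta0; congr (_ * _); rewrite pair_big/= mulr_sumr.
by apply: eq_bigr => p _; rewrite mulrC mulrA.
Qed.

End PointwiseStar.

Section Codifferential.
Variables (R : realType) (e : 'rV[R]_4 -> 'M[R]_4) (V : set 'rV[R]_4).
Hypothesis H : regular_coframe V e.
Variable a : 'I_3 -> 'rV[R]_4 -> 'rV[R]_4.
Hypothesis aP : torsion_forms e V a.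

Local Notation dir k := (delta_mx 0 k : 'rV[R]_4).

Lemma is_derive_cometric k x : V x -> is_derive x (dir k) (cometric e)
  (- (gam e k x *m cometric e x + cometric e x *m (gam e k x)^T)).
Proof.
move=> Vx; apply: (@near_eq_is_derive _ _ _ (fun y => frame e y *m (frame e y)^T)).
  by apply: filterS (nearV H Vx) => y Vy; rewrite (cometricE H Vy).
have D := is_derive_frame H k Vx.
apply: is_derive_eq (is_derive_mulmx D (is_derive_trmx D)) _.
rewrite (de_conn H k Vx) (cometricE H Vx).
move: (conn_skew H k Vx) (frameK H Vx) (coframeK H Vx).
move: (e x) (frame e x) (gam e k x) (conn e k x) => E F G T TE EF FE.
have -> : F *m (E *m G + T *m E) *m F = G *m F + F *m T.
  by rewrite mulmxDr mulmxDl !mulmxA FE mul1mx -!mulmxA EF mulmx1.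
have -> : (- (G *m F + F *m T))^T = T *m F^T - F^T *m G^T.
  rewrite raddfN raddfD /= !trmx_mul TE mulNmx.
  by apply/matrixP => i j; rewrite !mxlinE; ring.
rewrite mulNmx mulmxDl mulmxDr mulmxN !mulmxA.
move: (G *m F *m F^T) (F *m F^T *m G^T) (F *m T *m F^T) => A B C.
by apply/matrixP => i j; rewrite !mxlinE; ring.
Qed.

(** The logarithmic derivative of the volume density is a trace of Christoffel symbols; the
    connection matrix contributes nothing, being skew. *)
Lemma is_derive_det_coframe k x : V x -> is_derive x (dir k) (fun y => \det (e y))
  (\det (e x) * \tr (gam e k x)).
Proof.
move=> Vx; apply: is_derive_eq (is_derive_det (is_derive_coframe H k Vx)) _.
have [_ eu _] := H; have eux := eu x Vx.
have -> : \adj (e x) = \det (e x) *: frame e x.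
  by rewrite frameE /invmx eux scalerA divrr ?scale1r// -unitmxE.
rewrite -scalemxAl mxtraceZ (de_conn H k Vx) mulmxDr linearD /= mulmxA.
rewrite (coframeK H Vx) mul1mx mulmxA mxtrace_mulC mulmxA (frameK H Vx) mul1mx.
rewrite [X in _ + X](_ : _ = 0) ?addr0//.
by rewrite /mxtrace big1// => i _; rewrite (skew_upper (conn_skew H k Vx)).
Qed.

(** Up to sign, the components of the star of [a p] are those of the dual vector field times the
    volume density, so d of it is a divergence, and the codifferential is minus the trace of nabla
    a_p. *)
Lemma codiffE p x : V x ->
  codiff e (a p) x = - \tr ((frame e x)^T *m nabla1 e (a p) x *m frame e x).
Proof.
move=> Vx; have [_ eu _] := H; have eux := eu x Vx.
have det0 : \det (e x) != 0 by rewrite -unitfE -unitmxE.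
pose u y := a p y *m cometric e y.
(* Only the index [m0] absent from [j], [k], [l] contributes to the sum. *)
have starE j k l y m0 s : (forall m, eps R m j k l = s *+ (m == m0)) ->
    star1 e (a p) y j k l = s * (u y 0 m0 * \det (e y)).
  move=> epsE; rewrite /star1 (bigD1 m0)//= vol_eps epsE eqxx big1 => [|m ne].
    by rewrite addr0 mulr1n [LHS]mulrA [LHS]mulrC.
  by rewrite vol_eps epsE (negPf ne) mulr0n !mulr0.
have uD m : is_derive x (dir m) (fun y => u y 0 m)
    ((row m (nabla1 e (a p) x) *m cometric e x - u x *m (gam e m x)^T) 0 m).
  have D := is_derive_mulmx (is_derive_tors H aP m p Vx) (is_derive_cometric m Vx).
  have /is_derive_mxP/(_ 0 m) D' := D; apply: is_derive_eq D' _.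
  have -> : dtform e m p x = row m (nabla1 e (a p) x) + a p x *m gam e m x.
    apply/rowP => l; rewrite mxDE [row _ _ _ _]mxE (nabla1E H aP)// dtformE.
    by rewrite subrK.
  congr (fun_of_matrix _ _ _); rewrite /u.
  move: (row m _) (a p x) (gam e m x) (cometric e x) => A B G C.
  rewrite mulmxDl mulmxN mulmxDr !mulmxA opprD addrA.
  by rewrite [X in X - _]addrK.
have uDD m : is_derive x (dir m) (fun y => u y 0 m * \det (e y))
    (\det (e x) * ((row m (nabla1 e (a p) x) *m cometric e x) 0 m
     - (u x *m (gam e m x)^T) 0 m + u x 0 m * \tr (gam e m x))).
  apply: is_derive_eq (is_deriveM (uD m) (is_derive_det_coframe m Vx)) _.
  by rewrite mxDE mxNE /GRing.scale/= mulrCA -mulrDr addrC.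
pose T m := (row m (nabla1 e (a p) x) *m cometric e x) 0 m
     - (u x *m (gam e m x)^T) 0 m + u x 0 m * \tr (gam e m x).
have pdE j k l m0 s : (forall m, eps R m j k l = s *+ (m == m0)) ->
    pd m0 (fun y => star1 e (a p) y j k l) x = s * (\det (e x) * T m0).
  move=> epsE; have -> : (fun y => star1 e (a p) y j k l) =
      s \*: (fun y => u y 0 m0 * \det (e y)).
    by apply/funext => y; rewrite (starE j k l y m0 s epsE).
  by have [_] := is_deriveZ s (uDD m0).
have signE (b : bool) : - b%:R = (-1) *+ b :> R by case: b; rewrite ?oppr0.
rewrite /codiff /star4 /ext3 (pdE 1 2 3 0 1 (@eps_123 R)) (pdE 0 1 3 2 1 (@eps_013 R)).
rewrite (pdE 0 2 3 1 (-1)) => [|m]; last by rewrite eps_023 signE.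
rewrite (pdE 0 1 2 3 (-1)) => [|m]; last by rewrite eps_012 signE.
rewrite vol_eps eps_123 eqxx mulr1.
have sumT (F : 'I_4 -> R) : \sum_m F m = F 0 + F 1 + F 2 + F 3.
  by rewrite sum4; do !congr (_ + _); congr (F _); apply: val_inj.
transitivity (- \sum_m T m).
  by rewrite sumT; move: (T 0) (T 1) (T 2) (T 3) => t0 t1 t2 t3; field.
congr (- _); rewrite !big_split/= sumrN.
(* The derivative of the volume density cancels the Christoffel term of the vector field, by
   symmetry of the lower indices. *)
have -> : \sum_m (u x *m (gam e m x)^T) 0 m = \sum_m u x 0 m * \tr (gam e m x).
  transitivity (\sum_m \sum_l u x 0 l * gam e l x m m).
    apply: eq_bigr => m _; rewrite mxE; apply: eq_bigr => l _.
    by rewrite mxTE (gamC e m x m l).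
  by rewrite exchange_big; apply: eq_bigr => m _; rewrite /= -mulr_sumr.
rewrite subrK mxtrace_mulC mulmxA -(cometricE H Vx) mxtrace_mulC.
by apply: eq_bigr => m _; rewrite -row_mul mxE.
Qed.

End Codifferential.

(** * Frame components of the invariants *)

Section FrameProjections.
Variable R : realType.
Implicit Types A B : 'M[R]_4.

Lemma tr_omega0 p : (omega0 R p)^T = - omega0 R p.
Proof.
apply/matrixP => i j; rewrite mxTE mxNE !omega0E.
move: p i j; elim/ord3_ind; elim/ord4_ind; elim/ord4_ind;
  by rewrite /somega /= ?mulr0n ?mulr1n ?oppr0 ?opprK.
Qed.

Lemma tr_eta0 p : (eta0 R p)^T = - eta0 R p.
Proof.
apply/matrixP => i j; rewrite mxTE mxNE !eta0E.
move: p i j; elim/ord3_ind; elim/ord4_ind; elim/ord4_ind;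
  by rewrite /seta /= ?mulr0n ?mulr1n ?oppr0 ?opprK.
Qed.

Lemma dot_tr A B : dot A B = \tr (A *m B^T).
Proof.
rewrite /mxtrace; apply: eq_bigr => a _; rewrite mxE.
by apply: eq_bigr => b _; rewrite mxTE.
Qed.

Lemma dotBl A B C : dot (A - B) C = dot A C - dot B C.
Proof. by rewrite !dot_tr mulmxBl raddfB. Qed.

Lemma dotZl c A B : dot (c *: A) B = c * dot A B.
Proof. by rewrite !dot_tr -scalemxAl mxtraceZ. Qed.

Lemma dot_sumZ n (f : 'I_n -> R) (M : 'I_n -> 'M[R]_4) B :
  dot (\sum_k f k *: M k) B = \sum_k f k * dot (M k) B.
Proof.
rewrite dot_tr mulmx_suml raddf_sum /=.
by apply: eq_bigr => k _; rewrite -scalemxAl mxtraceZ dot_tr.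
Qed.

Lemma asd_dot A k : asd A k = 2^-1 * dot A (eta0 R k).
Proof. by []. Qed.

Lemma sd_dot A k : sd A k = 2^-1 * dot A (omega0 R k).
Proof. by []. Qed.

Lemma eta0_mul_omega0 j k : eta0 R k *m omega0 R j = sig R j k.
Proof.
by rewrite -(tr_sig R j k) trmx_mul tr_omega0 tr_eta0 mulNmx mulmxN opprK.
Qed.

Lemma dot_sig_sig j k j' k' :
  dot (sig R j k) (sig R j' k') = 4 *+ ((j == j') && (k == k')).
Proof.
rewrite dot_sig sum4 !sigE; move: j k j' k'; elim/ord3_ind; elim/ord3_ind;
  elim/ord3_ind; elim/ord3_ind; rewrite /somega /seta /= ?mulr0n ?mulr1n; by ring.
Qed.

Lemma omega0_sqr j : omega0 R j *m omega0 R j = - 1%:M.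
Proof.
apply/matrixP => a b; rewrite mul_omega0 omega0E mxNE mxE.
move: j a b; elim/ord3_ind; elim/ord4_ind; elim/ord4_ind;
  rewrite /somega /= ?mulr0n ?mulr1n; by ring.
Qed.

Definition frame_Sigma20 (j : 'I_3) (B : 'M[R]_4) : Prop :=
  [/\ B^T = B, omega0 R j *m B *m omega0 R j = - B &
      forall i, i != j -> omega0 R i *m B *m omega0 R i = B].

Lemma frame_Sigma20_sig j k : frame_Sigma20 j (sig R j k).
Proof.
split; first exact: tr_sig.
  by rewrite omega0_sig_omega0 eqxx expr1 scaleN1r.
by move=> i ij; rewrite omega0_sig_omega0 (negPf ij) expr0 scale1r.
Qed.

Lemma frame_Sigma20_lin j n (f : 'I_n -> R) (M : 'I_n -> 'M[R]_4) :
  (forall k, frame_Sigma20 j (M k)) -> frame_Sigma20 j (\sum_k f k *: M k).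
Proof.
move=> HM; split.
- rewrite raddf_sum /=; apply: eq_bigr => k _; rewrite linearZ /=.
  by have [-> _ _] := HM k.
- rewrite mulmx_sumr mulmx_suml -sumrN; apply: eq_bigr => k _.
  by rewrite -scalemxAr -scalemxAl; have [_ -> _] := HM k; rewrite scalerN.
- move=> i ij; rewrite mulmx_sumr mulmx_suml; apply: eq_bigr => k _.
  by rewrite -scalemxAr -scalemxAl; have [_ _ ->] := HM k.
Qed.

(** The defining signs make [B] orthogonal to the identity and to every [sig p k] with [p != j], so
    only three terms of [sym_decomposition] survive. *)
Lemma frame_Sigma20_span j B : frame_Sigma20 j B ->
  B = 4^-1 *: \sum_k dot B (sig R j k) *: sig R j k.
Proof.
move=> [symB jB iB].
have [i ij] : exists i, i != j by exists (j + 1); move: j {jB iB}; elim/ord3_ind.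
(* Multiplying by [omega0 i] on both sides fixes [B], yet reverses its trace since [omega0 i]
   squares to -1. *)
have trB : \tr B = 0.
  have : \tr (omega0 R i *m B *m omega0 R i) = - \tr B.
    by rewrite mxtrace_mulC mulmxA omega0_sqr mulNmx mul1mx raddfN.
  by rewrite iB// => E; lra.
(* Multiplication by [omega0 p] on both sides is self-adjoint, fixes [B] and negates [sig p k]. *)
have dot0 p k : p != j -> dot B (sig R p k) = 0.
  move=> pj; have : dot (omega0 R p *m B *m omega0 R p) (sig R p k)
                  = dot B (omega0 R p *m sig R p k *m omega0 R p).
    rewrite !dot_tr -!mulmxA [LHS]mxtrace_mulC !trmx_mul tr_omega0 -!mulmxA.
    by rewrite !(mulmxN, mulNmx) opprK.
  rewrite iB// omega0_sig_omega0 eqxx expr1 scaleN1r.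
  by rewrite [in RHS]dot_tr linearN mulmxN raddfN /= -dot_tr => E; lra.
apply/matrixP => a b; have := sym_decomposition B a b; rewrite trB mul0rn add0r.
have -> : B b a = B a b by rewrite -[in LHS]symB mxTE.
rewrite (bigD1 j)//= [X in _ * (_ + X)]big1 => [|p pj]; last first.
  by rewrite big1// => k _; rewrite dot0// mul0r.
rewrite addr0 mxZE summxE => E.
have -> : \sum_k (dot B (sig R j k) *: sig R j k) a b
        = \sum_k dot B (sig R j k) * sig R j k a b.
  by apply: eq_bigr => k _; rewrite mxZE.
by move: E; set S := \sum_k _ => E; lra.
Qed.

End FrameProjections.

(** * Pointwise tensors in the orthonormal frame *)

Section FrameTensors.
Variables (R : realType) (e : 'rV[R]_4 -> 'M[R]_4) (V : set 'rV[R]_4).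
Hypothesis H : regular_coframe V e.
Variables (x : 'rV[R]_4) (Vx : V x).

Local Notation F := (frame e x).
Local Notation E := (e x).

Let EF : E *m F = 1%:M := frameK H Vx.
Let FE : F *m E = 1%:M := coframeK H Vx.
Let EFt : E^T *m F^T = 1%:M := coframe_trK H Vx.
Let FEt : F^T *m E^T = 1%:M := frame_trK H Vx.
Let gE := cometricE H Vx.

Definition fr (b : 'M[R]_4) : 'M[R]_4 := F^T *m b *m F.

Lemma frK b : E^T *m fr b *m E = b.
Proof. by rewrite /fr !mulmxA EFt mul1mx -mulmxA FE mulmx1. Qed.

Lemma fr_pull B : fr (E^T *m B *m E) = B.
Proof. by rewrite /fr !mulmxA FEt mul1mx -mulmxA EF mulmx1. Qed.

Lemma fr_tr b : fr b^T = (fr b)^T.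
Proof. by rewrite /fr !trmx_mul trmxK mulmxA. Qed.

Lemma frD b c : fr (b + c) = fr b + fr c.
Proof. by rewrite /fr mulmxDr mulmxDl. Qed.

Lemma frN b : fr (- b) = - fr b.
Proof. by rewrite /fr mulmxN mulNmx. Qed.

Lemma frZ k b : fr (k *: b) = k *: fr b.
Proof. by rewrite /fr -scalemxAr -scalemxAl. Qed.

Lemma fr_om p : fr (om e p x) = omega0 R p.
Proof. exact: fr_pull. Qed.

Lemma fr_eta p : fr (eta e p x) = eta0 R p.
Proof. exact: fr_pull. Qed.

Lemma fr_mul b c : fr (b *m cometric e x *m c) = fr b *m fr c.
Proof. by rewrite /fr gE !mulmxA. Qed.

Lemma inner2E b c : inner2 e x b c = dot (fr b) (fr c).
Proof.
by rewrite dot_tr -fr_tr -fr_mul /inner2 /fr [RHS]mxtrace_mulC !mulmxA -gE.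
Qed.

Lemma fr_acs_act i b : fr (acs_act e i x b) = - (omega0 R i *m fr b *m omega0 R i).
Proof.
have acsE : acs e i x = F *m (omega0 R i)^T *m E.
  rewrite /acs /om gE -!mulmxA (mulmxA (e x) F) EF mul1mx.
  by rewrite !trmx_mul !trmxK mulmxA.
rewrite /acs_act acsE !trmx_mul !trmxK tr_omega0 /fr !(mulmxN, mulNmx).
by rewrite !mulmxA FEt mul1mx -[_ *m E *m F]mulmxA EF mulmx1.
Qed.

Lemma Sigma20E j b : Sigma20 e j x b <-> frame_Sigma20 j (fr b).
Proof.
have inj A B : fr A = fr B -> A = B.
  by move=> AB; rewrite -[A]frK AB frK.
split=> [[Hs Hj Hi]|[Hs Hj Hi]]; split.
- by rewrite -fr_tr Hs.
- by rewrite -[in RHS]Hj fr_acs_act opprK.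
- by move=> i ij; apply: oppr_inj; rewrite -fr_acs_act Hi// frN.
- by apply: inj; rewrite fr_tr.
- by apply: inj; rewrite fr_acs_act Hj opprK.
- by move=> i ij; apply: inj; rewrite fr_acs_act Hi// frN.
Qed.

(** Exhibiting one orthogonal projection guarantees that [xget] returns such a projection and not
    its default. *)
Lemma S20P j b : Sigma20 e j x (S20 e j x b) /\
  forall s, Sigma20 e j x s -> inner2 e x (b - S20 e j x b) s = 0.
Proof.
rewrite /S20; apply: (@xgetPex _ 0 [set c | Sigma20 e j x c /\
  forall s, Sigma20 e j x s -> inner2 e x (b - c) s = 0]).
(* Orthogonal expansion in the [sig j k]; the factor [4^-1] is the inverse of their squared
   length. *)
exists (E^T *m (\sum_k (4^-1 * dot (fr b) (sig R j k)) *: sig R j k) *m E).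
split=> [|s].
  by apply/Sigma20E; rewrite fr_pull; apply: frame_Sigma20_lin => k; exact: frame_Sigma20_sig.
move=> /Sigma20E/frame_Sigma20_span; rewrite inner2E frD frN fr_pull => ->.
set P := \sum_k _ *: _.
have dotC (A B : 'M[R]_4) : dot A B = dot B A.
  by apply: eq_bigr => i _; apply: eq_bigr => l _; rewrite mulrC.
rewrite dotC dotZl dot_sumZ big1 ?mulr0// => k _.
rewrite [X in _ * X]dotC dotBl /P dot_sumZ (bigD1 k)//= dot_sig_sig !eqxx big1 => [|l lk].
  by rewrite /= addr0 mulr1n mulrAC mulVf ?mul1r ?subrr ?mulr0// pnatr_eq0.
by rewrite dot_sig_sig (negPf lk) andbF mulr0.
Qed.

(** [sig j k] lies in Sigma^2_{0,j}, so pairing with it does not notice the projection; diamond with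
    omega_j followed by pairing with eta_k is, up to the factor, that pairing. Hence the listed
    forms are coordinates of the symmetric traceless part of nabla a_i. *)
Lemma asd_diamond_S20 j k b :
  asd (fr (diamond e x (S20 e j x b) (om e j x))) k = - 2^-1 * dot (fr b) (sig R j k).
Proof.
have [/Sigma20E[symC _ _] Horth] := S20P j b.
set c := S20 e j x b in symC Horth *.
have -> : dot (fr b) (sig R j k) = dot (fr c) (sig R j k).
  have S : Sigma20 e j x (E^T *m sig R j k *m E).
    by apply/Sigma20E; rewrite fr_pull; exact: frame_Sigma20_sig.
  by have := Horth _ S; rewrite inner2E frD frN fr_pull dotBl => /eqP;
     rewrite subr_eq0 => /eqP.
rewrite /diamond frZ frD fr_mul fr_mul fr_tr symC fr_om asdZ asdD.
have E1 : \tr (fr c *m omega0 R j *m eta0 R k) = dot (fr c) (sig R j k).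
  by rewrite -mulmxA dot_tr tr_sig.
have E2 : \tr (omega0 R j *m fr c *m eta0 R k) = dot (fr c) (sig R j k).
  by rewrite -mulmxA mxtrace_mulC -mulmxA eta0_mul_omega0 dot_tr tr_sig.
rewrite !asd_dot ![dot _ (eta0 R k)]dot_tr tr_eta0 !mulmxN !raddfN /= E1 E2.
by field.
Qed.

End FrameTensors.

Section FrameComponents.
Variables (R : realType) (e : 'rV[R]_4 -> 'M[R]_4) (V : set 'rV[R]_4).
Hypothesis H : regular_coframe V e.
Variables (x : 'rV[R]_4) (Vx : V x).
Variable a : 'I_3 -> 'rV[R]_4 -> 'rV[R]_4.
Hypothesis aP : torsion_forms e V a.

Local Notation F := (frame e x).
Local Notation E := (e x).
Local Notation fr := (fr e x).
Local Notation dir k := (delta_mx 0 k : 'rV[R]_4).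

Definition tcomp (p : 'I_3) (A : 'I_4) : R := (a p x *m F) 0 A.
Definition ncomp (p : 'I_3) : 'M[R]_4 := fr (nabla1 e (a p) x).

Lemma tcompE p A : tcomp p A = \sum_i F i A * a p x 0 i.
Proof. by rewrite /tcomp mxE; apply: eq_bigr => i _; rewrite mulrC. Qed.

Lemma frE (M : 'M[R]_4) A B : fr M A B = \sum_k F k A * \sum_l F l B * M k l.
Proof.
rewrite /fr -mulmxA mxE; apply: eq_bigr => i _; rewrite mxTE; congr (_ * _).
by rewrite mxE; apply: eq_bigr => j _; rewrite mulrC.
Qed.

Lemma fr_sum n (M : 'I_n -> 'M[R]_4) : fr (\sum_p M p) = \sum_p fr (M p).
Proof. by rewrite /fr mulmx_sumr mulmx_suml. Qed.

Lemma comp3E t A B C : comp3 e x t A B C = \sum_i F i A * fr (t i) B C.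
Proof.
rewrite /comp3; apply: eq_bigr => i _; rewrite frE mulr_sumr; apply: eq_bigr => j _.
rewrite !mulr_sumr; apply: eq_bigr => k _; rewrite -frameE; ring.
Qed.

Lemma comp4E t A B C D : comp4 e x t A B C D =
  \sum_i F i A * \sum_j F j B * fr (\matrix_(k, l) t i j k l) C D.
Proof.
rewrite /comp4; apply: eq_bigr => i _; rewrite mulr_sumr; apply: eq_bigr => j _.
rewrite frE !mulr_sumr; apply: eq_bigr => k _.
rewrite !mulr_sumr; apply: eq_bigr => l _; rewrite mxE -frameE; ring.
Qed.

Lemma comp3_torsion A B C :
  comp3 e x (torsion e a x) A B C = \sum_p tcomp p A * omega0 R p B C.
Proof.
rewrite comp3E.
transitivity (\sum_i \sum_p F i A * (a p x 0 i * omega0 R p B C)).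
  apply: eq_bigr => i _; rewrite /torsion fr_sum summxE mulr_sumr.
  by apply: eq_bigr => p _; rewrite frZ (fr_om H Vx) mxZE.
rewrite exchange_big/=; apply: eq_bigr => p _; rewrite tcompE mulr_suml.
by apply: eq_bigr => i _; rewrite mulrA.
Qed.

Lemma is_derive_torsion k l : is_derive x (dir k) (fun y => torsion e a y l)
  (\sum_p (dtform e k p x 0 l *: om e p x
           + a p x 0 l *: ((de e k x)^T *m omega0 R p *m E + E^T *m omega0 R p *m de e k x))).
Proof.
apply/is_derive_mxP => i j.
have -> : (fun y => torsion e a y l i j)
    = \sum_p (fun y => a p y 0 l) * (fun y => om e p y i j).
  by apply/funext => y; rewrite /torsion summxE fct_sumE; apply: eq_bigr => p _; rewrite mxZE.
rewrite summxE; apply: is_derive_sum => p; rewrite mxDE !mxZE.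
have /is_derive_mxP/(_ 0 l) D1 := is_derive_tors H aP k p Vx.
have /is_derive_mxP/(_ i j) D2 := is_derive_om H p k Vx.
apply: is_derive_eq (is_deriveM D1 D2) _.
by rewrite addrC; congr (_ + _); exact: mulrC.
Qed.

Lemma nabla3_torsion k l : \matrix_(i, j) nabla3 e (torsion e a) x k l i j
  = \sum_p (nabla1 e (a p) x k l *: om e p x + a p x 0 l *: nabla2 e (om e p) x k).
Proof.
have Dt := is_derive_torsion k l.
transitivity (nabla2 e (fun y => torsion e a y l) x k
    - \sum_m christoffel e x m k l *: torsion e a x m).
  apply/matrixP => i j; rewrite [LHS]mxE mxDE mxNE summxE [X in _ = X - _]mxE.
  rewrite /nabla3.
  have -> : \sum_m (christoffel e x m k l *: torsion e a x m) i j
      = \sum_m christoffel e x m k l * torsion e a x m i j.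
    by apply: eq_bigr => m _; rewrite mxZE.
  have alg (p s1 s2 s3 : R) : p - s1 - s2 - s3 = p - s2 - s3 - s1 by ring.
  exact: alg.
rewrite (nabla2E H Vx Dt).
have -> : \sum_m christoffel e x m k l *: torsion e a x m
    = \sum_p (a p x *m gam e k x) 0 l *: om e p x.
  rewrite /torsion; under eq_bigr do rewrite scaler_sumr.
  rewrite exchange_big/=; apply: eq_bigr => p _.
  rewrite [in RHS]mxE scaler_suml; apply: eq_bigr => m _.
  by rewrite scalerA (christoffelE H)// mulrC.
rewrite /torsion mulmx_sumr mulmx_suml -!sumrB; apply: eq_bigr => p _.
rewrite (nabla2E H Vx (is_derive_om H p k Vx)) (nabla1E H aP)// -dtformE.
rewrite -scalemxAr -scalemxAl.
have alg (d c s : R) (O X P Q : 'M[R]_4) : d *: O + s *: X - s *: P - s *: Q - c *: O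
    = (d - c) *: O + s *: (X - P - Q).
  by apply/matrixP => i j; rewrite !mxlinE; ring.
exact: alg.
Qed.

(** The Leibniz rule for T: the derivatives of the omega_p are again expressed by torsion forms, and
    this makes the second group of terms quadratic. *)
Lemma comp4_nabla3_torsion k l m n : comp4 e x (nabla3 e (torsion e a) x) k l m n
  = \sum_p (ncomp p k l * omega0 R p m n + tcomp p l *
      (tcomp (p + 2) k * omega0 R (p + 1) m n - tcomp (p + 1) k * omega0 R (p + 2) m n)).
Proof.
rewrite comp4E.
transitivity (\sum_i F i k * \sum_j F j l * \sum_p (nabla1 e (a p) x i j * omega0 R p m n
   + a p x 0 j * (a (p + 2) x 0 i * omega0 R (p + 1) m n
                  - a (p + 1) x 0 i * omega0 R (p + 2) m n))).
  apply: eq_bigr => i _; congr (_ * _); apply: eq_bigr => j _; congr (_ * _).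
  rewrite nabla3_torsion fr_sum summxE; apply: eq_bigr => p _.
  rewrite frD !frZ (aP p i Vx) frD frN !frZ !(fr_om H Vx).
  by rewrite mxDE !mxZE mxDE mxNE !mxZE.
transitivity (\sum_p \sum_i F i k * \sum_j F j l * (nabla1 e (a p) x i j * omega0 R p m n
   + a p x 0 j * (a (p + 2) x 0 i * omega0 R (p + 1) m n
                  - a (p + 1) x 0 i * omega0 R (p + 2) m n))).
  rewrite exchange_big/=; apply: eq_bigr => i _; rewrite -mulr_sumr; congr (_ * _).
  by rewrite exchange_big/=; apply: eq_bigr => j _; rewrite -mulr_sumr.
apply: eq_bigr => p _; rewrite /ncomp frE !tcompE.
set u := omega0 R (p + 1) m n; set v := omega0 R (p + 2) m n; set w := omega0 R p m n.
transitivity (\sum_i F i k * ((\sum_j F j l * nabla1 e (a p) x i j) * w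
    + (\sum_j F j l * a p x 0 j) * (a (p + 2) x 0 i * u - a (p + 1) x 0 i * v))).
  apply: eq_bigr => i _; congr (_ * _); rewrite !mulr_suml -big_split/=.
  by apply: eq_bigr => j _; ring.
move: (\sum_j F j l * a p x 0 j) => al.
rewrite !mulr_suml -sumrB mulr_sumr -big_split/=; apply: eq_bigr => i _; ring.
Qed.

End FrameComponents.

(* Frame components of the Riemann tensor: rho e x A B is the skew matrix of
   R(f_A, f_B) in the frame f dual to e. *)
HB.lock Definition rho (R : realType) (e : 'rV[R]_4 -> 'M[R]_4) (x : 'rV[R]_4)
    (A B : 'I_4) : 'M[R]_4 :=
  \sum_i \sum_j (frame e x i A * frame e x j B) *: curv e i j x.

Arguments rho {R} e x.

(** * Riemann, Ricci and Weyl curvature in the frame *)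

Section FrameCurvature.
Variables (R : realType) (e : 'rV[R]_4 -> 'M[R]_4) (V : set 'rV[R]_4).
Hypothesis H : regular_coframe V e.
Variables (x : 'rV[R]_4) (Vx : V x).

Local Notation F := (frame e x).
Local Notation E := (e x).
Local Notation fr := (fr e x).
Local Notation rho := (rho e x).

Lemma rhoE A B C D :
  rho A B C D = \sum_i F i A * \sum_j F j B * curv e i j x C D.
Proof.
rewrite rho.unlock summxE; apply: eq_bigr => i _; rewrite summxE mulr_sumr.
by apply: eq_bigr => j _; rewrite mxZE mulrA.
Qed.

Lemma rho_anti A B C D : rho B A C D = - rho A B C D.
Proof.
rewrite !rhoE sum_lin -sumrN; apply: eq_bigr => i _; rewrite -mulrN; congr (_ * _).
rewrite -sumrN; apply: eq_bigr => j _; rewrite -mulrN; congr (_ * _).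
by rewrite (curv_anti e i j x) mxNE.
Qed.

Lemma rho_skew A B : (rho A B)^T = - rho A B.
Proof.
apply/matrixP => C D; rewrite mxTE mxNE !rhoE -sumrN; apply: eq_bigr => i _.
rewrite -mulrN; congr (_ * _); rewrite -sumrN; apply: eq_bigr => j _.
by rewrite -mulrN; congr (_ * _); exact: (skewE (curv_skew H i j Vx)).
Qed.

Lemma curv_curv31 i j : curv e i j x = - (E *m curv31 e i j x *m F).
Proof. by rewrite (curv31E H i j Vx) mulNmx opprK -mulmxA (frameK H Vx) mulmx1. Qed.

Lemma curv31_entry i j C D :
  curv e i j x C D = \sum_k F k C * (E *m curv31 e i j x) D k.
Proof.
rewrite (skewE (curv_skew H i j Vx)) curv_curv31 mxNE opprK mxE.
by apply: eq_bigr => k _; rewrite mulrC.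
Qed.

Lemma rho_bianchi A B C D : rho A B C D + rho B C A D + rho C A B D = 0.
Proof.
pose X i j k := (E *m curv31 e i j x) D k.
have rhoX A' B' C' : rho A' B' C' D
    = \sum_i F i A' * \sum_j F j B' * \sum_k F k C' * X i j k.
  rewrite rhoE; apply: eq_bigr => i _; congr (_ * _); apply: eq_bigr => j _.
  by rewrite curv31_entry.
have rot (f g h : 'I_4 -> R) (Y : 'I_4 -> 'I_4 -> 'I_4 -> R) :
    \sum_i f i * \sum_j g j * \sum_k h k * Y i j k
    = \sum_k h k * \sum_i f i * \sum_j g j * Y i j k.
  rewrite -[RHS]sum_lin; apply: eq_bigr => i _; congr (_ * _); exact: sum_lin.
rewrite !rhoX (rot (F ^~ B)) -(rot (F ^~ A) (F ^~ B) (F ^~ C) (fun j k i => X i j k)).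
rewrite -!big_split big1//= => i _; rewrite -!mulrDr -!big_split big1 ?mulr0//= => j _.
rewrite -!mulrDr -!big_split big1 ?mulr0//= => k _; rewrite -!mulrDr.
rewrite [X in _ * X](_ : _ = 0) ?mulr0// /X !mxE -!big_split big1//= => l _.
by rewrite -!mulrDr (bianchi31 H i j k l Vx) mulr0.
Qed.

Lemma fr_riem i j : fr (\matrix_(k, l) riem e x i j k l) = curv e i j x.
Proof.
have -> : \matrix_(k, l) riem e x i j k l = E^T *m curv e i j x *m E.
  transitivity ((curv31 e i j x)^T *m metric e x).
    apply/matrixP => k l; rewrite [LHS]mxE [RHS]mxE; apply: eq_bigr => m _.
    by rewrite (riem31E H m i j k Vx) mxTE.
  rewrite /metric mulmxA -trmx_mul (curv31E H i j Vx).
  by rewrite raddfN /= trmx_mul (curv_skew H i j Vx) mulmxN opprK.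
exact: (fr_pull H Vx).
Qed.

Lemma comp4_riem A B C D : comp4 e x (riem e x) A B C D = rho A B C D.
Proof.
rewrite comp4E rhoE; apply: eq_bigr => i _; congr (_ * _); apply: eq_bigr => j _.
by rewrite fr_riem.
Qed.

Lemma fr_ric B C : fr (ric e x) B C = \sum_A rho A B C A.
Proof.
rewrite frE.
have -> : \sum_A rho A B C A
    = \sum_j F j B * \sum_i (curv31 e i j x *m F) i C.
  transitivity (\sum_A \sum_j F j B * \sum_i F i A * (E *m curv31 e i j x *m F) A C).
    apply: eq_bigr => A _; rewrite rhoE sum_lin; apply: eq_bigr => j _; congr (_ * _).
    apply: eq_bigr => i _; rewrite (skewE (curv_skew H i j Vx)) curv_curv31.
    by rewrite mxNE opprK.
  rewrite exchange_big/=; apply: eq_bigr => j _; rewrite -mulr_sumr; congr (_ * _).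
  rewrite exchange_big/=; apply: eq_bigr => i _.
  transitivity ((F *m (E *m curv31 e i j x *m F)) i C); first by rewrite mxE.
  by rewrite !mulmxA (coframeK H Vx) mul1mx.
apply: eq_bigr => j _; congr (_ * _).
transitivity (\sum_k \sum_i F k C * curv31 e i j x i k).
  apply: eq_bigr => k _; rewrite [ric e x j k]mxE mulr_sumr; apply: eq_bigr => i _.
  by rewrite (riem31E H i i j k Vx).
rewrite exchange_big/=; apply: eq_bigr => i _; rewrite mxE.
by apply: eq_bigr => k _; rewrite mulrC.
Qed.

Lemma fr_metric : fr (metric e x) = 1%:M.
Proof. by rewrite -(fr_pull H Vx 1%:M) mulmx1. Qed.

Lemma scalE : scal e x = \tr (fr (ric e x)).
Proof. by rewrite /scal (cometricE H Vx) -mulmxA mxtrace_mulC. Qed.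

Lemma fr_schouten : fr (schouten e x)
  = 2^-1 *: (fr (ric e x) - (\tr (fr (ric e x)) / 6) *: 1%:M).
Proof. by rewrite /schouten frZ frD frN frZ fr_metric scalE. Qed.

Lemma dot_push (B Y : 'M[R]_4) : dot (F *m B *m F^T) Y = dot B (fr Y).
Proof. by rewrite !dot_tr /fr -!mulmxA mxtrace_mulC !trmx_mul trmxK !mulmxA. Qed.

Lemma dotC (A B : 'M[R]_4) : dot A B = dot B A.
Proof. by apply: eq_bigr => i _; apply: eq_bigr => l _; rewrite mulrC. Qed.

Lemma up_eta i : cometric e x *m eta e i x *m cometric e x = F *m eta0 R i *m F^T.
Proof. by rewrite -(fr_eta H Vx i) /fr (cometricE H Vx) !mulmxA. Qed.

Lemma fr_asd_curv j A B :
  fr (\matrix_(k, l) asd (curv e k l x) j) A B = asd (rho A B) j.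
Proof.
have asd_sum n (M : 'I_n -> 'M[R]_4) : asd (\sum_k M k) j = \sum_k asd (M k) j.
  elim/big_ind2: _ => [|A1 b1 A2 b2 <- <-|//]; last by rewrite asdD.
  by rewrite -(scale0r 0) asdZ mul0r.
rewrite frE rho.unlock asd_sum; apply: eq_bigr => k _; rewrite asd_sum mulr_sumr.
by apply: eq_bigr => l _; rewrite mxE asdZ mulrA.
Qed.

Lemma weyl_minusE i j : weyl_minus e x i j =
  asd (\matrix_(A, B) asd (rho A B) j) i
  - 2^-1 * (\tr (eta0 R i *m fr (schouten e x) *m eta0 R j)
            + \tr (eta0 R i *m eta0 R j *m (fr (schouten e x))^T)).
Proof.
rewrite [LHS]mxE /= !up_eta.
set U := F *m eta0 R i *m F^T; set W := F *m eta0 R j *m F^T.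
set g := metric e x; set P := schouten e x.
have gC k l : g k l = g l k by rewrite /g -[in LHS](tr_metric e x) mxTE.
have UC k l : U l k = - U k l.
  by rewrite -[in LHS](trmxK U) mxTE /U !trmx_mul trmxK tr_eta0 mulNmx mulmxN mxNE mulmxA.
pose S (f : 'I_4 -> 'I_4 -> 'I_4 -> 'I_4 -> R) := \sum_k \sum_l \sum_m \sum_n f k l m n.
have SD f h : S (fun k l m n => f k l m n + h k l m n) = S f + S h.
  rewrite /S -big_split; apply: eq_bigr => k _; rewrite -big_split.
  apply: eq_bigr => l _; rewrite -big_split; apply: eq_bigr => m _.
  by rewrite -big_split.
have SN f : S (fun k l m n => - f k l m n) = - S f.
  rewrite /S -sumrN; apply: eq_bigr => k _; rewrite -sumrN.
  apply: eq_bigr => l _; rewrite -sumrN; apply: eq_bigr => m _.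
  by rewrite -sumrN.
have Stwist f : S (fun k l m n => f l k m n) = S f by rewrite /S exchange_big.
have Str (A B C D : 'M[R]_4) :
    S (fun k l m n => A k l * B l m * C m n * D n k) = \tr (A *m B *m C *m D).
  rewrite /S; apply: eq_bigr => k _; rewrite -!mulmxA mxE; apply: eq_bigr => l _.
  rewrite mxE mulr_sumr; apply: eq_bigr => m _; rewrite mxE !mulr_sumr.
  by apply: eq_bigr => n _; rewrite !mulrA.
have Sriem : S (fun k l m n => riem e x k l m n * U k l * W m n)
    = 4 * asd (\matrix_(A, B) asd (rho A B) j) i.
  transitivity (dot U (\matrix_(k, l) (2 * asd (curv e k l x) j))).
    apply: eq_bigr => k _; apply: eq_bigr => l _.
    rewrite [X in _ = U k l * X]mxE asd_dot mulVKf ?pnatr_eq0//.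
    rewrite -(fr_riem k l) dotC -dot_push dotC -/W mulr_sumr.
    apply: eq_bigr => m _; rewrite mulr_sumr; apply: eq_bigr => n _.
    by rewrite [X in _ = _ * (X * _)]mxE mulrA [U k l * _]mulrC.
  rewrite /U dot_push asd_dot dotC.
  have -> : fr (\matrix_(k, l) (2 * asd (curv e k l x) j))
      = 2 *: \matrix_(A, B) asd (rho A B) j.
    apply/matrixP => A B; rewrite mxZE [in RHS]mxE -fr_asd_curv -mxZE -frZ.
    by congr (fr _ A B); apply/matrixP => k l; rewrite !mxE.
  by rewrite dotZl; field.
(* Skewness of [U] brings the four Schouten terms to the cyclic index pattern of a trace of four
   matrices; exchanging [k] and [l] then shows that they are equal in pairs. *)
transitivity (4^-1 * S (fun k l m n => riem e x k l m n * U k l * W m n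
    + - (U k l * P l m * W m n * g n k + U k l * g l m * W m n * P^T n k
       + (U l k * P k m * W m n * g n l + U l k * g k m * W m n * P^T n l)))).
  congr (_ * _); apply: eq_bigr => k _; apply: eq_bigr => l _.
  apply: eq_bigr => m _; apply: eq_bigr => n _.
  rewrite /weyl -/g -/P !mxTE (UC k l) (gC n k) (gC n l).
  by move: (riem e x k l m n) => r; ring.
rewrite SD SN !SD Sriem.
rewrite (Stwist (fun k l m n => U k l * P l m * W m n * g n k)).
rewrite (Stwist (fun k l m n => U k l * g l m * W m n * P^T n k)) !Str.
have -> : \tr (U *m P *m W *m g) = \tr (eta0 R i *m fr P *m eta0 R j).
  rewrite /U /W /g /metric /fr !mulmxA -[_ *m F^T *m E^T]mulmxA (frame_trK H Vx) mulmx1.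
  by rewrite mxtrace_mulC !mulmxA (frameK H Vx) mul1mx.
have -> : \tr (U *m g *m W *m P^T) = \tr (eta0 R i *m eta0 R j *m (fr P)^T).
  rewrite /U /W /g /metric /fr !mulmxA -[_ *m F^T *m E^T]mulmxA (frame_trK H Vx) mulmx1.
  rewrite -[_ *m E *m F]mulmxA (frameK H Vx) mulmx1 !trmx_mul trmxK.
  by rewrite -!mulmxA mxtrace_mulC !mulmxA.
by field.
Qed.

End FrameCurvature.

(** * Algebraic curvature tensors *)

Section AlgebraicCurvature.
Variables (R : realType) (r : 'I_4 -> 'I_4 -> 'M[R]_4).
Hypothesis r_anti : forall A B C D, r B A C D = - r A B C D.
Hypothesis r_skew : forall A B, (r A B)^T = - r A B.
Hypothesis r_bianchi : forall A B C D, r A B C D + r B C A D + r C A B D = 0.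

(** The octahedron argument: a linear combination of the Bianchi identities for the four cyclic
    rotations of the indices. *)
Lemma r_pair A B C D : r A B C D = r C D A B.
Proof.
have s2 a b c d : r a b c d = - r a b d c by exact: (skewE (r_skew a b)).
have b1 := r_bianchi A B C D; have b2 := r_bianchi B C D A.
have b3 := r_bianchi C D A B; have b4 := r_bianchi D A B C.
rewrite (s2 B C D A) (s2 C D B A) (s2 D B C A) (r_anti B D A C) in b2.
rewrite (s2 A C D B) (r_anti C A B D) in b3.
rewrite (s2 D A B C) (s2 A B D C) in b4.
by lra.
Qed.

(** The curvature as a bilinear form on 2-tensors: pair symmetry becomes symmetry, and its
    restrictions give the blocks between self-dual and anti-self-dual forms. *)
Definition blk (M N : 'M[R]_4) : R :=
  \sum_(p : 'I_4 * 'I_4) \sum_(q : 'I_4 * 'I_4) r p.1 p.2 q.1 q.2 * M p.1 p.2 * N q.1 q.2.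

Lemma blkC M N : blk M N = blk N M.
Proof.
rewrite /blk exchange_big; apply: eq_bigr => q _; apply: eq_bigr => p _ /=.
by rewrite r_pair; ring.
Qed.

Lemma dot_blk M N : dot (\matrix_(A, B) dot (r A B) N) M = blk M N.
Proof.
rewrite /dot pair_big /blk /=; apply: eq_bigr => p _.
rewrite mxE pair_big/= mulr_suml; apply: eq_bigr => q _; ring.
Qed.

Definition blk_sd q := \matrix_(A, B) sd (r A B) q.
Definition blk_asd k := \matrix_(A, B) asd (r A B) k.

Lemma sd_blk_sdC p q : sd (blk_sd p) q = sd (blk_sd q) p.
Proof.
have E a b : sd (blk_sd a) b = 4^-1 * blk (omega0 R b) (omega0 R a).
  rewrite -dot_blk sd_dot (_ : blk_sd a = 2^-1 *: \matrix_(A, B) dot (r A B) (omega0 R a)).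
    by rewrite dotZl; field.
  by apply/matrixP => A B; rewrite mxZE !mxE sd_dot.
by rewrite !E blkC.
Qed.

Lemma asd_blk_asdC i j : asd (blk_asd i) j = asd (blk_asd j) i.
Proof.
have E a b : asd (blk_asd a) b = 4^-1 * blk (eta0 R b) (eta0 R a).
  rewrite -dot_blk asd_dot (_ : blk_asd a = 2^-1 *: \matrix_(A, B) dot (r A B) (eta0 R a)).
    by rewrite dotZl; field.
  by apply/matrixP => A B; rewrite mxZE !mxE asd_dot.
by rewrite !E blkC.
Qed.

Lemma sd_blk_asd p k : sd (blk_asd k) p = asd (blk_sd p) k.
Proof.
have -> : blk_asd k = 2^-1 *: \matrix_(A, B) dot (r A B) (eta0 R k).
  by apply/matrixP => A B; rewrite mxZE !mxE asd_dot.
have -> : blk_sd p = 2^-1 *: \matrix_(A, B) dot (r A B) (omega0 R p).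
  by apply/matrixP => A B; rewrite mxZE !mxE sd_dot.
by rewrite sd_dot asd_dot !dotZl !dot_blk blkC.
Qed.

Definition ricci : 'M[R]_4 := \matrix_(B, C) \sum_A r A B C A.

Lemma ricci_sym : ricci^T = ricci.
Proof.
apply/matrixP => B C; rewrite mxTE !mxE; apply: eq_bigr => A _.
by rewrite r_pair (r_anti A B) (skewE (r_skew A B)) opprK.
Qed.

Let rAA A : r A A = 0.
Proof. by apply/matrixP => C D; rewrite mxE; have := r_anti A A C D; lra. Qed.

Let rN A B : r B A = - r A B.
Proof. by apply/matrixP => C D; rewrite r_anti mxNE. Qed.

(** The Bianchi identity forces the two diagonal blocks to have equal trace, so the scalar curvature
    in the anti-self-dual block can be read off from the self-dual one. The sign is due to the
    convention that [r A B B A] is a sectional curvature. *)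
Lemma blk_traces : (\sum_p sd (blk_sd p) p = - 2^-1 * \tr ricci) /\
  (\sum_k asd (blk_asd k) k = - 2^-1 * \tr ricci).
Proof.
have mx0E A B : (0 : 'M[R]_4) A B = 0 by rewrite mxE.
(* Antisymmetry reduces everything to components with increasing pairs of indices; in these the
   claims are linear consequences of Bianchi and pair symmetry. *)
have up := (rAA, rN (ord4 0) (ord4 1), rN (ord4 0) (ord4 2), rN (ord4 0) (ord4 3),
  rN (ord4 1) (ord4 2), rN (ord4 1) (ord4 3), rN (ord4 2) (ord4 3)).
have sk := (skew_upper (r_skew (ord4 0) (ord4 1)), skew_upper (r_skew (ord4 0) (ord4 2)),
  skew_upper (r_skew (ord4 0) (ord4 3)), skew_upper (r_skew (ord4 1) (ord4 2)),
  skew_upper (r_skew (ord4 1) (ord4 3)), skew_upper (r_skew (ord4 2) (ord4 3))).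
have b0 := r_bianchi (ord4 0) (ord4 1) (ord4 2) (ord4 3).
have p1 := r_pair (ord4 0) (ord4 1) (ord4 2) (ord4 3).
have p2 := r_pair (ord4 0) (ord4 2) (ord4 1) (ord4 3).
have p3 := r_pair (ord4 0) (ord4 3) (ord4 1) (ord4 2).
rewrite !up !mxNE ?sk in b0 p1 p2 p3.
split.
  rewrite !sum3 !sdE /mxtrace !sum4 !mxE !sdE !sum4 /somega /flip /=.
  rewrite !up !mx0E !mxNE ?sk.
  lra.
rewrite !sum3 !asdE /mxtrace !sum4 !mxE !asdE !sum4 /seta /flip /=.
rewrite !up !mx0E !mxNE ?sk.
lra.
Qed.

(** Clifford relation: the [eta0] anticommute and square to -1, so the two traces add up to the
    trace of [p] against a scalar matrix. *)
Lemma tr_eta0_schouten (p : 'M[R]_4) i j : p^T = p ->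
  \tr (eta0 R i *m p *m eta0 R j) + \tr (eta0 R i *m eta0 R j *m p^T)
  = - (2 * \tr p) *+ (i == j).
Proof.
move=> symp; rewrite symp.
have trE k l : \tr (p *m eta0 R k *m eta0 R l)
    = \sum_a seta R l a * seta R k (flip l a) * p a (flip k (flip l a)).
  by apply: eq_bigr => a _; rewrite !mulr_eta0 mulrN opprK mulrA.
rewrite -mulmxA [\tr (eta0 R i *m _)]mxtrace_mulC trE.
rewrite [\tr (eta0 R i *m eta0 R j *m p)]mxtrace_mulC mulmxA trE /mxtrace !sum4.
move: i j; elim/ord3_ind; elim/ord3_ind; rewrite /seta /flip /=;
  rewrite ?(sym_upper symp) ?mulr0n ?mulr1n; by ring.
Qed.

End AlgebraicCurvature.

Lemma sd_rho (R : realType) (e : 'rV[R]_4 -> 'M[R]_4) (V : set 'rV[R]_4)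
    (H : regular_coframe V e) x (Vx : V x) a (aP : torsion_forms e V a) p A B :
  sd (rho e x A B) p = ncomp e x a p A B - ncomp e x a p B A
    + (tcomp e x a (p + 1) A * tcomp e x a (p + 2) B
       - tcomp e x a (p + 2) A * tcomp e x a (p + 1) B).
Proof.
have sd_sum n (M : 'I_n -> 'M[R]_4) : sd (\sum_k M k) p = \sum_k sd (M k) p.
  elim/big_ind2: _ => [|A1 b1 A2 b2 <- <-|//]; last by rewrite sdD.
  by rewrite -(scale0r 0) sdZ mul0r.
transitivity (fr e x (\matrix_(k, l) sd (curv e k l x) p) A B).
  rewrite frE rho.unlock sd_sum; apply: eq_bigr => k _; rewrite sd_sum mulr_sumr.
  by apply: eq_bigr => l _; rewrite mxE sdZ mulrA.
have -> : \matrix_(k, l) sd (curv e k l x) p = nabla1 e (a p) x - (nabla1 e (a p) x)^T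
    + ((a (p + 1) x)^T *m a (p + 2) x - (a (p + 2) x)^T *m a (p + 1) x).
  apply/matrixP => k l; rewrite [LHS]mxE (sd_curv H aP p k l Vx) (ext1E H aP)//.
  rewrite !mxDE !mxNE mxTE [X in _ = _ + (X - _)]mxE [X in _ = _ + (_ - X)]mxE.
  by rewrite !big_ord1 !mxTE.
have prodE (u v : 'rV[R]_4) : fr e x (u^T *m v) A B
    = (u *m frame e x) 0 A * (v *m frame e x) 0 B.
  rewrite /fr mulmxA -trmx_mul -mulmxA mxE big_ord1 mxTE.
  by congr (_ * _).
by rewrite !frD !frN fr_tr !mxDE !mxNE mxTE !prodE.
Qed.

(** * The listed terms and the curvature at a point *)

Section Points.
Variable R : realType.
Implicit Types (s : SU2_point R) (F G : SU2_point R -> R).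

Lemma regular_cofr s : regular_coframe (nbd s) (cofr s).
Proof.
have [sm dt _] := cofr_adapted s.
split; [exact: nbd_open| |exact: sm].
by move=> x Vx; rewrite unitmxE unitfE gt_eqF// dt.
Qed.

Lemma nbd_loc s : nbd s (loc s).
Proof. exact: nbd_pt. Qed.

Definition nabla_at (p : 'I_3) s : 'M[R]_4 := ncomp (cofr s) (loc s) (tors s) p.
Definition tors_at (p : 'I_3) (A : 'I_4) s : R := tcomp (cofr s) (loc s) (tors s) p A.
Definition curvature s := rho (cofr s) (loc s).
Definition ext_at (p : 'I_3) s : 'M[R]_4 := nabla_at p s - (nabla_at p s)^T.

Lemma fr_ext1 p s : fr (cofr s) (loc s) (ext1 (tors s p) (loc s)) = ext_at p s.
Proof.
rewrite /ext_at /nabla_at /ncomp -fr_tr -frN -frD; congr fr; apply/matrixP => k l.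
by rewrite (ext1E (regular_cofr s) (@torsP _ s) p k l (nbd_loc s)) mxDE mxNE mxTE.
Qed.

Lemma term_codiffE p s : term_codiff p s = - \tr (nabla_at p s).
Proof. by rewrite /term_codiff (codiffE (regular_cofr s) (@torsP _ s) p (nbd_loc s)). Qed.

Lemma asd_compE s b k : asd_comp s b k = asd (fr (cofr s) (loc s) b) k.
Proof.
rewrite /asd_comp /innerL2 (inner2E (regular_cofr s) (nbd_loc s)).
by rewrite (fr_eta (regular_cofr s) (nbd_loc s)).
Qed.

Lemma term_dE p q s : term_d p q s = sd (ext_at p s) q.
Proof.
rewrite /term_d /innerL2 (inner2E (regular_cofr s) (nbd_loc s)).
by rewrite (fr_om (regular_cofr s) (nbd_loc s)) fr_ext1.
Qed.

Lemma term_dminusE p k s : term_dminus p k s = asd (ext_at p s) k.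
Proof.
rewrite /term_dminus asd_compE /pi2m frZ frD frN asdZ asdD asdN.
rewrite [asd (fr _ _ (star2 _ _ _)) k](asd_star2 (regular_cofr s) _ k (nbd_loc s)).
by rewrite -/(fr _ _ _) fr_ext1 opprK; field.
Qed.

Lemma term_nablaE p j k s : term_nabla p j k s = - 2^-1 * dot (nabla_at p s) (sig R j k).
Proof.
rewrite /term_nabla asd_compE.
by rewrite (asd_diamond_S20 (regular_cofr s) (nbd_loc s)).
Qed.

Lemma curvature_anti s A B C D : curvature s B A C D = - curvature s A B C D.
Proof. exact: rho_anti. Qed.

Lemma curvature_skew s A B : (curvature s A B)^T = - curvature s A B.
Proof. by rewrite /curvature (rho_skew (regular_cofr s) (nbd_loc s)). Qed.

Lemma curvature_bianchi s A B C D :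
  curvature s A B C D + curvature s B C A D + curvature s C A B D = 0.
Proof. by rewrite /curvature (rho_bianchi (regular_cofr s) (nbd_loc s)). Qed.

Lemma sd_curvature s p A B : sd (curvature s A B) p = ext_at p s A B
  + (tors_at (p + 1) A s * tors_at (p + 2) B s - tors_at (p + 2) A s * tors_at (p + 1) B s).
Proof.
by rewrite mxDE mxNE mxTE /curvature (sd_rho (regular_cofr s) (nbd_loc s) (@torsP _ s)).
Qed.

(** Of the Schouten tensor only the trace reaches the anti-self-dual block; in dimension four this
    trace is one sixth of the scalar curvature. *)
Lemma term_WE k l s : term_W k l s
  = asd (blk_asd (curvature s) l) k + (6^-1 * \tr (ricci (curvature s))) *+ (k == l).
Proof.
have H := regular_cofr s; have Vx := nbd_loc s.
rewrite /term_W (weyl_minusE H Vx).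
have ricE : fr (cofr s) (loc s) (ric (cofr s) (loc s)) = ricci (curvature s).
  by apply/matrixP => B C; rewrite (fr_ric H Vx) mxE.
have symp : (fr (cofr s) (loc s) (schouten (cofr s) (loc s)))^T
    = fr (cofr s) (loc s) (schouten (cofr s) (loc s)).
  rewrite (fr_schouten H Vx) ricE linearZ /= linearB /= linearZ /= trmx1.
  by rewrite (ricci_sym (@curvature_anti s) (@curvature_skew s) (@curvature_bianchi s)).
rewrite (tr_eta0_schouten _ _ symp) (fr_schouten H Vx) ricE.
rewrite mxtraceZ raddfB /= mxtraceZ mxtrace1 -/(curvature s).
rewrite -[LHS]/(asd (blk_asd (curvature s) l) k - _).
by congr (_ + _); case: (k == l); rewrite ?mulr0n ?mulr1n; field.
Qed.

Lemma T_compE s A B C : T_comp s (A, B, C) = \sum_p tors_at p A s * omega0 R p B C.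
Proof. by rewrite /T_comp (comp3_torsion (regular_cofr s) (nbd_loc s)). Qed.

Lemma nablaT_compE s k l m n : nablaT_comp k l m n s
  = \sum_p (nabla_at p s k l * omega0 R p m n + tors_at p l s *
      (tors_at (p + 2) k s * omega0 R (p + 1) m n
       - tors_at (p + 1) k s * omega0 R (p + 2) m n)).
Proof.
by rewrite /nablaT_comp (comp4_nabla3_torsion (regular_cofr s) (nbd_loc s) (@torsP _ s)).
Qed.

Lemma Rm_compE s A B C D : Rm_comp A B C D s = curvature s A B C D.
Proof. by rewrite /Rm_comp (comp4_riem (regular_cofr s) (nbd_loc s)). Qed.

End Points.

(** * Generation *)

Section Generation.
Variable R : realType.
Implicit Types (s : SU2_point R) (F G : SU2_point R -> R).

Definition expressible F : Prop :=
  exists (c1 : 'I_3 -> R) (c2 c3 : 'I_3 -> 'I_3 -> R)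
    (c4 : 'I_3 -> 'I_3 -> 'I_3 -> R) (c5 : 'M[R]_3),
    S20_minus c5 /\ eq_highest F (lincomb c1 c2 c3 c4 c5).

Lemma expressible_eq F G : F =1 G -> expressible F -> expressible G.
Proof.
move=> FG [c1 [c2 [c3 [c4 [c5 [S [q Fq]]]]]]].
by exists c1, c2, c3, c4, c5; split=> //; exists q => s; rewrite -FG.
Qed.

Lemma sum_affine n (P : pred 'I_n) (a : R) (c d t : 'I_n -> R) :
  \sum_(i < n | P i) (a * c i + d i) * t i
  = a * \sum_(i < n | P i) c i * t i + \sum_(i < n | P i) d i * t i.
Proof.
by rewrite mulr_sumr -big_split/=; apply: eq_bigr => i _; rewrite mulrDl mulrA.
Qed.

Lemma sum_affineD n (a : R) (f g h : 'I_n -> R) :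
  (forall i, f i = a * g i + h i) -> \sum_i f i = a * \sum_i g i + \sum_i h i.
Proof. by move=> E; rewrite mulr_sumr -big_split/=; apply: eq_bigr. Qed.

Lemma lincomb_affine a c1 c2 c3 c4 c5 d1 d2 d3 d4 d5 s :
  lincomb (fun i => a * c1 i + d1 i) (fun i j => a * c2 i j + d2 i j)
    (fun i j => a * c3 i j + d3 i j) (fun i j k => a * c4 i j k + d4 i j k)
    (a *: c5 + d5) s
  = a * lincomb c1 c2 c3 c4 c5 s + lincomb d1 d2 d3 d4 d5 s.
Proof.
rewrite /lincomb sum_affine.
rewrite (sum_affineD (fun i => sum_affine _ a (c2 i) (d2 i) (fun j => term_d i j s))).
rewrite (sum_affineD (fun i => sum_affine xpredT a (c3 i) (d3 i)
  (fun j => term_dminus i j s))).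
rewrite (sum_affineD (fun i => sum_affineD (fun j =>
  sum_affine xpredT a (c4 i j) (d4 i j) (fun k => term_nabla i j k s)))).
rewrite (@sum_affineD _ a (fun k => \sum_l (a *: c5 + d5) k l * term_W k l s)
  (fun k => \sum_l c5 k l * term_W k l s)
  (fun k => \sum_l d5 k l * term_W k l s)) => [|k]; last first.
  rewrite mulr_sumr -big_split/=; apply: eq_bigr => l _.
  by rewrite mxDE mxZE mulrDl mulrA.
have alg (x1 x2 x3 x4 x5 y1 y2 y3 y4 y5 : R) :
    a * x1 + y1 + (a * x2 + y2) + (a * x3 + y3) + (a * x4 + y4) + (a * x5 + y5)
    = a * (x1 + x2 + x3 + x4 + x5) + (y1 + y2 + y3 + y4 + y5) by ring.
exact: alg.
Qed.

Lemma expressible_affine a F G :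
  expressible F -> expressible G -> expressible (fun s => a * F s + G s).
Proof.
move=> [c1 [c2 [c3 [c4 [c5 [[Sc Tc] [q Fq]]]]]]].
move=> [d1 [d2 [d3 [d4 [d5 [[Sd Td] [r Gr]]]]]]].
exists (fun i => a * c1 i + d1 i), (fun i j => a * c2 i j + d2 i j),
  (fun i j => a * c3 i j + d3 i j), (fun i j k => a * c4 i j k + d4 i j k), (a *: c5 + d5).
split.
  split; first by rewrite linearD linearZ /= Sc Sd.
  by rewrite linearD linearZ /= Tc Td mulr0 addr0.
exists (fun I J => a * q I J + r I J) => s.
rewrite lincomb_affine Fq Gr mulrDr addrACA; congr (_ + _).
rewrite mulr_sumr -big_split/=; apply: eq_bigr => I _.
by rewrite mulr_sumr -big_split/=; apply: eq_bigr => J _; ring.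
Qed.

Lemma sum0_1 n (P : pred 'I_n) (t : 'I_n -> R) : \sum_(i | P i) 0 * t i = 0.
Proof. by rewrite big1// => i _; rewrite mul0r. Qed.

Lemma sum0_2 n (P : 'I_n -> pred 'I_n) (t : 'I_n -> 'I_n -> R) :
  \sum_i \sum_(j | P i j) 0 * t i j = 0.
Proof. by rewrite big1// => i _; rewrite sum0_1. Qed.

Lemma sum0_3 n (t : 'I_n -> 'I_n -> 'I_n -> R) :
  \sum_i \sum_j \sum_k 0 * t i j k = 0.
Proof. by rewrite big1// => i _; rewrite (sum0_2 (fun _ => xpredT)). Qed.

Lemma sum0_mx (t : 'I_3 -> 'I_3 -> R) : \sum_i \sum_j (0 : 'M[R]_3) i j * t i j = 0.
Proof. by rewrite big1// => i _; rewrite big1// => j _; rewrite mxE mul0r. Qed.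

Lemma sum_delta n (P : pred 'I_n) (k : 'I_n) (t : 'I_n -> R) : P k ->
  \sum_(i | P i) (i == k)%:R * t i = t k.
Proof.
move=> Pk; rewrite (bigD1 k)//= eqxx mul1r big1 ?addr0// => i /andP[_ /negPf->].
by rewrite mul0r.
Qed.

Lemma S20_minus0 : S20_minus (0 : 'M[R]_3).
Proof. by split; rewrite ?trmx0 ?raddf0. Qed.

Lemma expressible_lincomb c1 c2 c3 c4 c5 F : S20_minus c5 ->
  lincomb c1 c2 c3 c4 c5 =1 F -> expressible F.
Proof.
move=> S E; apply: expressible_eq E _; exists c1, c2, c3, c4, c5; split=> //.
exists (fun _ _ => 0) => s; rewrite big1 ?addr0// => I _.
by rewrite big1// => J _; rewrite !mul0r.
Qed.

Lemma expressible0 : expressible (fun=> 0).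
Proof.
apply: (@expressible_lincomb (fun=> 0) (fun _ _ => 0) (fun _ _ => 0)
  (fun _ _ _ => 0) 0 _ S20_minus0) => s.
rewrite /lincomb sum0_1 (sum0_2 (fun i (j : 'I_3) => (i <= j)%N)).
by rewrite (sum0_2 (fun _ => xpredT)) sum0_3 sum0_mx !addr0.
Qed.

(** Such an expression is zero to highest order: the combination is trivial and the expression is
    its own remainder. *)
Lemma expressible_quad (q : 'I_4 * 'I_4 * 'I_4 -> 'I_4 * 'I_4 * 'I_4 -> R) :
  expressible (fun s => \sum_I \sum_J q I J * T_comp s I * T_comp s J).
Proof.
exists (fun=> 0), (fun _ _ => 0), (fun _ _ => 0), (fun _ _ _ => 0), 0.
split; first exact: S20_minus0.
exists q => s; rewrite -[LHS]add0r; congr (_ + _).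
rewrite /lincomb sum0_1 (sum0_2 (fun i (j : 'I_3) => (i <= j)%N)).
by rewrite (sum0_2 (fun _ => xpredT)) sum0_3 sum0_mx !addr0.
Qed.

Lemma expressible_codiff i : expressible (term_codiff i).
Proof.
apply: (@expressible_lincomb (fun i' => (i' == i)%:R) (fun _ _ => 0) (fun _ _ => 0)
  (fun _ _ _ => 0) 0 _ S20_minus0) => s.
rewrite /lincomb sum_delta// (sum0_2 (fun i (j : 'I_3) => (i <= j)%N)).
by rewrite (sum0_2 (fun _ => xpredT)) sum0_3 sum0_mx !addr0.
Qed.

Lemma sum_delta2 n (P : 'I_n -> pred 'I_n) (k l : 'I_n) (t : 'I_n -> 'I_n -> R) :
  P k l -> \sum_i \sum_(j | P i j) ((i == k) && (j == l))%:R * t i j = t k l.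
Proof.
move=> Pkl; rewrite (bigD1 k)//= [X in _ + X]big1 ?addr0 => [|i /negPf ik]; last first.
  by rewrite big1// => j _; rewrite ik mul0r.
by rewrite -(sum_delta (t k) Pkl); apply: eq_bigr => j _; rewrite eqxx.
Qed.

Lemma expressible_d (i j : 'I_3) : (i <= j)%N -> expressible (term_d i j).
Proof.
move=> ij.
apply: (@expressible_lincomb (fun=> 0) (fun i' j' => ((i' == i) && (j' == j))%:R)
  (fun _ _ => 0) (fun _ _ _ => 0) 0 _ S20_minus0) => s.
rewrite /lincomb sum0_1 (sum_delta2 (P := fun i (j : 'I_3) => (i <= j)%N))//.
by rewrite (sum0_2 (fun _ => xpredT)) sum0_3 sum0_mx !addr0 add0r.
Qed.

Lemma expressible_dminus i k : expressible (term_dminus i k).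
Proof.
apply: (@expressible_lincomb (fun=> 0) (fun _ _ => 0)
  (fun i' k' => ((i' == i) && (k' == k))%:R) (fun _ _ _ => 0) 0 _ S20_minus0) => s.
rewrite /lincomb sum0_1 (sum0_2 (fun i (j : 'I_3) => (i <= j)%N)).
by rewrite (sum_delta2 (P := fun _ => xpredT))// sum0_3 sum0_mx !addr0 !add0r.
Qed.

Lemma expressible_nabla i j k : expressible (term_nabla i j k).
Proof.
apply: (@expressible_lincomb (fun=> 0) (fun _ _ => 0) (fun _ _ => 0)
  (fun i' j' k' => (i' == i)%:R * ((j' == j) && (k' == k))%:R) 0 _ S20_minus0) => s.
rewrite /lincomb sum0_1 (sum0_2 (fun i (j : 'I_3) => (i <= j)%N)).
rewrite (sum0_2 (fun _ => xpredT)) sum0_mx addr0 !add0r.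
rewrite -(sum_delta (P := xpredT) (k := i) (fun i => term_nabla i j k s))//.
apply: eq_bigr => i' _; rewrite -(sum_delta2 (P := fun _ => xpredT)
  (fun j k => term_nabla i' j k s))//.
rewrite mulr_sumr; apply: eq_bigr => j' _; rewrite mulr_sumr.
by apply: eq_bigr => k' _; rewrite mulrA.
Qed.

Lemma expressible_sum n (P : pred 'I_n) (f : 'I_n -> SU2_point R -> R) :
  (forall i, expressible (f i)) -> expressible (fun s => \sum_(i | P i) f i s).
Proof.
move=> Ef; rewrite -[P]/(fun i => P i).
suff : forall r : seq 'I_n, expressible (fun s => \sum_(i <- r | P i) f i s) by apply.
elim=> [|i r IH].
  by apply: expressible_eq expressible0 => s; rewrite big_nil.
case Pi : (P i).
  apply: expressible_eq (expressible_affine 1 (Ef i) IH) => s.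
  by rewrite big_cons Pi mul1r.
by apply: expressible_eq IH => s; rewrite big_cons Pi.
Qed.

Lemma expressible_scale a F : expressible F -> expressible (fun s => a * F s).
Proof.
move=> EF; apply: expressible_eq (expressible_affine a EF expressible0) => s.
by rewrite addr0.
Qed.

Lemma expressibleD F G :
  expressible F -> expressible G -> expressible (fun s => F s + G s).
Proof.
move=> EF EG; apply: expressible_eq (expressible_affine 1 EF EG) => s.
by rewrite mul1r.
Qed.

(** Among the three [omega0] only the [p]-th has a nonzero entry at row 0 and column [flip p 0], and
    this entry is 1. Products of torsion forms thereby become quadratic in the components of T. *)
Lemma tors_atE (p : 'I_3) (A : 'I_4) s :
  tors_at p A s = T_comp s (A, ord4 0, flip p (ord4 0)).
Proof.
rewrite T_compE sum3 !omega0E; move: p.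
by elim/ord3_ind; rewrite /somega /flip /= ?mulr0n ?mulr1n; ring.
Qed.

Lemma expressible_tors_at2 p A q B : expressible (fun s => tors_at p A s * tors_at q B s).
Proof.
pose I0 := (A, ord4 0, flip p (ord4 0)).
pose J0 := (B, ord4 0, flip q (ord4 0)).
apply: expressible_eq (expressible_quad (fun I J => (I == I0)%:R * (J == J0)%:R)) => s.
rewrite (bigD1 I0)//= [X in _ + X]big1 ?addr0 => [|I /negPf II0]; last first.
  by rewrite big1// => J _; rewrite II0 !mul0r.
rewrite (bigD1 J0)//= [X in _ + X]big1 ?addr0 => [|J /negPf JJ0]; last first.
  by rewrite JJ0 mulr0 !mul0r.
by rewrite !eqxx !mul1r !tors_atE.
Qed.

(* The quadratic part of the Lambda^2_+ component of the curvature *)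
Definition quad_at (p : 'I_3) s : 'M[R]_4 := \matrix_(A, B)
  (tors_at (p + 1) A s * tors_at (p + 2) B s - tors_at (p + 2) A s * tors_at (p + 1) B s).

Lemma blk_sd_curvature p s : blk_sd (curvature s) p = ext_at p s + quad_at p s.
Proof.
by apply/matrixP => A B; rewrite [LHS]mxE sd_curvature
  (mxDE (ext_at p s) (quad_at p s)) [quad_at p s A B]mxE.
Qed.

Lemma expressible_quad_at p A B : expressible (fun s => quad_at p s A B).
Proof.
apply: expressible_eq (expressible_affine (-1) (expressible_tors_at2 (p + 2) A (p + 1) B)
  (expressible_tors_at2 (p + 1) A (p + 2) B)) => s.
by rewrite mxE mulN1r addrC.
Qed.

Lemma expressible_linear (f : SU2_point R -> 'M[R]_4) (c : 'I_4 -> 'I_4 -> R) k :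
  (forall A B, expressible (fun s => f s A B)) ->
  expressible (fun s => k * \sum_A \sum_B f s A B * c A B).
Proof.
move=> Ef; apply: expressible_scale; apply: expressible_sum => A.
apply: expressible_sum => B.
by apply: expressible_eq (expressible_scale (c A B) (Ef A B)) => s; rewrite mulrC.
Qed.

(** Only the pairs [p <= q] are listed; the others are reached through the symmetry of the self-dual
    curvature block, at the cost of quadratic terms. *)
Lemma expressible_sd_ext_at p q : expressible (fun s => sd (ext_at p s) q).
Proof.
have [pq|/ltnW qp] := leqP p q.
  by apply: expressible_eq (expressible_d pq) => s; rewrite term_dE.
have E s : sd (ext_at p s) q = sd (ext_at q s) p
    + (-1 * sd (quad_at p s) q + sd (quad_at q s) p).
  have := sd_blk_sdC (@curvature_anti _ s) (@curvature_skew _ s)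
    (@curvature_bianchi _ s) p q.
  by rewrite !blk_sd_curvature !sdD => E; lra.
apply: (expressible_eq (fun s => esym (E s))); apply: expressibleD.
  by apply: expressible_eq (expressible_d qp) => s; rewrite term_dE.
by apply: expressible_affine; apply: expressible_linear => A B; exact: expressible_quad_at.
Qed.

Lemma expressible_asd_ext_at p k : expressible (fun s => asd (ext_at p s) k).
Proof. by apply: expressible_eq (expressible_dminus p k) => s; rewrite term_dminusE. Qed.

Lemma ext_at_skew p s : (ext_at p s)^T = - ext_at p s.
Proof. by rewrite /ext_at raddfB /= trmxK opprB. Qed.

Lemma expressible_ext_at p A B : expressible (fun s => ext_at p s A B).
Proof.
apply: (expressible_eq (fun s => esym (skew_decomposition A B (ext_at_skew p s)))).
apply: expressible_scale; apply: expressibleD; apply: expressible_sum => q.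
  apply: expressible_eq (expressible_scale (omega0 R q A B) (expressible_sd_ext_at p q)) => s.
  exact: mulrC.
apply: expressible_eq (expressible_scale (eta0 R q A B) (expressible_asd_ext_at p q)) => s.
exact: mulrC.
Qed.

Lemma expressible_nabla_at p A B : expressible (fun s => nabla_at p s A B).
Proof.
have E s : nabla_at p s A B
    = 2^-1 * (nabla_at p s A B + nabla_at p s B A) + 2^-1 * ext_at p s A B.
  by rewrite mxDE mxNE mxTE; field.
apply: (expressible_eq (fun s => esym (E s))); apply: expressibleD; apply: expressible_scale.
  apply: (expressible_eq (fun s => esym (sym_decomposition (nabla_at p s) A B))).
  apply: expressible_scale; apply: expressibleD.
    apply: expressible_eq (expressible_scale (- (A == B)%:R) (expressible_codiff p)) => s.
    by rewrite term_codiffE mulrNN mulr_natl.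
  apply: expressible_sum => q; apply: expressible_sum => k.
  apply: expressible_eq (expressible_scale (- 2 * sig R q k A B)
    (expressible_nabla p q k)) => s.
  by rewrite term_nablaE; field.
exact: expressible_ext_at.
Qed.

Lemma term_WC k l s : term_W k l s = term_W l k s.
Proof.
rewrite !term_WE (asd_blk_asdC (@curvature_anti _ s) (@curvature_skew _ s)
  (@curvature_bianchi _ s)).
by congr (_ + _); rewrite eq_sym.
Qed.

Lemma term_W_tr s : \sum_k term_W k k s = 0.
Proof.
have [_ E] := blk_traces (@curvature_anti _ s) (@curvature_skew _ s)
  (@curvature_bianchi _ s).
transitivity (\sum_k asd (blk_asd (curvature s) k) k
    + \sum_(k < 3) 6^-1 * \tr (ricci (curvature s))).
  by rewrite -big_split; apply: eq_bigr => k _; rewrite term_WE eqxx.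
by rewrite E sum3; field.
Qed.

Lemma expressible_W k l : expressible (term_W k l).
Proof.
(* The matrix unit at [k], [l], symmetrised and made traceless so that it satisfies [S20_minus]; its
   sum against W^- is unchanged because W^- is symmetric and traceless. *)
pose c : 'M[R]_3 := \matrix_(i, j) (2^-1 * (((i == k) && (j == l))%:R
  + ((i == l) && (j == k))%:R) - 3^-1 * (k == l)%:R * (i == j)%:R).
have S : S20_minus c.
  split; first by apply/matrixP => i j; rewrite mxTE !mxE [_ && (j == l)]andbC
    [_ && (j == k)]andbC [X in 2^-1 * X]addrC [j == i]eq_sym.
  rewrite /mxtrace sum3 !mxE; move: k l {c}; elim/ord3_ind; elim/ord3_ind;
    rewrite /= ?mulr0n ?mulr1n; by field.
apply: (@expressible_lincomb (fun=> 0) (fun _ _ => 0) (fun _ _ => 0)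
  (fun _ _ _ => 0) c _ S) => s.
rewrite /lincomb sum0_1 (sum0_2 (fun i (j : 'I_3) => (i <= j)%N)).
rewrite (sum0_2 (fun _ => xpredT)) sum0_3 !add0r.
transitivity (2^-1 * (\sum_i \sum_j ((i == k) && (j == l))%:R * term_W i j s
    + \sum_i \sum_j ((i == l) && (j == k))%:R * term_W i j s)
    - 3^-1 * (k == l)%:R * \sum_i term_W i i s).
  rewrite -big_split !mulr_sumr -sumrB; apply: eq_bigr => i _.
  rewrite -(sum_delta (P := xpredT) (k := i) (term_W i ^~ s))// -big_split !mulr_sumr -sumrB.
  by apply: eq_bigr => j _; rewrite mxE [i == j]eq_sym /=; ring.
rewrite !(sum_delta2 (P := fun _ => xpredT) (fun i j => term_W i j s))// term_W_tr.
by rewrite (term_WC l k); field.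
Qed.

Lemma expressible_blk_sd p A B : expressible (fun s => blk_sd (curvature s) p A B).
Proof.
apply: (expressible_eq (F := fun s => ext_at p s A B + quad_at p s A B)) => [s|].
  by rewrite blk_sd_curvature (mxDE (ext_at p s) (quad_at p s)).
by apply: expressibleD; [exact: expressible_ext_at|exact: expressible_quad_at].
Qed.

(** The trace is taken over the self-dual block, the one known from the d a_p. *)
Lemma expressible_scal : expressible (fun s => \tr (ricci (curvature s))).
Proof.
have E s : - 2 * \sum_p sd (blk_sd (curvature s) p) p = \tr (ricci (curvature s)).
  have [-> _] := blk_traces (@curvature_anti _ s) (@curvature_skew _ s)
    (@curvature_bianchi _ s).
  by field.
apply: (expressible_eq E); apply: expressible_scale; apply: expressible_sum => p.
by apply: expressible_linear => A B; exact: expressible_blk_sd.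
Qed.

(** The self-dual part of this block is the transpose of a mixed block already expressed; its
    anti-self-dual part is W^- plus a multiple of the scalar curvature. *)
Lemma expressible_blk_asd k A B : expressible (fun s => blk_asd (curvature s) k A B).
Proof.
have skew s : (blk_asd (curvature s) k)^T = - blk_asd (curvature s) k.
  apply/matrixP => C D; rewrite mxTE mxNE !mxE -asdN; congr asd.
  by apply/matrixP => C' D'; rewrite mxNE curvature_anti.
apply: (expressible_eq (fun s => esym (skew_decomposition A B (skew s)))).
apply: expressible_scale; apply: expressibleD; apply: expressible_sum => q.
  apply: (expressible_eq (F := fun s => omega0 R q A B * asd (blk_sd (curvature s) q) k)).
    move=> s; rewrite mulrC (sd_blk_asd (@curvature_anti _ s) (@curvature_skew _ s)
      (@curvature_bianchi _ s)) //.
  apply: expressible_scale; apply: expressible_linear => C D; exact: expressible_blk_sd.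
apply: (expressible_eq (F := fun s => eta0 R q A B * (term_W q k s
    + - 6^-1 *+ (q == k) * \tr (ricci (curvature s))))) => [s|].
  by rewrite term_WE mulrC; congr (_ * _); case: (q == k); rewrite ?mulr0n ?mulr1n; ring.
apply: expressible_scale; apply: expressibleD; first exact: expressible_W.
by apply: expressible_scale; exact: expressible_scal.
Qed.

Lemma expressible_curvature A B C D : expressible (fun s => curvature s A B C D).
Proof.
apply: (expressible_eq (fun s => esym (skew_decomposition C D (curvature_skew s A B)))).
apply: expressible_scale; apply: expressibleD; apply: expressible_sum => q.
  apply: expressible_eq (expressible_scale (omega0 R q C D) (expressible_blk_sd q A B)) => s.
  by rewrite mxE mulrC.
apply: expressible_eq (expressible_scale (eta0 R q C D) (expressible_blk_asd q A B)) => s.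
by rewrite mxE mulrC.
Qed.

Lemma expressible_second_order F : second_order_component F -> expressible F.
Proof.
move=> [k [l [m [n [->|->]]]]]; last first.
  apply: (expressible_eq (F := fun s => curvature s k l m n)) => [s|].
    by rewrite Rm_compE.
  exact: expressible_curvature.
apply: (expressible_eq (fun s => esym (nablaT_compE s k l m n))).
apply: expressible_sum => p; apply: expressibleD.
  apply: expressible_eq (expressible_scale (omega0 R p m n) (expressible_nabla_at p k l)) => s.
  exact: mulrC.
apply: (expressible_eq (F := fun s =>
  omega0 R (p + 1) m n * (tors_at p l s * tors_at (p + 2) k s)
  + - omega0 R (p + 2) m n * (tors_at p l s * tors_at (p + 1) k s))) => [s|]; first ring.
by apply: expressibleD; apply: expressible_scale; exact: expressible_tors_at2.
Qed.

End Generation.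

(** * Independence *)

Section EuclideanSpace.
Variable R : realType.

(** The basis consists of the balls with rational centre and rational radius. *)
Lemma rV_second_countable n : @second_countable 'rV[R]_n.
Proof.
pose B (qr : 'rV[rat]_n * rat) : set 'rV[R]_n :=
  ball (map_mx (@ratr R) qr.1 : 'rV[R]_n) (ratr qr.2).
exists (range B).
  exact: sub_countable (card_image_le _ _) (countableP _).
split=> [_ [qr _ <-]|x U /nbhs_ballP[/= eps eps0 xU]]; first exact: ball_open.
have [r /[!in_itv]/= /andP[r0 re]] := rat_in_itvoo (divr_gt0 eps0 (ltr0Sn R 1)).
have qP i : exists q : rat, `|x 0 i - ratr q| < ratr r.
  have [|q] := @rat_in_itvoo R (x 0 i - ratr r) (x 0 i + ratr r).
    by rewrite ltrD2l gt0_cp.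
  by rewrite in_itv/= => qx; exists q; rewrite ltr_distlC.
pose q : 'rV[rat]_n := \row_i sval (cid (qP i)).
have qB : ball (map_mx (@ratr R) q : 'rV[R]_n) (ratr r) x.
  split=> // i j; rewrite !mxE (ord1 i) /ball/= distrC.
  exact: svalP (cid (qP j)).
exists (B (q, r)); first by split; [exists (q, r)|].
move=> y By; apply: xU; rewrite (splitr eps).
apply: (@ball_triangle _ _ (map_mx (@ratr R) q : 'rV[R]_n)).
  by apply: ball_sym; apply: le_ball qB; exact: ltW.
by apply: le_ball By; exact: ltW.
Qed.

Lemma rV_connected n : connected [set: 'rV[R]_n].
Proof.
have -> : [set: 'rV[R]_n] = \bigcup_(v in setT) range (fun t : R => t *: v).
  by apply/seteqP; split=> // v _; exists v => //; exists 1; rewrite ?scale1r.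
apply: bigcup_connected => [|v _].
  by exists 0 => v _; exists 0; rewrite ?scale0r.
apply: connected_continuous_connected.
  by apply/connected_intervalP => x y _ _ z _.
by apply: continuous_subspaceT => t; exact: scalel_continuous.
Qed.

Implicit Types (f g : 'rV[R]_4 -> R).

Local Notation dir k := (delta_mx 0 k : 'rV[R]_4).

Lemma CkS k f : Ck k.+1 setT f -> Ck k setT f.
Proof.
elim: k f => [|k IH] f [cf /= Hf]; split=> //.
by move=> i; have [df Cf] := Hf i; split=> //; exact: IH.
Qed.

Lemma smooth_cst (c : R) : smooth_on setT (fun _ : 'rV[R]_4 => c).
Proof.
move=> k; elim: k c => [|k IH] c; split=> //.
- by move=> x _; exact: cst_continuous.
- by move=> x _; exact: cst_continuous.
move=> i; split=> [x _|]; first exact: derivable_cst.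
have -> : pd i (fun=> c) = (fun=> 0); last exact: IH.
by apply/funext => x; exact: derive_cst.
Qed.

Lemma is_derive_coord (i j : 'I_4) (x : 'rV[R]_4) :
  is_derive x (dir i) (fun y : 'rV[R]_4 => y 0 j) ((j == i)%:R).
Proof.
have -> : (j == i)%:R = (dir i) 0 j :> R by rewrite mxE eqxx.
by have /is_derive_mxP := is_derive_id x (dir i).
Qed.

Lemma smooth_coord (j : 'I_4) : smooth_on setT (fun x : 'rV[R]_4 => x 0 j).
Proof.
have cc : continuous (fun x : 'rV[R]_4 => x 0 j) by exact: coord_continuous.
case=> [|k]; split=> //.
- by move=> x _; exact: cc.
- by move=> x _; exact: cc.
move=> i; split=> [x _|]; first by have [H _] := is_derive_coord i j x; exact: H.
have -> : pd i (fun x : 'rV[R]_4 => x 0 j) = (fun=> (j == i)%:R).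
  by apply/funext => x; have [_] := is_derive_coord i j x.
exact: smooth_cst.
Qed.

Lemma CkD k f g : Ck k setT f -> Ck k setT g -> Ck k setT (fun x => f x + g x).
Proof.
elim: k f g => [|k IH] f g [cf Hf] [cg Hg]; split=> //.
- by move=> x _; apply: continuousD; [exact: cf|exact: cg].
- by move=> x _; apply: continuousD; [exact: cf|exact: cg].
move=> i; have [df Cf] := Hf i; have [dg Cg] := Hg i.
split=> [x _|]; first by apply: derivableD; [exact: df|exact: dg].
have -> : pd i (fun x => f x + g x) = (fun x => pd i f x + pd i g x); last exact: IH.
by apply/funext => x; apply: deriveD; [exact: df|exact: dg].
Qed.

Lemma CkM k f g : Ck k setT f -> Ck k setT g -> Ck k setT (fun x => f x * g x).
Proof.
elim: k f g => [|k IH] f g Cf Cg; have [cf Hf] := Cf; have [cg Hg] := Cg; split=> //.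
- by move=> x _; apply: continuousM; [exact: cf|exact: cg].
- by move=> x _; apply: continuousM; [exact: cf|exact: cg].
move=> i; have [df Cf'] := Hf i; have [dg Cg'] := Hg i.
split=> [x _|]; first by apply: derivableM; [exact: df|exact: dg].
have -> : pd i (fun x => f x * g x) = (fun x => f x * pd i g x + g x * pd i f x).
  by apply/funext => x; apply: deriveM; [exact: df|exact: dg].
by apply: CkD; apply: IH => //; exact: CkS.
Qed.

Lemma smoothD f g :
  smooth_on setT f -> smooth_on setT g -> smooth_on setT (fun x => f x + g x).
Proof. by move=> sf sg k; exact: CkD. Qed.

Lemma smoothM f g :
  smooth_on setT f -> smooth_on setT g -> smooth_on setT (fun x => f x * g x).
Proof. by move=> sf sg k; exact: CkM. Qed.

Lemma smooth_sum n (f : 'I_n -> 'rV[R]_4 -> R) :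
  (forall i, smooth_on setT (f i)) -> smooth_on setT (fun x => \sum_i f i x).
Proof.
elim: n f => [|n IH] f sf.
  have -> : (fun x => \sum_i f i x) = (fun=> 0); last exact: smooth_cst.
  by apply/funext => x; rewrite big_ord0.
have -> : (fun x => \sum_i f i x) = (fun x => f ord0 x + \sum_i f (lift ord0 i) x).
  by apply/funext => x; rewrite big_ord_recl.
by apply: smoothD => //; exact: IH.
Qed.

Lemma jacobian_id (x : 'rV[R]_4) : jacobian (id : 'rV[R]_4 -> 'rV[R]_4) x = 1%:M.
Proof.
apply/row_matrixP => i; rewrite !rowE -deriveEjacobian//=.
by rewrite mulmx1; exact: derive_id.
Qed.

Lemma image_idT : (id : 'rV[R]_4 -> 'rV[R]_4) @` setT = setT.
Proof. by apply/seteqP; split=> // x _; exists x. Qed.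

(** A single identity chart. The construction is transparent so that charts, coordinates and
    coframes of the test points reduce by computation. *)
Definition euclidean_atlas : oriented_atlas R 'rV[R]_4.
Proof.
refine (@OrientedAtlas R 'rV[R]_4 unit (fun=> setT) (fun=> id) (fun=> id) _ _ _ _ _ _ _ _).
- by move=> _; exact: openT.
- by move=> _; rewrite image_idT; exact: openT.
- by [].
- by move=> _ p _; exact: cvg_id.
- by move=> _ p _; exact: cvg_id.
- by move=> p; exists tt.
- by move=> _ _ i; rewrite setIT image_idT; exact: smooth_coord.
- by move=> _ _ x _; rewrite jacobian_id det1.
Defined.

Variable e : 'rV[R]_4 -> 'M[R]_4.
Hypothesis e_smooth : forall i k, smooth_on setT (fun x => e x i k).
Hypothesis e_det : forall x, 0 < \det (e x).

Lemma euclidean_regular : regular_coframe setT e.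
Proof. by split; [exact: openT|move=> x _; rewrite unitmxE unitfE gt_eqF|]. Qed.

Definition euclidean_SU2 : SU2_structure euclidean_atlas.
Proof.
refine (@SU2Structure R _ euclidean_atlas (fun _ i x => om e i x) _ _).
- by move=> b c i x _; rewrite /transition /= jacobian_id mul1mx trmx1 mulmx1.
- move=> c x _; exists setT, e; split=> //; first exact: openT.
  by move=> y _; exists y.
Defined.

Definition euclidean_point : SU2_point R.
Proof.
refine (@SU2Point R _ euclidean_atlas _ _ _ euclidean_SU2 0 tt setT e (tform e)
  _ _ _ _ _ _).
- exact: norm_hausdorff.
- exact: rV_second_countable.
- exact: rV_connected.
- by [].
- exact: openT.
- by [].
- by move=> y _; exists y.
- by split.
- by apply/(torsion_formsP euclidean_regular).
Defined.

End EuclideanSpace.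

(** * Two-jets of the test coframes at the origin *)

Section TestCoframes.
Variables (R : realType) (S K : 'M[R]_4).
Hypothesis symS : S^T = S.

Local Notation dir k := (delta_mx 0 k : 'rV[R]_4).

(** [S] is the Hessian. As [phi] vanishes to first order at 0, the connection vanishes there and
    only second derivatives of the coframe are seen. *)
Definition phi (x : 'rV[R]_4) : R := 2^-1 * \sum_k \sum_l S k l * (x 0 k * x 0 l).

Definition test_coframe (x : 'rV[R]_4) : 'M[R]_4 := 1%:M + phi x *: K.

Lemma test_coframe_smooth i k : smooth_on setT (fun x => test_coframe x i k).
Proof.
have -> : (fun x => test_coframe x i k) = (fun x => (i == k)%:R + phi x * K i k).
  by apply/funext => x; rewrite mxDE mxZE mxE.
apply: smoothD; first exact: smooth_cst.
apply: smoothM; last exact: smooth_cst.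
apply: smoothM; first exact: smooth_cst.
apply: smooth_sum => a; apply: smooth_sum => b; apply: smoothM; first exact: smooth_cst.
by apply: smoothM; exact: smooth_coord.
Qed.

Lemma is_derive_phi k x : is_derive x (dir k) phi (\sum_l S k l * x 0 l).
Proof.
have symSE a b : S a b = S b a by rewrite -[in LHS]symS mxTE.
have -> : phi = 2^-1 \*: \sum_a \sum_b S a b \*:
    ((fun y : 'rV[R]_4 => y 0 a) * (fun y : 'rV[R]_4 => y 0 b)).
  apply/funext => y; rewrite /phi /= fct_sumE; congr (_ * _); apply: eq_bigr => a _.
  by rewrite fct_sumE.
have D := is_deriveZ 2^-1 (is_derive_sum (fun a => is_derive_sum (fun b =>
  is_deriveZ (S a b) (is_deriveM (is_derive_coord k a x) (is_derive_coord k b x))))).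
apply: is_derive_eq D _; rewrite /GRing.scale/=.
transitivity (2^-1 * (\sum_a \sum_b S a b * (x 0 a * (b == k)%:R)
   + \sum_a \sum_b S a b * (x 0 b * (a == k)%:R))).
  congr (_ * _); rewrite -big_split; apply: eq_bigr => a _; rewrite -big_split.
  by apply: eq_bigr => b _ /=; ring.
have E1 : \sum_a \sum_b S a b * (x 0 a * (b == k)%:R) = \sum_a S k a * x 0 a.
  apply: eq_bigr => a _; rewrite (bigD1 k)//= eqxx mulr1 big1 ?addr0 => [|b /negPf->].
    by rewrite symSE.
  by rewrite !mulr0.
have E2 : \sum_a \sum_b S a b * (x 0 b * (a == k)%:R) = \sum_b S k b * x 0 b.
  rewrite exchange_big; apply: eq_bigr => b _ /=.
  by rewrite (bigD1 k)//= eqxx mulr1 big1 ?addr0// => a /negPf->; rewrite !mulr0.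
by rewrite E1 E2; field.
Qed.

Lemma de_test k x : de test_coframe k x = (\sum_l S k l * x 0 l) *: K.
Proof.
apply/matrixP => i j; rewrite deE mxZE.
have -> : (fun y => test_coframe y i j) = cst ((i == j)%:R) + K i j \*: phi.
  by apply/funext => y; rewrite mxDE mxZE mxE /= mulrC.
have [_ E] := is_deriveD (is_derive_cst ((i == j)%:R : R) x (dir k))
  (is_deriveZ (K i j) (is_derive_phi k x)).
by apply: etrans E _; rewrite add0r mulrC.
Qed.

Lemma dde_test l k x : dde test_coframe l k x = S k l *: K.
Proof.
apply/matrixP => i j; rewrite ddeE mxZE.
have -> : pd k (fun y => test_coframe y i j)
    = K i j \*: \sum_m S k m \*: (fun y : 'rV[R]_4 => y 0 m).
  apply/funext => y; rewrite -deE de_test mxZE mulrC /= fct_sumE; congr (_ * _).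
have [_ E] := is_deriveZ (K i j) (is_derive_sum (fun m => is_deriveZ (S k m)
  (is_derive_coord l m x))).
apply: etrans E _; rewrite /GRing.scale/= mulrC; congr (_ * _).
by rewrite (bigD1 l)//= eqxx mulr1 big1 ?addr0// => m /negPf->; rewrite mulr0.
Qed.

Hypothesis det_pos : forall x, 0 < \det (test_coframe x).

Let H : regular_coframe setT test_coframe :=
  euclidean_regular test_coframe_smooth det_pos.

Lemma test_coframe0 : test_coframe 0 = 1%:M.
Proof.
rewrite /test_coframe /phi big1 ?mulr0 ?scale0r ?addr0// => a _.
by rewrite big1// => b _; rewrite !mxE !mulr0.
Qed.

Lemma frame_test0 : frame test_coframe 0 = 1%:M.
Proof. by rewrite frameE test_coframe0 invmx1. Qed.

Lemma de_test0 k : de test_coframe k 0 = 0.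
Proof. by rewrite de_test big1 ?scale0r// => l _; rewrite mxE mulr0. Qed.

Lemma dg_test0 k : dg test_coframe k 0 = 0.
Proof. by rewrite dgE de_test0 trmx0 mul0mx mulmx0 addr0. Qed.

Lemma lowered_test0 k : lowered test_coframe k 0 = 0.
Proof.
apply/matrixP => i j; rewrite loweredE !dg_test0.
by rewrite !mxE !addr0 subrr mulr0.
Qed.

Lemma gam_test0 k : gam test_coframe k 0 = 0.
Proof. by rewrite gam.unlock lowered_test0 mulmx0. Qed.

Lemma conn_test0 k : conn test_coframe k 0 = 0.
Proof. by rewrite conn.unlock de_test0 gam_test0 mulmx0 subrr mul0mx. Qed.

Lemma is_derive_dg_test0 l k :
  is_derive 0 (dir l) (dg test_coframe k) (S k l *: (K^T + K)).
Proof.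
have -> : dg test_coframe k = (fun y => (de test_coframe k y)^T *m test_coframe y
    + (test_coframe y)^T *m de test_coframe k y).
  by apply/funext => y; rewrite dgE.
have H1 := is_derive_coframe H l (I : setT 0).
have H2 := is_derive_de H l k (I : setT 0).
apply: is_derive_eq (is_deriveD (is_derive_mulmx (is_derive_trmx H2) H1)
  (is_derive_mulmx (is_derive_trmx H1) H2)) _.
rewrite !de_test0 trmx0 test_coframe0 trmx1 dde_test mul0mx !mulmx1 mul1mx.
by rewrite addr0 add0r linearZ /= scalerDr.
Qed.

(** Linearised Christoffel symbols of the metric perturbation [phi] times [K^T + K]; derivatives of
    the inverse metric do not enter because [lowered] vanishes at 0. *)
Lemma dgam_test0 l k m i : dgam test_coframe l k 0 m i
  = 2^-1 * (S k l * (K^T + K) i m + S i l * (K^T + K) k m - S m l * (K^T + K) k i).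
Proof.
have D1 a b c : is_derive 0 (dir l) (fun y => dg test_coframe a y b c)
    (S a l * (K^T + K) b c).
  by have /is_derive_mxP/(_ b c) := is_derive_dg_test0 l a; rewrite mxZE.
have D2 : is_derive 0 (dir l) (lowered test_coframe k)
    (\matrix_(m, i) (2^-1 * (S k l * (K^T + K) i m + S i l * (K^T + K) k m
                             - S m l * (K^T + K) k i))).
  apply/is_derive_mxP => a b; rewrite mxE.
  have -> : (fun y => lowered test_coframe k y a b) = 2^-1 \*:
      ((fun y => dg test_coframe k y b a) + (fun y => dg test_coframe b y k a)
       - (fun y => dg test_coframe a y k b)).
    by apply/funext => y; rewrite loweredE.
  exact: is_deriveZ (is_deriveB (is_deriveD (D1 k b a) (D1 b k a)) (D1 a k b)).
have Hf := is_derive_frame H l (I : setT 0).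
have [_ E] := is_derive_mulmx (is_derive_mulmx Hf (is_derive_trmx Hf)) D2.
rewrite dgam.unlock.
have -> : gam test_coframe k = (fun y => frame test_coframe y *m (frame test_coframe y)^T
    *m lowered test_coframe k y) by apply/funext => y; rewrite gam.unlock.
rewrite E lowered_test0 mulmx0 add0r frame_test0 trmx1 !mul1mx mxE.
by [].
Qed.

Lemma dconn_test0 l k :
  dconn test_coframe l k 0 = S k l *: K - dgam test_coframe l k 0.
Proof.
have T0 : setT (0 : 'rV[R]_4) by [].
have [_ E] := is_derive_mulmx (is_deriveB (is_derive_de H l k T0)
  (is_derive_mulmx (is_derive_coframe H l T0) (is_derive_gam H l k T0)))
  (is_derive_frame H l T0).
rewrite dconn.unlock.
have -> : conn test_coframe k = (fun y => (de test_coframe k y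
    - test_coframe y *m gam test_coframe k y) *m frame test_coframe y).
  by apply/funext => y; rewrite conn.unlock.
apply: etrans E _.
rewrite de_test0 gam_test0 dde_test frame_test0 test_coframe0.
by rewrite !(mul0mx, mulmx0, mulmx1, mul1mx, add0r, oppr0, addr0).
Qed.

Definition test_point : SU2_point R := euclidean_point test_coframe_smooth det_pos.

Lemma tors_at_test p A : tors_at p A test_point = 0.
Proof.
rewrite /tors_at /tcomp /loc /=.
have -> : tform test_coframe p 0 = 0.
  apply/rowP => k; rewrite tformE conn_test0 mxE.
  by rewrite -(scale0r 0) sdZ mul0r.
by rewrite mul0mx mxE.
Qed.

Lemma nabla_at_test p k l : nabla_at p test_point k l = sd (dconn test_coframe k l 0) p.
Proof.
rewrite /nabla_at /ncomp /loc /= /fr frame_test0 trmx1 mul1mx mulmx1.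
have aP : torsion_forms test_coframe setT (tform test_coframe).
  exact: (torsP (s := test_point)).
by rewrite (nabla1E H aP p k l (I : setT 0)) gam_test0 mulmx0 mxE subr0.
Qed.

Lemma curvature_test A B : curvature test_point A B
  = dconn test_coframe A B 0 - dconn test_coframe B A 0.
Proof.
rewrite /curvature /loc /=; apply/matrixP => C D; rewrite rhoE frame_test0.
rewrite (bigD1 A)//= [X in _ + X]big1 ?addr0 => [|i /negPf iA];
  last by rewrite mxE iA mul0r.
rewrite (bigD1 B)//= [X in _ * (_ + X)]big1 ?addr0 => [|j /negPf jB];
  last by rewrite mxE jB mul0r.
by rewrite ![1%:M _ _]mxE !eqxx !mul1r curvE !conn_test0 mulmx0 subrr subr0.
Qed.

End TestCoframes.

(** * Vanishing of the coefficients of a relation *)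

Section Independence.
Variables (R : realType) (c1 : 'I_3 -> R) (c2 c3 : 'I_3 -> 'I_3 -> R)
  (c4 : 'I_3 -> 'I_3 -> 'I_3 -> R) (c5 : 'M[R]_3).
Hypothesis c5_S20 : S20_minus c5.
Hypothesis relation : eq_highest (lincomb c1 c2 c3 c4 c5) (fun=> 0).

(** The quadratic remainder allowed by [eq_highest] is zero at a test point, where T vanishes. *)
Lemma relation_test S K (symS : S^T = S)
    (det_pos : forall x, 0 < \det (test_coframe S K x)) :
  lincomb c1 c2 c3 c4 c5 (test_point det_pos) = 0.
Proof.
have [q ->] := relation; rewrite add0r big1// => -[[A B] C] _; rewrite big1// => J _.
by rewrite T_compE [\sum_p _]big1 ?mulr0 ?mul0r// => p _; rewrite (tors_at_test symS) mul0r.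
Qed.

(** Positive for every real [t], so the gauge test gives a coframe on all of R^4 whatever the sign
    of [phi]. *)
Lemma det_add_omega0 (t : R) q : \det (1%:M + t *: omega0 R q) = (1 + t ^+ 2) ^+ 2.
Proof.
rewrite det4E /det4 /= !mxDE !mxZE !omega0E ![1%:M _ _]mxE.
by move: q; elim/ord3_ind; rewrite /somega /flip /= ?mulr0n ?mulr1n; ring.
Qed.

(** Positive for [t >= 0]; for this test [phi] is half a square. *)
Lemma det_add_sqr (t : R) (v : 'I_4 -> R) :
  \det (1%:M + t *: \matrix_(i, j) (v i * v j)) = 1 + t * \sum_i v i ^+ 2.
Proof.
rewrite det4E /det4 /= !mxDE !mxZE ![1%:M _ _]mxE ![(\matrix_(_, _) _) _ _]mxE.
by rewrite sum4 /= ?mulr0n ?mulr1n; ring.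
Qed.

Lemma sd0 p : sd (0 : 'M[R]_4) p = 0.
Proof. by rewrite -(scale0r 0) sdZ mul0r. Qed.

Lemma asd0 p : asd (0 : 'M[R]_4) p = 0.
Proof. by rewrite -(scale0r 0) asdZ mul0r. Qed.

Lemma dot0l (B : 'M[R]_4) : dot 0 B = 0.
Proof. by rewrite -(scale0r 0) dotZl mul0r. Qed.

(* Rotating the flat coframe by a self-dual gauge transformation with Hessian S
   keeps the metric flat to second order. *)
Lemma gauge_relation (S : 'M[R]_4) q : S^T = S ->
  2 * c1 q * \tr S + \sum_j \sum_k c4 q j k * dot S (sig R j k) = 0.
Proof.
move=> symS.
have det_pos x : 0 < \det (test_coframe S (omega0 R q) x).
  by rewrite det_add_omega0 exprn_gt0// ltr_wpDr// sqr_ge0.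
have symSE a b : S a b = S b a by rewrite -[in LHS]symS mxTE.
(* [omega0 q] is skew, so the linearised Christoffel symbols vanish. *)
have dc l k : dconn (test_coframe S (omega0 R q)) l k 0 = S k l *: omega0 R q.
  rewrite (dconn_test0 symS det_pos) [X in _ - X](_ : _ = 0) ?subr0//.
  apply/matrixP => m i; rewrite (dgam_test0 symS det_pos) tr_omega0 addNr !mxE.
  by rewrite !mulr0 addr0 subrr mulr0.
have NE p : nabla_at p (test_point det_pos) = (2 *+ (q == p)) *: S.
  by apply/matrixP => k l; rewrite (nabla_at_test symS) dc sdZ sd_omega0 mxZE symSE mulrC.
have dN0 p : ext_at p (test_point det_pos) = 0.
  by rewrite /ext_at NE linearZ /= symS subrr.
have R0 A B : curvature (test_point det_pos) A B = 0.
  by rewrite (curvature_test symS) !dc symSE subrr.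
have W0 k l : term_W k l (test_point det_pos) = 0.
  rewrite term_WE.
  have -> : blk_asd (curvature (test_point det_pos)) l = 0.
    by apply/matrixP => A B; rewrite [LHS]mxE R0 asd0 mxE.
  have -> : ricci (curvature (test_point det_pos)) = 0.
    by apply/matrixP => A B; rewrite [LHS]mxE big1 ?mxE// => C _; rewrite R0 mxE.
  by rewrite asd0 mxtrace0 mulr0 mul0rn addr0.
have := relation_test symS det_pos; rewrite /lincomb.
have -> : \sum_(i < 3) \sum_(j < 3 | (i <= j)%N) c2 i j * term_d i j (test_point det_pos) = 0.
  by rewrite big1// => i _; rewrite big1// => j _; rewrite term_dE dN0 sd0 mulr0.
have -> : \sum_(i < 3) \sum_(k < 3) c3 i k * term_dminus i k (test_point det_pos) = 0.
  by rewrite big1// => i _; rewrite big1// => j _; rewrite term_dminusE dN0 asd0 mulr0.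
have -> : \sum_(k < 3) \sum_(l < 3) c5 k l * term_W k l (test_point det_pos) = 0.
  by rewrite big1// => i _; rewrite big1// => j _; rewrite W0 mulr0.
rewrite (bigD1 q)//= term_codiffE NE eqxx mxtraceZ big1 => [|i iq]; last first.
  by rewrite term_codiffE NE eq_sym (negPf iq) scale0r mxtrace0 oppr0 mulr0.
rewrite [X in _ + X + 0](_ : _ = - \sum_j \sum_k c4 q j k * dot S (sig R j k)).
  by move=> E; apply: oppr_inj; rewrite oppr0 -[RHS]E mulr1n; ring.
rewrite (bigD1 q)//= [X in _ + X]big1 ?addr0 => [|i iq]; last first.
  rewrite big1// => j _; rewrite big1// => k _.
  by rewrite term_nablaE NE eq_sym (negPf iq) scale0r dot0l !mulr0.
rewrite -sumrN; apply: eq_bigr => j _; rewrite -sumrN; apply: eq_bigr => k _.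
by rewrite term_nablaE NE eqxx mulr1n dotZl; field.
Qed.

(** The Hessian [1%:M] has trace 4 and is orthogonal to every [sig]. *)
Lemma c1_eq0 q : c1 q = 0.
Proof.
have := @gauge_relation 1%:M q (trmx1 _ _); rewrite mxtrace1.
rewrite [X in _ + X]big1 => [|j _].
  by rewrite addr0 => E; lra.
rewrite big1// => k _; rewrite dot_sig sum4 ![1%:M _ _]mxE.
move: j k; elim/ord3_ind; elim/ord3_ind; rewrite /somega /seta /flip /= ?mulr0n ?mulr1n;
  by ring.
Qed.

Lemma c4_eq0 q j k : c4 q j k = 0.
Proof.
have := @gauge_relation (sig R j k) q (tr_sig R j k); rewrite c1_eq0 mulr0 mul0r add0r.
rewrite (bigD1 j)//= [X in _ + X]big1 ?addr0 => [|i ij]; last first.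
  by rewrite big1// => l _; rewrite dot_sig_sig eq_sym (negPf ij) mulr0.
rewrite (bigD1 k)//= [X in _ + X]big1 ?addr0 => [|l lk]; last first.
  by rewrite dot_sig_sig [k == l]eq_sym (negPf lk) andbF mulr0.
by rewrite dot_sig_sig !eqxx /= mulr1n => E; lra.
Qed.

(* The curvature at the origin is b (x) b, where b = w /\ v. *)
Lemma decomposable_relation (w v : 'I_4 -> R) :
  let b := \matrix_(i, j) (w i * v j - w j * v i) in
  \sum_(i < 3) \sum_(j < 3 | (i <= j)%N) c2 i j * (sd b i * sd b j)
  + \sum_i \sum_k c3 i k * (sd b i * asd b k)
  + \sum_k \sum_l c5 k l * (asd b k * asd b l) = 0.
Proof.
move=> b.
pose S : 'M[R]_4 := \matrix_(i, j) (w i * w j).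
pose K : 'M[R]_4 := \matrix_(i, j) (v i * v j).
have symS : S^T = S by apply/matrixP => i j; rewrite !mxE mulrC.
have phi_ge0 x : 0 <= phi S x.
  have -> : phi S x = 2^-1 * (\sum_k w k * x 0 k) ^+ 2.
    rewrite /phi expr2 mulr_suml; congr (_ * _); apply: eq_bigr => k _.
    by rewrite mulr_sumr; apply: eq_bigr => l _; rewrite mxE; ring.
  by rewrite mulr_ge0 ?invr_ge0 ?ler0n ?sqr_ge0.
have det_pos x : 0 < \det (test_coframe S K x).
  by rewrite det_add_sqr ltr_wpDr// mulr_ge0// sumr_ge0// => i _; rewrite sqr_ge0.
have dc l k : dconn (test_coframe S K) l k 0 = (w l * v k) *: b.
  rewrite (dconn_test0 symS det_pos); apply/matrixP => m i.
  rewrite mxDE mxNE (dgam_test0 symS det_pos).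
  by rewrite !mxE; field.
have RE A B : curvature (test_point det_pos) A B = b A B *: b.
  by rewrite (curvature_test symS) !dc -scalerBl [b A B]mxE [w B * v A]mulrC [v A * _]mulrC.
set s := test_point det_pos in RE *.
have dNE p : ext_at p s = sd b p *: b.
  apply/matrixP => A B; have := sd_curvature s p A B.
  by rewrite RE sdZ !(tors_at_test symS) !mul0r subrr addr0 mxZE mulrC => <-.
have WE k l : term_W k l s = asd b k * asd b l
    + (6^-1 * \tr (ricci (curvature s))) *+ (k == l).
  rewrite term_WE; congr (_ + _).
  have -> : blk_asd (curvature s) l = asd b l *: b.
    by apply/matrixP => A B; rewrite [LHS]mxE RE asdZ mxZE mulrC.
  by rewrite asdZ mulrC.
have := relation_test symS det_pos; rewrite -/s /lincomb.
have -> : \sum_(i < 3) c1 i * term_codiff i s = 0.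
  by rewrite big1// => i _; rewrite c1_eq0 mul0r.
have -> : \sum_(i < 3) \sum_(j < 3) \sum_(k < 3) c4 i j k * term_nabla i j k s = 0.
  rewrite big1// => i _; rewrite big1// => j _; rewrite big1// => k _.
  by rewrite c4_eq0 mul0r.
rewrite add0r addr0 => E0; rewrite -[RHS]E0; congr (_ + _ + _).
- by apply: eq_bigr => i _; apply: eq_bigr => j _; rewrite term_dE dNE sdZ.
- by apply: eq_bigr => i _; apply: eq_bigr => j _; rewrite term_dminusE dNE asdZ.
have [_ tr5] := c5_S20.
(* The scalar curvature of the test metric is multiplied by the trace of [c5], hence drops out. *)
transitivity (\sum_k \sum_l c5 k l * (asd b k * asd b l)
    + \tr c5 * (6^-1 * \tr (ricci (curvature s)))); first by rewrite tr5 mul0r addr0.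
rewrite mulr_suml -big_split; apply: eq_bigr => k _ /=.
rewrite [in RHS](bigD1 k)//= WE eqxx [in LHS](bigD1 k)//= mulr1n mulrDr addrAC.
by congr (_ + _); apply: eq_bigr => l lk; rewrite WE eq_sym (negPf lk) addr0.
Qed.

Lemma c2_c3_c5_eq0 :
  [/\ forall i j : 'I_3, (i <= j)%N -> c2 i j = 0, forall i k, c3 i k = 0 & c5 = 0].
Proof.
have [sym5 tr5] := c5_S20.
have s5 i j : c5 i j = c5 j i by rewrite -[in LHS]sym5 mxTE.
(* The relation in the self-dual coordinates [p] and anti-self-dual coordinates [q] of w /\ v, which
   satisfy p0^2 + p1^2 + p2^2 = q0^2 + q1^2 + q2^2. *)
have E (w0 w1 w2 w3 v0 v1 v2 v3 : R) :
    let p0 := w0 * v1 - w1 * v0 + (w2 * v3 - w3 * v2) in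
    let p1 := w0 * v2 - w2 * v0 + (w3 * v1 - w1 * v3) in
    let p2 := w0 * v3 - w3 * v0 + (w1 * v2 - w2 * v1) in
    let q0 := w0 * v1 - w1 * v0 - (w2 * v3 - w3 * v2) in
    let q1 := w0 * v2 - w2 * v0 - (w3 * v1 - w1 * v3) in
    let q2 := w0 * v3 - w3 * v0 - (w1 * v2 - w2 * v1) in
    c2 (ord3 0) (ord3 0) * (p0 * p0) + c2 (ord3 0) (ord3 1) * (p0 * p1) + c2 (ord3 0) (ord3 2) * (p0 * p2)
      + c2 (ord3 1) (ord3 1) * (p1 * p1) + c2 (ord3 1) (ord3 2) * (p1 * p2) + c2 (ord3 2) (ord3 2) * (p2 * p2)
    + (c3 (ord3 0) (ord3 0) * (p0 * q0) + c3 (ord3 0) (ord3 1) * (p0 * q1) + c3 (ord3 0) (ord3 2) * (p0 * q2)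
      + c3 (ord3 1) (ord3 0) * (p1 * q0) + c3 (ord3 1) (ord3 1) * (p1 * q1) + c3 (ord3 1) (ord3 2) * (p1 * q2)
      + c3 (ord3 2) (ord3 0) * (p2 * q0) + c3 (ord3 2) (ord3 1) * (p2 * q1) + c3 (ord3 2) (ord3 2) * (p2 * q2))
    + (c5 (ord3 0) (ord3 0) * (q0 * q0) + c5 (ord3 0) (ord3 1) * (q0 * q1) + c5 (ord3 0) (ord3 2) * (q0 * q2)
      + c5 (ord3 1) (ord3 0) * (q1 * q0) + c5 (ord3 1) (ord3 1) * (q1 * q1) + c5 (ord3 1) (ord3 2) * (q1 * q2)
      + c5 (ord3 2) (ord3 0) * (q2 * q0) + c5 (ord3 2) (ord3 1) * (q2 * q1) + c5 (ord3 2) (ord3 2) * (q2 * q2)) = 0.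
  move=> p0 p1 p2 q0 q1 q2.
  pose w (i : 'I_4) := [:: w0; w1; w2; w3]`_i; pose v (i : 'I_4) := [:: v0; v1; v2; v3]`_i.
  pose b : 'M[R]_4 := \matrix_(i, j) (w i * v j - w j * v i).
  have sdb i : sd b i = [:: p0; p1; p2]`_i.
    rewrite sdE sum4 !mxE /w /v /p0 /p1 /p2; move: i.
    by elim/ord3_ind; rewrite /somega /flip /=; field.
  have asdb i : asd b i = [:: q0; q1; q2]`_i.
    rewrite asdE sum4 !mxE /w /v /q0 /q1 /q2; move: i.
    by elim/ord3_ind; rewrite /seta /flip /=; field.
  have F1 (i : 'I_3) : \sum_(j < 3 | (i <= j)%N) c2 i j * (sd b i * sd b j)
      = \sum_(j < 3) (if (i <= j)%N then c2 i j * (sd b i * sd b j) else 0).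
    by rewrite big_mkcond.
  have := decomposable_relation w v; rewrite /= -/b; under eq_bigr do rewrite F1.
  rewrite !sum3 !sdb !asdb /= => E0; rewrite -[RHS]E0; ring.
(* For each [i], [k], two test forms with self-dual part along omega_i and anti-self-dual part of
   equal length along eta_k. They differ in the relative sign of the parts, which separates [c3 i k]
   from [c2 i i + c5 k k]. *)
have D : forall i k, c3 i k = 0 /\ c2 i i + c5 k k = 0.
  elim/ord3_ind; elim/ord3_ind.
  - have := E (-1) 0 0 0 0 (-1) 0 0;
    have := E 0 0 (-1) 0 0 0 0 (-1).
    by move=> /= E1 E2; split; lra.
  - have := E (-1) 0 0 1 0 (-1) (-1) 0;
    have := E (-1) 0 0 (-1) 0 (-1) 1 0.
    by move=> /= E1 E2; split; lra.
  - have := E (-1) 0 (-1) 0 0 (-1) 0 (-1);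
    have := E (-1) 0 1 0 0 (-1) 0 1.
    by move=> /= E1 E2; split; lra.
  - have := E (-1) 0 0 (-1) 0 (-1) (-1) 0;
    have := E (-1) 0 0 1 0 1 (-1) 0.
    by move=> /= E1 E2; split; lra.
  - have := E (-1) 0 0 0 0 0 (-1) 0;
    have := E 0 (-1) 0 0 0 0 0 1.
    by move=> /= E1 E2; split; lra.
  - have := E (-1) 1 0 0 0 0 (-1) (-1);
    have := E (-1) (-1) 0 0 0 0 (-1) 1.
    by move=> /= E1 E2; split; lra.
  - have := E (-1) 0 1 0 0 (-1) 0 (-1);
    have := E (-1) 0 (-1) 0 0 1 0 (-1).
    by move=> /= E1 E2; split; lra.
  - have := E (-1) (-1) 0 0 0 0 (-1) (-1);
    have := E (-1) 1 0 0 0 0 1 (-1).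
    by move=> /= E1 E2; split; lra.
  - have := E (-1) 0 0 0 0 0 0 (-1);
    have := E 0 (-1) 0 0 0 0 (-1) 0.
    by move=> /= E1 E2; split; lra.
have c30 i k : c3 i k = 0 by have [] := D i k.
(* By [D] all diagonal entries of [c5] equal [- c2 0 0]; a vanishing trace makes them zero. *)
have c5d k : c5 k k = 0.
  move: tr5; rewrite /mxtrace sum3 => tr5.
  have [_ d0] := D (ord3 0) (ord3 0); have [_ d1] := D (ord3 0) (ord3 1).
  have [_ d2] := D (ord3 0) (ord3 2).
  by move: k; elim/ord3_ind; lra.
have c2d i : c2 i i = 0 by have [_] := D i i; rewrite c5d addr0.
(* Now both parts of each test form have two nonzero coordinates, and the two forms differ in the
   sign of the product [q0 * q1]. The remaining two index pairs are treated alike. *)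
have [e01 f01] : c2 (ord3 0) (ord3 1) = 0 /\ c5 (ord3 0) (ord3 1) = 0.
  have := E (-1) 0 0 0 0 (-1) (-1) 0; have := E (-1) 0 0 (-1) 0 (-1) 0 0.
  by rewrite /= !c30 !c2d !c5d (s5 (ord3 1) (ord3 0)) => E1 E2; split; lra.
have [e02 f02] : c2 (ord3 0) (ord3 2) = 0 /\ c5 (ord3 0) (ord3 2) = 0.
  have := E (-1) 0 0 0 0 (-1) 0 (-1); have := E (-1) 0 1 0 0 (-1) 0 0.
  by rewrite /= !c30 !c2d !c5d (s5 (ord3 2) (ord3 0)) => E1 E2; split; lra.
have [e12 f12] : c2 (ord3 1) (ord3 2) = 0 /\ c5 (ord3 1) (ord3 2) = 0.
  have := E (-1) 0 0 0 0 0 (-1) (-1); have := E (-1) (-1) 0 0 0 0 (-1) 0.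
  by rewrite /= !c30 !c2d !c5d (s5 (ord3 2) (ord3 1)) => E1 E2; split; lra.
split=> //; first by elim/ord3_ind; elim/ord3_ind.
apply/matrixP => i j; rewrite [RHS]mxE; move: i j.
by elim/ord3_ind; elim/ord3_ind => //; rewrite s5.
Qed.

End Independence.

Theorem theorem4p2 (R : realType) :
  (* the listed terms express all second-order invariants *)
  (forall F : SU2_point R -> R, second_order_component F ->
    exists (c1 : 'I_3 -> R) (c2 c3 : 'I_3 -> 'I_3 -> R)
           (c4 : 'I_3 -> 'I_3 -> 'I_3 -> R) (c5 : 'M[R]_3),
      S20_minus c5 /\ eq_highest F (lincomb c1 c2 c3 c4 c5)) /\
  (* and they are linearly independent *)
  (forall (c1 : 'I_3 -> R) (c2 c3 : 'I_3 -> 'I_3 -> R)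
          (c4 : 'I_3 -> 'I_3 -> 'I_3 -> R) (c5 : 'M[R]_3),
    S20_minus c5 ->
    eq_highest (lincomb c1 c2 c3 c4 c5) (fun=> 0) ->
    [/\ forall i, c1 i = 0,
        forall i j : 'I_3, (i <= j)%N -> c2 i j = 0,
        forall i k, c3 i k = 0,
        forall i j k, c4 i j k = 0 &
        c5 = 0]).
Proof.
split=> [F|c1 c2 c3 c4 c5 S5 rel]; first exact: expressible_second_order.
have [c20 c30 c50] := c2_c3_c5_eq0 S5 rel.
split=> // [i|i j k]; first exact: c1_eq0 rel i.
exact: c4_eq0 rel i j k.
Qed.
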